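(* Let $\mathcal A$ be an approximately unital operator algebra and let $Y$ be a right $\mathcal A$-operator module. Then the following are equivalent: (i) $Y$ is a right $\sigma\Delta$-$\mathcal A$-rigged module. (ii) $Y$ is orthogonally complemented in $C_\infty(\mathcal A)$; that is, there exists a left multiplier $P\in M_\ell(C_\infty(\mathcal A))$ with $P$ contractive and $P^2=P$ such that $Y$ is completely isometrically isomorphic, as a right $\mathcal A$-module, to $P(C_\infty(\mathcal A))$.
   Context: Approximately unital means having a contractive approximate identity. $\mathbb B(H,K)$ is the space of bounded operators $H\to K$; for sets of operators, $\overline{[Z\,X]}$ is the norm closure of the linear span of the products $zx$, $z\in Z$, $x\in X$. A right $\mathcal A$-operator module is an operator space with a completely contractive right action of $\mathcal A$. A linear subspace $M\subseteq\mathbb B(H,K)$ is a TRO if $MM^\star M\subseteq M$. A norm closed TRO $M$ is a $\sigma$-TRO if there are sequences $(m_i),(n_j)$ in $M$ with $\lim_n\sum_{i=1}^n m_im_i^\star m=m$ and $\lim_t\sum_{j=1}^t m\,n_j^\star n_j=m$ for all $m\in M$, and $\|\sum_{i=1}^n m_im_i^\star\|\le1$, $\|\sum_{j=1}^t n_j^\star n_j\|\le1$ for all $n,t$. For a concrete approximately unital operator algebra $\mathcal A\subseteq\mathbb B(H)$ and a $\sigma$-TRO $M\subseteq\mathbb B(H,K)$ with $M^\star M\mathcal A\subseteq\mathcal A$, the space $Y_0=\overline{[M\mathcal A]}$ is called a $\sigma$-TRO-$\mathcal A$-rigged module (a right $\mathcal A$-module by operator multiplication). For abstract $\mathcal A$,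 a right $\mathcal A$-module $Y$ (an operator space) is a $\sigma\Delta$-$\mathcal A$-rigged module if there are a completely isometric homomorphism $a:\mathcal A\to a(\mathcal A)\subseteq\mathbb B(H)$, a $\sigma$-TRO-$a(\mathcal A)$-rigged module $Y_0$, and a surjective complete isometry $\rho:Y\to Y_0$ that is a right $\mathcal A$-module map ($\rho(yx)=\rho(y)a(x)$). $C_\infty(\mathcal A)$ is the operator space of infinite columns with entries in $\mathcal A$ (norm closure of the finitely supported columns). $M_\ell(X)$ is the operator space left multiplier algebra of an operator space $X$; ''contractive'' for $P\in M_\ell(X)$ means multiplier norm at most $1$, equivalently the map $\tau_P:C_2(X)\to C_2(X)$, $\tau_P\binom{x}{y}=\binom{P(x)}{y}$, is completely contractive. *)

(* Defs.v *)
From HB Require Import structures.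
From mathcomp Require Import all_boot all_order all_algebra.
From mathcomp Require Import sesquilinear complex.
From mathcomp Require Import all_classical all_reals all_analysis.

Set Implicit Arguments.
Unset Strict Implicit.
Unset Printing Implicit Defensive.

Import Order.TTheory GRing.Theory Num.Theory.
Import numFieldNormedType.Exports.

Local Open Scope classical_set_scope.
Local Open Scope complex_scope.
Local Open Scope ring_scope.

(** ** Matrix norms *)

(* Only the norms on the [M_n(V)]; the axioms of an operator space
   are in [isOperatorSpace] below. *)
HB.mixin Record hasMatrixNorms (R : realType) V & GRing.Lmodule R[i] V := {
  mxnorm : forall n : nat, 'M[V]_n -> R
}.

#[short(type="matrixNormedType")]
HB.structure Definition MatrixNormed (R : realType) :=
  {V of GRing.Lmodule R[i] V & hasMatrixNorms R V}.

Arguments mxnorm {R s n}.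

Section MatrixNorms.
Context {R : realType}.

Definition nrm {V : matrixNormedType R} (x : V) : R :=
  mxnorm (const_mx x : 'M[V]_1).

(* A rectangular matrix is normed as the upper right corner of a square one. *)
Definition rmxnorm {V : matrixNormedType R} m n (x : 'M[V]_(m, n)) : R :=
  mxnorm (block_mx 0 x 0 0 : 'M[V]_(m + n)).

Definition complete_isometry {V W : matrixNormedType R} (f : V -> W) : Prop :=
  forall n (x : 'M[V]_n), mxnorm (map_mx f x) = mxnorm x.

Definition norm_closure {V : matrixNormedType R} (S : set V) : set V :=
  [set x | forall e : R, 0 < e -> exists2 s, S s & nrm (x - s) < e].

Definition lin_span {V : lmodType R[i]} (S : set V) : set V :=
  [set x | exists n (c : 'I_n -> R[i]) (s : 'I_n -> V),
     (forall i, S (s i)) /\ x = \sum_(i < n) c i *: s i].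

Definition linear_subspace {V : lmodType R[i]} (S : set V) : Prop :=
  S 0 /\ forall (c : R[i]) x y, S x -> S y -> S (c *: x + y).

End MatrixNorms.

(** ** Hilbert spaces and bounded operators *)

Record hilbertType (R : realType) := Hilbert {
  hilbert_sort :> completeNormedModType R[i];
  hdot : {dot hilbert_sort for (@Num.conj R[i])};
  hdotE : forall x, `|x| ^+ 2 = hdot x x
}.

Section BoundedOperators.
Context {R : realType}.

Section Type_of_operators.
Variables H K : hilbertType R.

Definition bounded_op_pred : {pred H -> K} :=
  [pred f : H -> K | `[< linear f /\ continuous f >]].

Record bounded_op := BoundedOp {
  bounded_op_fun :> H -> K;
  bounded_op_funP : bounded_op_fun \in bounded_op_pred
}.

HB.instance Definition _ := [isSub for bounded_op_fun].
HB.instance Definition _ := [Choice of bounded_op by <:].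

Lemma bounded_op_submod_closed : submod_closed bounded_op_pred.
Proof.
split=> [|c f g /asboolP[lf cf] /asboolP[lg cg]]; apply/asboolP; split.
- by move=> a x y; rewrite scaler0 addr0.
- by move=> x; exact: cvg_cst.
- move=> a x y; rewrite !fctE lf lg !scalerDr !scalerA mulrC -!addrA.
  by congr (_ + _); rewrite addrCA.
- by move=> x; apply: cvgD; [apply: cvgZr; exact: cf|exact: cg].
Qed.

HB.instance Definition _ :=
  GRing.isSubmodClosed.Build R[i] (H -> K) bounded_op_pred
    bounded_op_submod_closed.
HB.instance Definition _ := [SubChoice_isSubLmodule of bounded_op by <:].

(* The norm of [T] as an operator [H^n -> K^n] between l^2-direct sums. *)
Definition op_mxnorm n (T : 'M[bounded_op]_n) : R :=
  inf [set r : R | 0 <= r /\ forall x : 'I_n -> H,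
    \sum_(i < n) `|\sum_(j < n) T i j (x j)| ^+ 2
      <= r%:C ^+ 2 * \sum_(j < n) `|x j| ^+ 2].

HB.instance Definition _ :=
  hasMatrixNorms.Build R bounded_op (@op_mxnorm).

End Type_of_operators.

Lemma op_comp_subproof (H K L : hilbertType R)
    (S : bounded_op K L) (T : bounded_op H K) :
  (S \o T) \in @bounded_op_pred H L.
Proof.
case: S T => [f /asboolP[lf cf]] [g /asboolP[lg cg]] /=.
apply/asboolP; split; first by move=> a x y /=; rewrite lg lf.
by move=> x; apply: continuous_comp; [exact: cg|exact: cf].
Qed.

Definition op_comp (H K L : hilbertType R)
    (S : bounded_op K L) (T : bounded_op H K) : bounded_op H L :=
  BoundedOp (op_comp_subproof S T).

(* The adjoint exists, by Riesz, and is unique, so the default value [0] is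
   never used. *)
Definition adjoint (H K : hilbertType R) (T : bounded_op H K) :
    bounded_op K H :=
  xget 0 [set S : bounded_op K H |
    forall x y, hdot K (T x) y = hdot H x (S y)].

End BoundedOperators.

Notation "''B' ( H , K )" := (bounded_op H K)
  (at level 8, format "''B' ( H ,  K )") : type_scope.
Notation "S *o T" := (op_comp S T)
  (at level 40, left associativity) : ring_scope.
Notation "T ^adj" := (adjoint T) (at level 2, format "T ^adj") : ring_scope.

(** ** Operator spaces, operator algebras, operator modules *)

HB.mixin Record isOperatorSpace (R : realType) X
    & MatrixNormed R X & CompleteNormedModule R[i] X := {
  mxnorm1 : forall x : X, `|x| = (nrm x)%:C;
  mxnormD : forall n (x y : 'M[X]_n), mxnorm (x + y) <= mxnorm x + mxnorm y;
  mxnormZ : forall n (c : R[i]) (x : 'M[X]_n),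
    (mxnorm (map_mx ( *:%R c) x))%:C = `|c| * (mxnorm x)%:C;
  mxnorm_eq0 : forall n (x : 'M[X]_n), mxnorm x = 0 -> x = 0;
  operator_space_rep : exists (H : hilbertType R) (f : {linear X -> 'B(H, H)}),
    complete_isometry f
}.

#[short(type="operatorSpaceType")]
HB.structure Definition OperatorSpace (R : realType) :=
  {X of MatrixNormed R X & CompleteNormedModule R[i] X & isOperatorSpace R X}.

(* Not necessarily unital, hence not an instance of the ring hierarchy;
   bilinearity and associativity of the product follow from the existence
   of the representation. *)
HB.mixin Record isOperatorAlgebra (R : realType) A & OperatorSpace R A := {
  oamul : A -> A -> A;
  operator_algebra_rep :
    exists (H : hilbertType R) (f : {linear A -> 'B(H, H)}),
      complete_isometry f /\ forall a b, f (oamul a b) = f a *o f b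
}.

#[short(type="operatorAlgebraType")]
HB.structure Definition OperatorAlgebra (R : realType) :=
  {A of OperatorSpace R A & isOperatorAlgebra R A}.

Section Algebras_and_modules.
Context {R : realType}.

(* The net is indexed by a type with a proper filter; a directed set gives the
   filter generated by its upper sections. *)
Definition approximately_unital (A : operatorAlgebraType R) : Prop :=
  exists (I : Type) (F : set_system I) (e : I -> A),
    [/\ ProperFilter F,
        forall i, `|e i| <= 1,
        forall a, oamul (e i) a @[i --> F] --> a &
        forall a, oamul a (e i) @[i --> F] --> a].

(* Complete contractivity of the action is in the sense of Christensen and
   Sinclair, i.e. that of a linear map on the Haagerup tensor product. *)
Definition operator_module (A : operatorAlgebraType R)
    (Y : operatorSpaceType R) (act : Y -> A -> Y) : Prop :=
  [/\ forall a, linear (act^~ a),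
      forall y, linear (act y),
      forall y a b, act (act y a) b = act y (oamul a b) &
      forall n (y : 'M[Y]_n) (a : 'M[A]_n),
        mxnorm (\matrix_(i, j) \sum_(k < n) act (y i k) (a k j))
          <= mxnorm y * mxnorm a].

End Algebras_and_modules.

(** ** TROs and rigged modules *)

Section Rigged_modules.
Context {R : realType}.

Definition is_TRO (H K : hilbertType R) (M : set 'B(H, K)) : Prop :=
  linear_subspace M /\
  forall x y z, M x -> M y -> M z -> M (x *o y^adj *o z).

Definition is_sigma_TRO (H K : hilbertType R) (M : set 'B(H, K)) : Prop :=
  [/\ is_TRO M,
      norm_closure M `<=` M,
      exists m : nat -> 'B(H, K), [/\ forall i, M (m i),
        forall x, M x ->
          nrm ((\sum_(i < n) m i *o (m i)^adj *o x) - x) @[n --> \oo]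
            --> (0 : R) &
        forall n, nrm (\sum_(i < n) m i *o (m i)^adj) <= 1] &
      exists m : nat -> 'B(H, K), [/\ forall j, M (m j),
        forall x, M x ->
          nrm ((\sum_(j < n) x *o (m j)^adj *o m j) - x) @[n --> \oo]
            --> (0 : R) &
        forall n, nrm (\sum_(j < n) (m j)^adj *o m j) <= 1]].

Definition closed_span_comp (H K L : hilbertType R)
    (Z : set 'B(K, L)) (X : set 'B(H, K)) : set 'B(H, L) :=
  norm_closure (lin_span [set z *o x | z in Z & x in X]).

Definition sigma_Delta_rigged (A : operatorAlgebraType R)
    (Y : operatorSpaceType R) (act : Y -> A -> Y) : Prop :=
  exists (H K : hilbertType R) (f : {linear A -> 'B(H, H)})
         (M : set 'B(H, K)) (rho : {linear Y -> 'B(H, K)}),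
    [/\ complete_isometry f /\ forall a b, f (oamul a b) = f a *o f b,
        is_sigma_TRO M /\
          (forall x y a, M x -> M y -> range f (x^adj *o y *o f a)),
        complete_isometry rho,
        range rho = closed_span_comp M (range f) &
        forall y a, rho (act y a) = rho y *o f a].

End Rigged_modules.

(** ** The column space *)

Section Columns.
Context {R : realType}.
Variable X : operatorSpaceType R.

Lemma rmxnormD m n (x y : 'M[X]_(m, n)) :
  rmxnorm (x + y) <= rmxnorm x + rmxnorm y.
Proof.
have := mxnormD _ (block_mx 0 x 0 0 : 'M[X]_(m + n)) (block_mx 0 y 0 0).
by rewrite (add_block_mx 0 x 0 0 0 y 0 0) !addr0.
Qed.

Lemma rmxnormZ m n (c : R[i]) (x : 'M[X]_(m, n)) :
  (rmxnorm (map_mx ( *:%R c) x))%:C = `|c| * (rmxnorm x)%:C.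
Proof.
rewrite /rmxnorm -mxnormZ map_block_mx.
by congr (mxnorm (block_mx _ _ _ _))%:C; apply/matrixP => i j;
  rewrite !mxE scaler0.
Qed.

Definition col_pred : {pred nat -> X} :=
  [pred x : nat -> X | `[< forall e : R, 0 < e -> exists2 y : nat -> X,
    (exists N, forall k, (N <= k)%N -> y k = 0) &
    forall m, rmxnorm (\col_(k < m) (x k - y k)) <= e >]].

Record Cinfty := ColumnOf {
  Cinfty_fun :> nat -> X;
  Cinfty_funP : Cinfty_fun \in col_pred
}.

HB.instance Definition _ := [isSub for Cinfty_fun].
HB.instance Definition _ := [Choice of Cinfty by <:].

Lemma col_submod_closed : submod_closed col_pred.
Proof.
have rn0 m n : rmxnorm (0 : 'M[X]_(m, n)) = 0.
  have := rmxnormZ 0 (0 : 'M[X]_(m, n)).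
  rewrite normr0 mul0r => /(@complexI R _ 0) <-; congr rmxnorm.
  by apply/matrixP => i j; rewrite !mxE scale0r.
split=> [|c x y /asboolP xS /asboolP yS]; apply/asboolP => e e0.
  exists (fun=> 0); first by exists 0%N.
  move=> m; rewrite [X in rmxnorm X](_ : _ = 0) ?rn0 1?ltW//.
  by apply/matrixP => i j; rewrite !mxE subr0.
have [r r0 cr] : exists2 r : R, 0 <= r & `|c| = r%:C.
  by exists (Num.sqrt ((complex.Re c) ^+ 2 + (complex.Im c) ^+ 2));
    [exact: sqrtr_ge0|rewrite normc_def].
have r1 : 0 < r + 1 by rewrite ltr_wpDl.
have [x' [N x'0] xx'] := xS (e / 2 / (r + 1)) ltac:(by rewrite !divr_gt0).
have [y' [N' y'0] yy'] := yS (e / 2) ltac:(by rewrite divr_gt0).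
exists (fun k => c *: x' k + y' k).
  exists (maxn N N') => k; rewrite geq_max => /andP[Nk N'k].
  by rewrite x'0// y'0// scaler0 addr0.
move=> m; pose u := \col_(k < m) (x k - x' k).
pose v := \col_(k < m) (y k - y' k).
rewrite [X in rmxnorm X](_ : _ = map_mx ( *:%R c) u + v); last first.
  apply/matrixP => i j; rewrite !mxE !fctE scalerBr opprD !addrA.
  by congr (_ + _); rewrite addrAC.
apply: le_trans (rmxnormD _ _) _; rewrite [e in _ <= e]splitr lerD ?yy'//.
have /complexI -> : (rmxnorm (map_mx ( *:%R c) u))%:C = (r * rmxnorm u)%:C.
  by rewrite rmxnormZ cr -rmorphM.
apply: le_trans (ler_wpM2l r0 (xx' m)) _.
rewrite mulrCA; apply: ler_piMr; first by rewrite divr_ge0// ltW.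
by rewrite ler_pdivrMr// mul1r lerDl.
Qed.

HB.instance Definition _ :=
  GRing.isSubmodClosed.Build R[i] (nat -> X) col_pred col_submod_closed.
HB.instance Definition _ := [SubChoice_isSubLmodule of Cinfty by <:].

(* An [n] x [n] matrix of columns is regarded as a column of [n] x [n]
   matrices. *)
Definition Cinfty_mxnorm n (x : 'M[Cinfty]_n) : R :=
  sup [set rmxnorm (\mxcol_(k < m) (\matrix_(i < n, j < n) (x i j : nat -> X) k))
      | m in [set: nat]].

HB.instance Definition _ := hasMatrixNorms.Build R Cinfty (@Cinfty_mxnorm).

End Columns.

(** ** Left multipliers *)

(* Definitions of Blecher and Le Merdy: [P] is a left multiplier when it becomes
   left multiplication by an operator [S] in some completely isometric
   representation of [X], and its norm is the infimum of the norms of such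
   [S]. *)
Section Left_multipliers.
Context {R : realType}.
Variable X : matrixNormedType R.

Definition multiplied_by (P : X -> X) (H : hilbertType R) (S : 'B(H, H)) : Prop :=
  exists s : {linear X -> 'B(H, H)},
    complete_isometry s /\ forall x, s (P x) = S *o s x.

Definition left_multiplier (P : {linear X -> X}) : Prop :=
  exists (H : hilbertType R) (S : 'B(H, H)), multiplied_by P S.

Definition multiplier_norm (P : {linear X -> X}) : R :=
  inf [set r | exists (H : hilbertType R) (S : 'B(H, H)),
         multiplied_by P S /\ r = nrm S].

End Left_multipliers.

(* [Cinfty A] is a right [A]-module by entrywise multiplication. *)
Definition orthogonally_complemented_in_columns (R : realType)
    (A : operatorAlgebraType R) (Y : operatorSpaceType R)
    (act : Y -> A -> Y) : Prop :=
  exists P : {linear Cinfty A -> Cinfty A},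
    [/\ left_multiplier P, multiplier_norm P <= 1, forall x, P (P x) = P x &
        exists rho : {linear Y -> Cinfty A},
          [/\ complete_isometry rho, range rho = range P &
              forall y a k, rho (act y a) k = oamul (rho y k) a]].

(* Main.v *)
(** (i) => (ii): for a sequence [m] as in the definition of a sigma-TRO, the
    column [V = (m_i^adj)_i] is a contraction which is isometric on the closed
    span of [M A]; it embeds this span in the columns over [A], and
    left multiplication by [V V^adj] is the required multiplier.

    (ii) => (i): comparing norms of [x a + t P (x a)] and of its image, for
    [P x = 0] and large [t], shows that [P] is a module map. An approximate identity then gives
    [|P(x) h + P(y) k| <= |x h + y k|] in [l^2(H)], for [A] represented on [H],
    so [P] is left multiplication by an orthogonal projection [p] of [l^2(H)].
    The entries [p_kl] multiply [A] into itself and satisfy [p_kl^adj = p_lk];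
    the closed span [M] of all products of a column of [p] by a word in the
    entries is a TRO, [M A] spans the range of [P], and [M] is separable, hence
    a sigma-TRO. For the last point, if [t_k] spans [M] densely and
    [T = sum_k t_k t_k^adj], the iteration [r_0 = 1],
    [r_(j+1) = r_j - r_j T r_j] decreases to [0] on [M], so the elements
    [r_j t_k] form the required sequence. *)

Require Import Defs.
From HB Require Import structures.
From mathcomp Require Import all_boot all_order all_algebra.
From mathcomp Require Import sesquilinear complex.
From mathcomp Require Import all_classical all_reals all_analysis.
From mathcomp Require Import ring lra.

Set Implicit Arguments.
Unset Strict Implicit.
Unset Printing Implicit Defensive.

Import Order.TTheory GRing.Theory Num.Theory.
Import numFieldNormedType.Exports.

Local Open Scope classical_set_scope.
Local Open Scope complex_scope.
Local Open Scope ring_scope.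

(** The obstacle in (ii) => (i) is that a multiplier acts in a representation of the columns on some
    space [H0] unrelated to the representation [colf] by operators [H -> ell2 H], and that the
    infimum in [multiplier_norm] need not be attained. Only norms of matrices pass from one
    representation to the other. Geometric facts on [H0], such as the near orthogonality of the
    range and the kernel of [P], are therefore turned into norm inequalities for matrices of
    columns, with an arbitrarily small loss, and read back in [ell2 H]. Since [A] may have no unit,
    the basis columns are replaced by columns with a single entry from an approximate identity.

    Infinite sums of [t_k t_k^adj] are never formed as limits of operators: the operator
    [V y = (t_k^adj y)_k] into [ell2 H] is bounded, and [V^adj V] is the sum. Partial sums are
    compared with it through quadratic forms, and [pos_sq], that is [|S y|^2 <= C <S y, y>] when
    [0 <= S <= C], converts these comparisons into norm estimates without functional calculus. *)

Lemma ler_sum_term (R : numDomainType) (I : finType) (F : I -> R) j :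
  (forall i, 0 <= F i) -> F j <= \sum_i F i.
Proof.
move=> F0; rewrite [leRHS](bigD1 j) //=.
by rewrite lerDl; apply: sumr_ge0.
Qed.

Lemma ler_sum_below (R : numDomainType) (F : nat -> R) n m :
  (forall k, 0 <= F k) -> \sum_(k < n | (k < m)%N) F k <= \sum_(k < m) F k.
Proof.
move=> F0; rewrite -(big_mkord (fun k => (k < m)%N) F) -(big_mkord xpredT F).
have le n' : \sum_(0 <= k < n' | (k < m)%N) F k <= \sum_(0 <= k < n') F k.
  by rewrite [leLHS]big_mkcond/=; apply: ler_sum => k _; case: ifP.
have [nm|mn] := leqP n m.
  rewrite [leRHS](big_cat_nat (leq0n n) nm)//= ler_wpDr ?le//.
  exact: sumr_ge0.
rewrite [leLHS](big_cat_nat (leq0n m) (ltnW mn))//= [X in _ + X <= _](_ : _ = 0).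
  by rewrite addr0 le.
by rewrite big_nat_cond big1// => k /andP[/andP[mk _]]; rewrite ltnNge mk.
Qed.

Lemma ex_inv_lt (R : realType) (e : R) : 0 < e ->
  exists N, forall n, (N <= n)%N -> n.+1%:R^-1 < e.
Proof.
move=> e0; exists (Num.truncn e^-1) => n Nn.
rewrite invf_plt ?posrE//; apply: lt_le_trans (truncnS_gt _) _.
by rewrite ler_nat.
Qed.

(** * Hilbert spaces with real-valued norms *)

Section RealNorm.
Context {R : realType}.

Definition modc (c : R[i]) : R := complex.Re `|c|.

Lemma modcE (c : R[i]) : `|c| = (modc c)%:C.
Proof. by rewrite RRe_real ?normr_real. Qed.

Lemma modc_ge0 c : 0 <= modc c.
Proof. rewrite -lecR -modcE; exact: normr_ge0. Qed.

Lemma modcR (r : R) : 0 <= r -> modc r%:C = r.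
Proof. by move=> r0; rewrite /modc ger0_norm ?lecR. Qed.

(* The library norm of a complex normed space takes its values in [R[i]]. *)
Definition nr {V : normedModType R[i]} (x : V) : R := complex.Re `|x|.

Variable V : normedModType R[i].
Implicit Types x y : V.

Lemma nrE x : `|x| = (nr x)%:C.
Proof. by rewrite RRe_real ?normr_real. Qed.

Lemma nr_ge0 x : 0 <= nr x.
Proof. rewrite -lecR -nrE; exact: normr_ge0. Qed.

Lemma nrD x y : nr (x + y) <= nr x + nr y.
Proof. by rewrite -lecR rmorphD/= -!nrE ler_normD. Qed.

Lemma nrN x : nr (- x) = nr x.
Proof. by rewrite /nr normrN. Qed.

Lemma nrBC x y : nr (x - y) = nr (y - x).
Proof. by rewrite -nrN opprB. Qed.

Lemma nrZ (c : R[i]) x : nr (c *: x) = modc c * nr x.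
Proof. by apply: (@complexI R); rewrite rmorphM/= -!nrE -modcE normrZ. Qed.

Lemma nrZR (r : R) x : 0 <= r -> nr (r%:C *: x) = r * nr x.
Proof. by move=> r0; rewrite nrZ modcR. Qed.

Lemma nr0 : nr (0 : V) = 0.
Proof. by rewrite /nr normr0. Qed.

Lemma nr0_eq0 x : nr x = 0 -> x = 0.
Proof. by move=> x0; apply/normr0_eq0; rewrite nrE x0. Qed.

Lemma nr_small_eq0 x : (forall e : R, 0 < e -> nr x < e) -> x = 0.
Proof.
move=> h; apply: nr0_eq0; apply/eqP; rewrite eq_le nr_ge0 andbT leNgt.
by apply/negP => x0; have := h _ x0; rewrite ltxx.
Qed.

Lemma nr_triangle y x z : nr (x - z) <= nr (x - y) + nr (y - z).
Proof. by have -> : x - z = (x - y) + (y - z); rewrite ?nrD// addrA subrK. Qed.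

End RealNorm.

Lemma complete_seq (R : realType) (V : completeNormedModType R[i])
    (u : nat -> V) :
  (forall e : R, 0 < e -> exists N, forall m n,
     (N <= m)%N -> (N <= n)%N -> nr (u m - u n) < e) ->
  exists l, forall e : R, 0 < e -> exists N, forall n,
     (N <= n)%N -> nr (u n - l) < e.
Proof.
move=> cu.
have /cauchy_cvgP/cvg_ex[/= l ul] : cauchy (u @ \oo).
  apply/cauchy_ballP => e e0.
  have re : (complex.Re e)%:C = e by rewrite RRe_real// gtr0_real.
  have e0' : 0 < complex.Re e by rewrite -ltcR re.
  have [N uN] := cu _ e0'.
  exists ([set u n | n in [set n | (N <= n)%N]],
          [set u n | n in [set n | (N <= n)%N]]).
    by split; exists N => // n /= Nn; exists n.
  move=> [x y] [/= [m Nm <-] [n Nn <-]].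
  by rewrite -ball_normE/= nrE -re ltcR uN.
exists l => e e0.
have /cvgrPdist_lt/(_ e%:C) := ul.
case; first by rewrite ltcR.
move=> N _ uN; exists N => n Nn.
by have := uN _ Nn; rewrite /= nrE ltcR nrBC.
Qed.

Section InnerProduct.
Context {R : realType} {H : hilbertType R}.
Implicit Types x y z : H.

Definition rdot x y : R := complex.Re (hdot H x y).

Lemma hdotC x y : hdot H x y = conjc (hdot H y x).
Proof. by rewrite hermitian_subproof/= expr0 mul1r. Qed.

Lemma hdotDl x y z : hdot H (x + y) z = hdot H x z + hdot H y z.
Proof. exact: linearDl. Qed.

Lemma hdotZl c x z : hdot H (c *: x) z = c * hdot H x z.
Proof. by rewrite linearZl_LR. Qed.

Lemma hdotDr x y z : hdot H z (x + y) = hdot H z x + hdot H z y.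
Proof. by rewrite [LHS]hdotC hdotDl rmorphD/= -!hdotC. Qed.

Lemma hdotZr c x z : hdot H z (c *: x) = conjc c * hdot H z x.
Proof. by rewrite [LHS]hdotC hdotZl rmorphM/= -!hdotC. Qed.

Lemma rdotC x y : rdot x y = rdot y x.
Proof. by rewrite /rdot hdotC; case: (hdot H y x). Qed.

Lemma rdotDl x y z : rdot (x + y) z = rdot x z + rdot y z.
Proof. by rewrite /rdot hdotDl raddfD. Qed.

Lemma rdotDr x y z : rdot z (x + y) = rdot z x + rdot z y.
Proof. by rewrite /rdot hdotDr raddfD. Qed.

Lemma rdotZl (r : R) x z : rdot (r%:C *: x) z = r * rdot x z.
Proof. by rewrite /rdot hdotZl; case: (hdot H x z) => a b; simpc. Qed.

Lemma rdotZr (r : R) x z : rdot z (r%:C *: x) = r * rdot z x.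
Proof. by rewrite rdotC rdotZl rdotC. Qed.

Lemma rdotNl x z : rdot (- x) z = - rdot x z.
Proof. by have := rdotZl (-1) x z; rewrite rmorphN1 scaleN1r mulN1r. Qed.

Lemma rdotNr x z : rdot z (- x) = - rdot z x.
Proof. by rewrite rdotC rdotNl rdotC. Qed.

Lemma rdot0l z : rdot 0 z = 0.
Proof. by have := rdotZl 0 0 z; rewrite scaler0 mul0r. Qed.

Lemma rdot0r z : rdot z 0 = 0.
Proof. by rewrite rdotC rdot0l. Qed.

Lemma rdotBl x y z : rdot (x - y) z = rdot x z - rdot y z.
Proof. by rewrite rdotDl rdotNl. Qed.

Lemma rdotBr x y z : rdot z (x - y) = rdot z x - rdot z y.
Proof. by rewrite rdotDr rdotNr. Qed.

Definition rdotE := (rdotDl, rdotDr, rdotNl, rdotNr, rdotZl, rdotZr, rdot0l, rdot0r).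

Lemma rdot_suml I (r : seq I) (P : pred I) (F : I -> H) z :
  rdot (\sum_(i <- r | P i) F i) z = \sum_(i <- r | P i) rdot (F i) z.
Proof.
by elim/big_rec2: _ => [|i a b _ <-]; rewrite ?rdot0l ?rdotDl.
Qed.

Lemma rdot_sumr I (r : seq I) (P : pred I) (F : I -> H) z :
  rdot z (\sum_(i <- r | P i) F i) = \sum_(i <- r | P i) rdot z (F i).
Proof. by rewrite rdotC rdot_suml; apply: eq_bigr => i _; rewrite rdotC. Qed.

Lemma nr2 x : nr x ^+ 2 = rdot x x.
Proof. by rewrite /rdot -hdotE nrE -rmorphXn/=. Qed.

Lemma rdotxx_ge0 x : 0 <= rdot x x.
Proof. by rewrite -nr2 sqr_ge0. Qed.

(** The multiples by [1] and ['i] detect the real and the imaginary part. Complex orthogonality thus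
    follows from the real discriminant argument of [psd_cauchy]. *)
Lemma hdot0P x y : (forall c : R[i], rdot (c *: x) y = 0) -> hdot H x y = 0.
Proof.
move=> h; have := h 1; have := h 'i; rewrite /rdot !hdotZl.
case: (hdot H x y) => a b; simpc => hb ha; apply/eqP; rewrite eq_complex/=.
by apply/andP; split; apply/eqP; move: ha hb => /=; lra.
Qed.

Lemma hdot0_rdot x y : hdot H x y = 0 -> rdot x y = 0.
Proof. by rewrite /rdot => ->. Qed.

(** The discriminant of a nonnegative quadratic. It is free of inner products because it serves
    semidefinite forms [rdot (S y) z] as well as, with [a = 0], the arguments in which a linear term
    in [t] must vanish. *)
Lemma psd_cauchy (a b c : R) : 0 <= c ->
  (forall t : R, 0 <= a + 2 * t * b + t ^+ 2 * c) -> b ^+ 2 <= a * c.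
Proof.
move=> c0' h; have [c0|c0] := eqVneq c 0; last first.
  have cp : 0 < c by rewrite lt_def c0.
  have := h (- (b / c)).
  have -> : a + 2 * - (b / c) * b + (- (b / c)) ^+ 2 * c = a - b ^+ 2 / c.
    by field.
  by rewrite subr_ge0 ler_pdivrMr.
(* For [c = 0] the function is affine in [t]; if [b] were nonzero, the next choice of [t] would give
   it the value [-1]. *)
rewrite c0 mulr0; have [->|b0] := eqVneq b 0; first by rewrite expr0n.
have := h (- (a + 1) / (2 * b)); rewrite c0 mulr0 addr0.
have -> : a + 2 * (- (a + 1) / (2 * b)) * b = -1 by field.
by rewrite lerNr oppr0 ler10.
Qed.

Lemma cauchy_schwarz2 x y : rdot x y ^+ 2 <= rdot x x * rdot y y.
Proof.
apply: psd_cauchy => [|t]; first exact: rdotxx_ge0.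
have := rdotxx_ge0 (x + t%:C *: y).
have -> : rdot (x + t%:C *: y) (x + t%:C *: y) =
    rdot x x + 2 * t * rdot x y + t ^+ 2 * rdot y y.
  by rewrite !rdotE (rdotC y x); ring.
by [].
Qed.

Lemma cauchy_schwarz x y : `|rdot x y| <= nr x * nr y.
Proof.
rewrite -(@ler_pXn2r _ 2) ?nnegrE ?mulr_ge0 ?nr_ge0//.
by rewrite real_normK ?num_real// exprMn !nr2 cauchy_schwarz2.
Qed.

Lemma rdot_le x y : rdot x y <= nr x * nr y.
Proof. exact: le_trans (ler_norm _) (cauchy_schwarz _ _). Qed.

Lemma nrD2 x y : nr (x + y) ^+ 2 = nr x ^+ 2 + 2 * rdot x y + nr y ^+ 2.
Proof. by rewrite !nr2 !rdotE (rdotC y x); ring. Qed.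

Lemma nrB2 x y : nr (x - y) ^+ 2 = nr x ^+ 2 - 2 * rdot x y + nr y ^+ 2.
Proof. by rewrite nrD2 rdotNr nrN; ring. Qed.

Lemma parallelogram x y :
  nr (x + y) ^+ 2 + nr (x - y) ^+ 2 = 2 * nr x ^+ 2 + 2 * nr y ^+ 2.
Proof. by rewrite nrD2 nrB2; ring. Qed.

Lemma rdot_ext x y : (forall z, rdot z x = rdot z y) -> x = y.
Proof.
move=> h; apply/eqP; rewrite -subr_eq0; apply/eqP/nr0_eq0/eqP.
by rewrite -(@eqrXn2 _ 2) ?nr_ge0// expr0n/= nr2 rdotBr h subrr.
Qed.

Lemma nr_le_dot x (C : R) : 0 <= C -> (forall y, rdot x y <= C * nr y) -> nr x <= C.
Proof.
move=> C0 h; have := h x; rewrite -nr2 expr2.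
have [->|x0] := eqVneq (nr x) 0; first by [].
by rewrite ler_pM2r // lt_def x0 nr_ge0.
Qed.

End InnerProduct.

Definition approx_closed (R : realType) (V : normedModType R[i]) (C : set V) :=
  forall x, (forall e : R, 0 < e -> exists2 c, C c & nr (x - c) < e) -> C x.

Lemma sum_real_complex (R : realType) I (r : seq I) (P : pred I) (F : I -> R) :
  \sum_(i <- r | P i) (F i)%:C = (\sum_(i <- r | P i) F i)%:C.
Proof. by rewrite rmorph_sum. Qed.

(** * Orthogonal projection onto closed subspaces *)

Section Projection.
Context {R : realType} {H : hilbertType R}.
Variable C : set H.
Hypothesis C0 : C 0.
Hypothesis CD : forall (c : R[i]) x y, C x -> C y -> C (c *: x + y).
Hypothesis Ccl : approx_closed C.

Lemma subsp_add x y : C x -> C y -> C (x + y).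
Proof. by move=> Cx Cy; rewrite -[x]scale1r; exact: CD. Qed.

Lemma subsp_scale c x : C x -> C (c *: x).
Proof. by move=> Cx; rewrite -[_ *: _]addr0; exact: CD. Qed.

(* Minimizing sequences are Cauchy by the parallelogram identity. *)
Lemma min_dist (x : H) :
  exists2 y, C y & forall c, C c -> nr (x - y) <= nr (x - c).
Proof.
pose D := [set nr (x - c) ^+ 2 | c in C].
have Dlb : lbound D 0 by move=> _ [c _ <-]; exact: sqr_ge0.
have Dinf : has_inf D.
  by split; [exists (nr (x - 0) ^+ 2); exists 0|exists 0].
pose d := inf D.
have dD c : C c -> d <= nr (x - c) ^+ 2.
  by move=> Cc; apply: ge_inf; [exists 0|exists c].
have approx (n : nat) : exists2 c, C c & nr (x - c) ^+ 2 < d + n.+1%:R^-1.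
  have [_ [c Cc <-] h] := inf_adherent (ltac:(by rewrite invr_gt0) : 0 < n.+1%:R^-1 :> R) Dinf.
  by exists c.
pose u n := projT1 (cid2 (approx n)).
have Cu n : C (u n) by rewrite /u; case: cid2.
have ud n : nr (x - u n) ^+ 2 < d + n.+1%:R^-1 by rewrite /u; case: cid2.
have cu m n : nr (u m - u n) ^+ 2 <= 2 * m.+1%:R^-1 + 2 * n.+1%:R^-1.
  have := parallelogram (x - u m) (x - u n).
  have -> : x - u m - (x - u n) = - (u m - u n).
    by rewrite !opprB addrC addrA subrK.
  rewrite nrN.
  have -> : x - u m + (x - u n) = 2%:R%:C *: (x - 2^-1%:C *: (u m + u n)).
    rewrite scalerBr scalerA -rmorphM/= mulfV ?pnatr_eq0// scale1r.
    by rewrite rmorph_nat scaler_nat mulr2n opprD addrACA.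
  rewrite nrZR// exprMn.
  have := dD _ (subsp_scale 2^-1%:C (subsp_add (Cu m) (Cu n))).
  have := ud m; have := ud n.
  move: (nr (x - u n) ^+ 2) (nr (x - u m) ^+ 2) (nr (u m - u n) ^+ 2).
  move: (nr (x - _) ^+ 2) m.+1%:R^-1 n.+1%:R^-1 (d) => a p q d' b c e.
  lra.
have [|y uy] := complete_seq (u := u).
  move=> e e0; have e2 : 0 < e ^+ 2 / 4 by rewrite divr_gt0// exprn_gt0.
  have [N hN] := ex_inv_lt e2; exists N => m n Nm Nn.
  rewrite -(@ltr_pXn2r _ 2) ?nnegrE ?nr_ge0 ?(ltW e0)//.
  apply: le_lt_trans (cu m n) _.
  have := hN _ Nm; have := hN _ Nn.
  by move: m.+1%:R^-1 n.+1%:R^-1 => p q; lra.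
exists y.
  apply: Ccl => e e0; have [N /(_ N (leqnn _)) h] := uy _ e0.
  by exists (u N) => //; rewrite nrBC.
move=> c Cc; apply/ler_addgt0Pr => e e0.
have xcd : d <= nr (x - c) ^+ 2 := dD _ Cc.
have e2 : 0 < e / 2 by rewrite divr_gt0.
have [N hN] := uy _ e2.
have ee : 0 < (e / 2) ^+ 2 by rewrite exprn_gt0.
have [N' hN'] := ex_inv_lt ee.
pose n := maxn N N'; have hn := hN n (leq_maxl _ _).
have hn' := hN' n (leq_maxr _ _).
have : nr (x - u n) <= nr (x - c) + e / 2.
  rewrite -(@ler_pXn2r _ 2) ?nnegrE ?nr_ge0 ?addr_ge0 ?nr_ge0 ?(ltW e2)//.
  have := ud n; rewrite sqrrD.
  have : 0 <= nr (x - c) * (e / 2) *+ 2 by apply/mulrn_wge0/mulr_ge0; [exact: nr_ge0|exact: ltW].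
  by move: hn' xcd; move: n.+1%:R^-1 (nr (x - c) * (e / 2) *+ 2) (d) => p q d'; lra.
by have := nr_triangle (u n) x y; lra.
Qed.

(** Moving the nearest point [y] along [a *: c] does not decrease the distance, so a quadratic in
    [t] without constant term is nonnegative and its linear coefficient vanishes. Complex [a] give
    the full inner product. *)
Lemma proj_exists (x : H) :
  exists2 y, C y & forall c, C c -> hdot H (x - y) c = 0.
Proof.
have [y Cy ymin] := min_dist x; exists y => // c Cc.
rewrite hdotC hdot0P ?conjc0// => a.
have : rdot (x - y) (a *: c) ^+ 2 <= 0 * rdot (a *: c) (a *: c).
  apply: psd_cauchy => [|t]; first exact: rdotxx_ge0.
  have /ymin : C (y + - t%:C *: (a *: c)).
    by rewrite addrC; apply: CD => //; exact: subsp_scale.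
  rewrite scaleNr opprD opprK addrA.
  rewrite -(@ler_pXn2r _ 2) ?nnegrE ?nr_ge0// [in leRHS]nrD2.
  by rewrite [nr (t%:C *: _) ^+ 2]nr2 !(rdotZl, rdotZr); lra.
rewrite mul0r => h; apply/eqP; rewrite rdotC -(@sqrf_eq0 R).
by rewrite eq_le h sqr_ge0.
Qed.

End Projection.

(** * Bounded operators and adjoints *)

Section BoundedOp.
Context {R : realType}.

Section OneOp.
Variables H K : hilbertType R.
Implicit Types S T : 'B(H, K).

Lemma bop_linear T : linear T.
Proof. by case: T => f /= /asboolP[]. Qed.

Lemma bopP S T : (forall x, S x = T x) -> S = T.
Proof. by move=> h; apply: val_inj; apply/funext. Qed.

Lemma bopDE S T x : (S + T) x = S x + T x. Proof. by []. Qed.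
Lemma bopNE T x : (- T) x = - T x. Proof. by []. Qed.
Lemma bopBE S T x : (S - T) x = S x - T x. Proof. by []. Qed.
Lemma bopZE c T x : (c *: T) x = c *: T x. Proof. by []. Qed.
Lemma bop0E x : (0 : 'B(H, K)) x = 0. Proof. by []. Qed.

Lemma bop_sumE I (r : seq I) (P : pred I) (F : I -> 'B(H, K)) x :
  (\sum_(i <- r | P i) F i) x = \sum_(i <- r | P i) F i x.
Proof. by elim/big_rec2: _ => [|i a b _ <-]. Qed.

Lemma bopD T x y : T (x + y) = T x + T y.
Proof. by have := bop_linear T 1 x y; rewrite !scale1r. Qed.

Lemma bop0 T : T 0 = 0.
Proof. by apply: (addrI (T 0)); rewrite -bopD !addr0. Qed.

Lemma bopZ T c x : T (c *: x) = c *: T x.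
Proof. by have := bop_linear T c x 0; rewrite bop0 !addr0. Qed.

Lemma bopN T x : T (- x) = - T x.
Proof. by rewrite -scaleN1r bopZ scaleN1r. Qed.

Lemma bopB T x y : T (x - y) = T x - T y.
Proof. by rewrite bopD bopN. Qed.

Lemma bop_sum T I (r : seq I) (P : pred I) (F : I -> H) :
  T (\sum_(i <- r | P i) F i) = \sum_(i <- r | P i) T (F i).
Proof. by elim/big_rec2: _ => [|i a b _ <-]; rewrite ?bop0 ?bopD. Qed.

Lemma bop_bounded T : exists2 C : R, 0 <= C & forall x, nr (T x) <= C * nr x.
Proof.
have cT : continuous T by case: T => f /= /asboolP[].
have /cvgrPdist_lt/(_ 1 ltr01) := cT 0.
move=> /(nbhs_ballP (0 : H) _).1[/= e e0 Te].
pose r := complex.Re e; have re : r%:C = e by rewrite RRe_real// gtr0_real.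
have r0 : 0 < r by rewrite -ltcR re.
exists (2 / r) => [|x]; first by rewrite divr_ge0// ltW.
have [->|x0] := eqVneq x 0; first by rewrite bop0 !nr0 mulr0.
have nx : 0 < nr x.
  by rewrite lt_def nr_ge0 andbT; apply: contraNneq x0 => /nr0_eq0 ->.
(* This scales [x] to norm [r / 2], inside the ball provided by continuity at [0]. *)
pose c := r / 2 / nr x; have c0 : 0 < c by rewrite !divr_gt0.
have /Te : ball (0 : H) e (c%:C *: x).
  rewrite -ball_normE /= sub0r nrE nrN nrZR ?(ltW c0)// -re ltcR.
  by rewrite /c divfK ?gt_eqF// ltr_pdivrMr// mulr_natr mulr2n ltrDl.
rewrite /= bop0 sub0r nrE nrN bopZ nrZR ?(ltW c0)//.
rewrite (_ : 1 = 1%:C)// ltcR => /ltW h.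
have -> : 2 / r * nr x = 1 / c by rewrite /c; field; rewrite !gt_eqF.
by rewrite ler_pdivlMr// mulrC.
Qed.

Lemma bounded_op_subproof (f : H -> K) (C : R) :
  linear f -> (forall x, nr (f x) <= C * nr x) -> f \in @bounded_op_pred R H K.
Proof.
move=> lf fC; apply/asboolP; split=> // x.
pose D := Num.max C 1; have D0 : 0 < D by rewrite lt_max ltr01 orbT.
apply/cvgrPdist_lt => e e0; apply/nbhs_ballP.
have re : (complex.Re e)%:C = e by rewrite RRe_real// gtr0_real.
have e0' : 0 < complex.Re e by rewrite -ltcR re.
exists (complex.Re e / D)%:C => /=; first by rewrite ltcR divr_gt0.
move=> y; rewrite -ball_normE/= nrE ltcR ltr_pdivlMr// => xy.
have -> : f x - f y = f (x - y).
  by rewrite addrC -scaleN1r -lf scaleN1r addrC.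
rewrite nrE -re ltcR; apply: le_lt_trans xy; apply: le_trans (fC _) _.
by rewrite mulrC ler_wpM2l ?nr_ge0// le_max lexx.
Qed.

Definition mkbop (f : H -> K) (C : R) (lf : linear f)
    (fC : forall x, nr (f x) <= C * nr x) : 'B(H, K) :=
  BoundedOp (bounded_op_subproof lf fC).

Definition mxbound n (T : 'M['B(H, K)]_n) (r : R) := forall x : 'I_n -> H,
  \sum_i nr (\sum_j T i j (x j)) ^+ 2 <= r ^+ 2 * \sum_j nr (x j) ^+ 2.

Lemma op_mxnormE n (T : 'M['B(H, K)]_n) :
  mxnorm T = inf [set r : R | 0 <= r /\ mxbound T r].
Proof.
have sE (V : normedModType R[i]) (x : 'I_n -> V) :
    \sum_i `|x i| ^+ 2 = (\sum_i nr (x i) ^+ 2)%:C.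
  by rewrite -sum_real_complex; apply: eq_bigr => i _; rewrite nrE -rmorphXn.
have rE (r s : R) : r%:C ^+ 2 * s%:C = (r ^+ 2 * s)%:C by rewrite rmorphM rmorphXn.
by congr inf; apply/seteqP; split => r [r0 h]; split=> // x; have := h x;
  rewrite !sE rE lecR.
Qed.

(** Makes the set under the infimum of [op_mxnorm] nonempty. The constant is crude: each entry of
    the image is at most [D] times the norm of [x], and the sum of [n] squares is estimated with
    [n <= n ^ 2]. *)
Lemma mxbound_exists n (T : 'M['B(H, K)]_n) : exists2 r : R, 0 <= r & mxbound T r.
Proof.
pose c i j := s2val (cid2 (bop_bounded (T i j))).
have c0 i j : 0 <= c i j by rewrite /c; case: cid2.
have cT i j x : nr (T i j x) <= c i j * nr x by rewrite /c; case: cid2.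
pose D := \sum_i \sum_j c i j.
have D0 : 0 <= D by apply: sumr_ge0 => i _; apply: sumr_ge0.
exists (n%:R * D) => [|x]; first by rewrite mulr_ge0.
set N := \sum_j nr (x j) ^+ 2; have N0 : 0 <= N by apply: sumr_ge0 => i _; exact: sqr_ge0.
have xN j : nr (x j) <= Num.sqrt N.
  rewrite -(@ler_pXn2r _ 2) ?nnegrE ?nr_ge0 ?sqrtr_ge0// sqr_sqrtr//.
  by apply: (@ler_sum_term _ _ (fun j => nr (x j) ^+ 2)) => i; exact: sqr_ge0.
have le i : nr (\sum_j T i j (x j)) <= D * Num.sqrt N.
  apply: (@le_trans _ _ (\sum_j c i j * Num.sqrt N)).
    elim/big_rec2: _ => [|j a b _ h]; first by rewrite nr0.
    apply: le_trans (nrD _ _) _; apply: lerD h.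
    by apply: le_trans (cT _ _ _) _; rewrite ler_wpM2l.
  rewrite -mulr_suml ler_wpM2r ?sqrtr_ge0//.
  by apply: (@ler_sum_term _ _ (fun i => \sum_j c i j)) => k; exact: sumr_ge0.
apply: (@le_trans _ _ (\sum_(i < n) D ^+ 2 * N)).
  apply: ler_sum => i _; rewrite -[N in leRHS]sqr_sqrtr// -exprMn.
  by rewrite ler_pXn2r ?nnegrE ?nr_ge0 ?mulr_ge0 ?sqrtr_ge0.
rewrite sumr_const card_ord -[leLHS]mulr_natl.
have -> : (n%:R * D) ^+ 2 * N = n%:R ^+ 2 * (D ^+ 2 * N) by rewrite exprMn mulrA.
rewrite ler_wpM2r ?mulr_ge0 ?sqr_ge0// -natrX ler_nat.
by case: n {T c c0 cT D D0 x N N0 xN le} => // n; rewrite -mulnn leq_pmulr.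
Qed.

Lemma op_mxnorm_ge0 n (T : 'M['B(H, K)]_n) : 0 <= mxnorm T.
Proof.
rewrite op_mxnormE; apply: lb_le_inf; last by move=> r [].
by have [r r0 h] := mxbound_exists T; exists r.
Qed.

(** The infimum is attained: for a fixed vector the inequality survives the passage to the limit in
    nearly optimal constants. *)
Lemma op_mxnormP n (T : 'M['B(H, K)]_n) r : 0 <= r -> mxnorm T <= r <-> mxbound T r.
Proof.
move=> r0; rewrite op_mxnormE; split=> [h x|h]; last first.
  by apply: ge_inf; [exists 0 => s []|].
set N := \sum_j nr (x j) ^+ 2; have N0 : 0 <= N by apply: sumr_ge0 => i _; exact: sqr_ge0.
have hi : has_inf [set r : R | 0 <= r /\ mxbound T r].
  split; last by exists 0 => s [].
  by have [s s0 hs] := mxbound_exists T; exists s.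
apply/ler_addgt0Pr => e e0.
(* With [f <= d] and [f <= 1], the excess [(r + f) ^+ 2 * N - r ^+ 2 * N = f * ((2 * r + f) * N)] is
   at most [e]. *)
pose d := e / ((2 * r + 1) * (N + 1)).
have M0 : 0 < (2 * r + 1) * (N + 1) by rewrite mulr_gt0// ltr_wpDl// mulr_ge0.
have d0 : 0 < d by rewrite divr_gt0.
pose f := Num.min d 1; have f0 : 0 < f by rewrite lt_min d0 ltr01.
have [s [s0 hs] sr] := inf_adherent f0 hi.
apply: le_trans (hs x) _.
have sr' : s <= r + f by apply: ltW; apply: lt_le_trans sr _; rewrite lerD2r.
apply: (@le_trans _ _ ((r + f) ^+ 2 * N)).
  by rewrite ler_wpM2r// ler_pXn2r ?nnegrE// addr_ge0// ltW.
have -> : (r + f) ^+ 2 * N = r ^+ 2 * N + f * ((2 * r + f) * N) by ring.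
rewrite lerD2l.
have f1 : f <= 1 by rewrite ge_min lexx orbT.
have fd : f <= d by rewrite ge_min lexx.
apply: (@le_trans _ _ (d * ((2 * r + 1) * (N + 1)))); last by rewrite /d divfK// gt_eqF.
apply: ler_pM => //; first exact: ltW.
  by rewrite mulr_ge0// addr_ge0 ?mulr_ge0// ltW.
by apply: ler_pM; rewrite ?lerD2l ?lerDl// addr_ge0 ?mulr_ge0// ltW.
Qed.

Lemma op_mxnorm_bound n (T : 'M['B(H, K)]_n) : mxbound T (mxnorm T).
Proof. exact: ((@op_mxnormP _ T _ (op_mxnorm_ge0 T)).1 (lexx _)). Qed.

Lemma nrm_ge0 T : 0 <= nrm T.
Proof. exact: op_mxnorm_ge0. Qed.

Lemma nrmP T r : 0 <= r -> nrm T <= r <-> forall x, nr (T x) <= r * nr x.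
Proof.
move=> r0; apply: iff_trans; first exact: op_mxnormP.
split=> h x.
  have := h (fun=> x); rewrite !big_ord1 !mxE -exprMn.
  by rewrite ler_pXn2r ?nnegrE ?mulr_ge0 ?nr_ge0.
rewrite !big_ord1 !mxE -exprMn.
by rewrite ler_pXn2r ?nnegrE ?mulr_ge0 ?nr_ge0.
Qed.

Lemma nrm_bound T x : nr (T x) <= nrm T * nr x.
Proof. exact: ((@nrmP T _ (nrm_ge0 T)).1 (lexx _) x). Qed.

Lemma nrm_boundC T r x : nrm T <= r -> nr (T x) <= r * nr x.
Proof. by move=> h; apply: le_trans (nrm_bound _ _) _; rewrite ler_wpM2r ?nr_ge0. Qed.

Lemma nrmD S T : nrm (S + T) <= nrm S + nrm T.
Proof.
apply/nrmP => [|x]; first by rewrite addr_ge0 ?nrm_ge0.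
by apply: le_trans (nrD _ _) _; rewrite mulrDl lerD ?nrm_bound.
Qed.

Lemma nrm0 : nrm (0 : 'B(H, K)) = 0.
Proof.
apply/eqP; rewrite eq_le nrm_ge0 andbT; apply/nrmP => // x.
by rewrite bop0E nr0 mul0r.
Qed.

Lemma nrm0_eq0 T : nrm T = 0 -> T = 0.
Proof.
move=> h; apply: bopP => x; apply: nr0_eq0; apply/eqP; rewrite eq_le nr_ge0 andbT.
by have := nrm_bound T x; rewrite h mul0r.
Qed.

Lemma nrmZ_le c T : nrm (c *: T) <= modc c * nrm T.
Proof.
apply/nrmP => [|x]; first by rewrite mulr_ge0 ?modc_ge0 ?nrm_ge0.
by rewrite bopZE nrZ -mulrA ler_wpM2l ?modc_ge0// nrm_bound.
Qed.

Lemma nrmN T : nrm (- T) = nrm T.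
Proof.
suff h S : nrm (- S) <= nrm S.
  by apply/eqP; rewrite eq_le h -{1}[T]opprK h.
by apply/nrmP => [|x]; rewrite ?nrm_ge0// bopNE nrN nrm_bound.
Qed.

Lemma nrmBC S T : nrm (S - T) = nrm (T - S).
Proof. by rewrite -nrmN opprB. Qed.

Lemma nrm_triangle S T U : nrm (S - U) <= nrm (S - T) + nrm (T - U).
Proof. by have -> : S - U = (S - T) + (T - U); rewrite ?nrmD// addrA subrK. Qed.

Lemma nrm_sum I (r : seq I) (P : pred I) (F : I -> 'B(H, K)) :
  nrm (\sum_(i <- r | P i) F i) <= \sum_(i <- r | P i) nrm (F i).
Proof.
elim/big_rec2: _ => [|i a b _ h]; first by rewrite nrm0.
by apply: le_trans (nrmD _ _) _; rewrite lerD2l.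
Qed.

Lemma nrm_small_eq0 T : (forall e : R, 0 < e -> nrm T < e) -> T = 0.
Proof.
move=> h; apply: nrm0_eq0; apply/eqP; rewrite eq_le nrm_ge0 andbT leNgt.
by apply/negP => x0; have := h _ x0; rewrite ltxx.
Qed.

End OneOp.

Definition bop1 (H : hilbertType R) : 'B(H, H) :=
  @mkbop H H id 1 (fun _ _ _ => erefl) (fun x => eq_ind_r (fun t => nr x <= t) (lexx _) (mul1r _)).

(** * Riesz representation and adjoints *)

Section Adjoint.
Variables H K : hilbertType R.

(** Boundedness makes the kernel closed, and the component [u] of some [x0] orthogonal to it spans
    its complement, so a multiple of [u] represents [phi]. The scalar is conjugated because [hdot]
    is linear in its first argument; [Num.max C 0] guards against a negative [C]. *)
Lemma riesz (phi : H -> R[i]) (C : R) :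
  (forall a x y, phi (a *: x + y) = a * phi x + phi y) ->
  (forall x, modc (phi x) <= C * nr x) ->
  exists z, forall x, phi x = hdot H x z.
Proof.
move=> lphi bphi.
have phiD x y : phi (x + y) = phi x + phi y by rewrite -[x]scale1r lphi scale1r mul1r.
have phi0 : phi 0 = 0 by apply: (addrI (phi 0)); rewrite -phiD !addr0.
have phiZ a x : phi (a *: x) = a * phi x by rewrite -[_ *: _]addr0 lphi phi0 addr0.
have phiB x y : phi (x - y) = phi x - phi y.
  by rewrite phiD -scaleN1r phiZ mulN1r.
have [/(_ _)/contrapT h0|/existsNP[x0 nx0]] := pselect (forall x, ~ ~ (phi x = 0)).
  by exists 0 => x; rewrite h0 linear0r.
pose N := [set x | phi x = 0].
have C0 : 0 <= Num.max C 0 by rewrite le_max lexx orbT.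
have Ncl : approx_closed N.
  move=> x h; apply/eqP; rewrite -normr_eq0 modcE; apply/eqP; congr (_%:C).
  apply/eqP; rewrite eq_le modc_ge0 andbT; apply/ler_addgt0Pl => e e0; rewrite addr0.
  have M0 : 0 < Num.max C 0 + 1 by rewrite ltr_wpDl.
  have [c Nc xc] := h (e / (Num.max C 0 + 1)) ltac:(by rewrite divr_gt0).
  have -> : phi x = phi (x - c) by rewrite phiB Nc subr0.
  apply: le_trans (bphi _) _; move: xc; rewrite ltr_pdivlMr// => /ltW.
  apply: le_trans; rewrite mulrC ler_wpM2l ?nr_ge0//.
  by apply: le_trans (_ : Num.max C 0 <= _); rewrite ?le_max ?lexx// lerDl.
have N0 : N 0 by [].
have ND c x y : N x -> N y -> N (c *: x + y) by rewrite /N/= lphi => -> ->; rewrite mulr0 addr0.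
have [y Ny ort] := proj_exists N0 ND Ncl x0.
pose u := x0 - y.
have pu : phi u != 0 by rewrite /u phiB Ny subr0; apply/eqP => h; apply: nx0.
have uu : hdot H u u != 0.
  rewrite -hdotE sqrf_eq0 normr_eq0; apply: contraNneq pu => ->; exact/eqP.
exists (conjc (phi u / hdot H u u) *: u) => x.
rewrite hdotZr conjcK.
have : N (x - (phi x / phi u) *: u) by rewrite /N/= phiB phiZ divfK// subrr.
move=> /ort; rewrite -/u => /(congr1 conjc); rewrite conjc0 -hdotC.
rewrite hdotDl -scaleNr hdotZl => /eqP; rewrite addrC addr_eq0 => /eqP h.
have -> : hdot H x u = phi x / phi u * hdot H u u by rewrite -[LHS]opprK -h mulNr opprK.
by field; apply/andP; split.
Qed.

(** A unimodular factor [c] turns the inner product into its modulus, which reduces the claim to the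
    real Cauchy-Schwarz inequality. *)
Lemma modc_hdot (L : hilbertType R) (x y : L) : modc (hdot L x y) <= nr x * nr y.
Proof.
have [->|nz] := eqVneq (hdot L x y) 0; first by rewrite /modc normr0 mulr_ge0 ?nr_ge0.
have nz' : `|hdot L x y| != 0 by rewrite normr_eq0.
pose c := conjc (hdot L x y) / `|hdot L x y|.
have c1 : modc c = 1.
  by apply: (@complexI R); rewrite -modcE /c normrM normfV normr_id normcJ divff.
have : rdot (c *: x) y <= nr (c *: x) * nr y := rdot_le _ _.
rewrite nrZ c1 mul1r; congr (_ <= _); rewrite /rdot hdotZl /c.
have -> : (hdot L x y)^*%C / `|hdot L x y| * hdot L x y = `|hdot L x y|.
  by rewrite mulrAC [_^*%C * _]mulrC -sqr_normc expr2 mulfK.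
by [].
Qed.

Lemma adjoint_exists (T : 'B(H, K)) :
  exists S : 'B(K, H), forall x y, hdot K (T x) y = hdot H x (S y).
Proof.
have h y : exists z, forall x, hdot K (T x) y = hdot H x z.
  apply: (@riesz _ (nrm T * nr y)) => [a x x'|x].
    by rewrite bopD bopZ hdotDl hdotZl.
  apply: le_trans (modc_hdot _ _) _.
  by rewrite mulrAC ler_wpM2r ?nr_ge0// nrm_bound.
have [s hs] := choice h.
have ls : linear s.
  move=> a y y'; apply: rdot_ext => z; rewrite /rdot -hs !hdotDr !hdotZr.
  by rewrite !hs.
have bs y : nr (s y) <= nrm T * nr y.
  apply: nr_le_dot => [|x]; first by rewrite mulr_ge0 ?nrm_ge0 ?nr_ge0.
  rewrite rdotC /rdot -hs; apply: le_trans (rdot_le _ _) _.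
  by rewrite mulrAC ler_wpM2r ?nr_ge0// nrm_bound.
by exists (mkbop ls bs).
Qed.

Lemma adjP (T : 'B(H, K)) x y : hdot K (T x) y = hdot H x (T^adj y).
Proof. by have := xgetPex 0 (adjoint_exists T); apply. Qed.

Lemma radjP (T : 'B(H, K)) x y : rdot (T x) y = rdot x (T^adj y).
Proof. by rewrite /rdot adjP. Qed.

End Adjoint.

Lemma adj_uniq (H K : hilbertType R) (T : 'B(H, K)) (S : 'B(K, H)) :
  (forall x y, rdot (T x) y = rdot x (S y)) -> T^adj = S.
Proof. by move=> h; apply: bopP => y; apply: rdot_ext => x; rewrite -radjP h. Qed.

Lemma adjK (H K : hilbertType R) (T : 'B(H, K)) : T^adj^adj = T.
Proof. by apply: adj_uniq => x y; rewrite rdotC -radjP rdotC. Qed.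

Lemma radjP' (H K : hilbertType R) (T : 'B(H, K)) x y : rdot (T^adj y) x = rdot y (T x).
Proof. by rewrite rdotC -radjP rdotC. Qed.

Lemma adj_comp (H K L : hilbertType R) (S : 'B(K, L)) (T : 'B(H, K)) :
  (S *o T)^adj = T^adj *o S^adj.
Proof. by apply: adj_uniq => x y; rewrite /= !radjP. Qed.

Lemma adjD (H K : hilbertType R) (S T : 'B(H, K)) : (S + T)^adj = S^adj + T^adj.
Proof. by apply: adj_uniq => x y; rewrite !bopDE rdotDl rdotDr !radjP. Qed.

Lemma adjZ (H K : hilbertType R) c (T : 'B(H, K)) : (c *: T)^adj = conjc c *: T^adj.
Proof.
apply: adj_uniq => x y; rewrite !bopZE /rdot hdotZl hdotZr conjcK adjP //.
Qed.

Lemma adj0 (H K : hilbertType R) : (0 : 'B(H, K))^adj = 0.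
Proof. by apply: adj_uniq => x y; rewrite !bop0E rdot0l rdot0r. Qed.

Lemma adjN (H K : hilbertType R) (T : 'B(H, K)) : (- T)^adj = - T^adj.
Proof. by apply: adj_uniq => x y; rewrite !bopNE rdotNl rdotNr radjP. Qed.

Lemma adjB (H K : hilbertType R) (S T : 'B(H, K)) : (S - T)^adj = S^adj - T^adj.
Proof. by rewrite adjD adjN. Qed.

Lemma adj_sum (H K : hilbertType R) I (r : seq I) (P : pred I) (F : I -> 'B(H, K)) :
  (\sum_(i <- r | P i) F i)^adj = \sum_(i <- r | P i) (F i)^adj.
Proof. by elim/big_rec2: _ => [|i a b _ <-]; rewrite ?adj0 ?adjD. Qed.

Lemma adj1 (H : hilbertType R) : (bop1 H)^adj = bop1 H.
Proof. by apply: adj_uniq. Qed.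

Lemma nrm_adj (H K : hilbertType R) (T : 'B(H, K)) : nrm T^adj = nrm T.
Proof.
suff h (H' K' : hilbertType R) (S : 'B(H', K')) : nrm S^adj <= nrm S.
  by apply/eqP; rewrite eq_le h -{1}[T]adjK h.
apply/nrmP => [|y]; first exact: nrm_ge0.
apply: nr_le_dot => [|x]; first by rewrite mulr_ge0 ?nrm_ge0 ?nr_ge0.
rewrite radjP'; apply: le_trans (rdot_le _ _) _.
by rewrite mulrC mulrAC ler_wpM2r ?nr_ge0// nrm_bound.
Qed.

Lemma nrm_comp (H K L : hilbertType R) (S : 'B(K, L)) (T : 'B(H, K)) :
  nrm (S *o T) <= nrm S * nrm T.
Proof.
apply/nrmP => [|x]; first by rewrite mulr_ge0 ?nrm_ge0.
apply: le_trans (nrm_bound S (T x)) _.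
by rewrite -mulrA ler_wpM2l ?nrm_ge0 ?nrm_bound.
Qed.

Lemma op_compE (H K L : hilbertType R) (S : 'B(K, L)) (T : 'B(H, K)) x :
  (S *o T) x = S (T x).
Proof. by []. Qed.

Lemma op_compA (H K L M : hilbertType R) (S : 'B(L, M)) (T : 'B(K, L)) (U : 'B(H, K)) :
  S *o (T *o U) = S *o T *o U.
Proof. exact: bopP. Qed.

Lemma op_compDl (H K L : hilbertType R) (S S' : 'B(K, L)) (T : 'B(H, K)) :
  (S + S') *o T = S *o T + S' *o T.
Proof. exact: bopP. Qed.

Lemma op_compBl (H K L : hilbertType R) (S S' : 'B(K, L)) (T : 'B(H, K)) :
  (S - S') *o T = S *o T - S' *o T.
Proof. exact: bopP. Qed.

Lemma op_compDr (H K L : hilbertType R) (S : 'B(K, L)) (T T' : 'B(H, K)) :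
  S *o (T + T') = S *o T + S *o T'.
Proof. by apply: bopP => x; rewrite !(bopDE, op_compE, bopD). Qed.

Lemma op_compBr (H K L : hilbertType R) (S : 'B(K, L)) (T T' : 'B(H, K)) :
  S *o (T - T') = S *o T - S *o T'.
Proof. by apply: bopP => x; rewrite !(bopBE, op_compE, bopB). Qed.

Lemma op_compZl (H K L : hilbertType R) c (S : 'B(K, L)) (T : 'B(H, K)) :
  (c *: S) *o T = c *: (S *o T).
Proof. exact: bopP. Qed.

Lemma op_compZr (H K L : hilbertType R) c (S : 'B(K, L)) (T : 'B(H, K)) :
  S *o (c *: T) = c *: (S *o T).
Proof. by apply: bopP => x; rewrite !(bopZE, op_compE, bopZ). Qed.

Lemma op_comp0r (H K L : hilbertType R) (S : 'B(K, L)) : S *o (0 : 'B(H, K)) = 0.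
Proof. by apply: bopP => x; rewrite !(op_compE, bop0E, bop0). Qed.

Lemma op_comp0l (H K L : hilbertType R) (T : 'B(H, K)) : (0 : 'B(K, L)) *o T = 0.
Proof. exact: bopP. Qed.

Lemma op_comp_suml (H K L : hilbertType R) I (r : seq I) (P : pred I)
    (F : I -> 'B(K, L)) (T : 'B(H, K)) :
  (\sum_(i <- r | P i) F i) *o T = \sum_(i <- r | P i) F i *o T.
Proof. by elim/big_rec2: _ => [|i a b _ <-]; rewrite ?op_comp0l ?op_compDl. Qed.

Lemma op_comp_sumr (H K L : hilbertType R) I (r : seq I) (P : pred I)
    (F : I -> 'B(H, K)) (T : 'B(K, L)) :
  T *o (\sum_(i <- r | P i) F i) = \sum_(i <- r | P i) T *o F i.
Proof. by elim/big_rec2: _ => [|i a b _ <-]; rewrite ?op_comp0r ?op_compDr. Qed.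

Lemma op_comp1l (H K : hilbertType R) (T : 'B(H, K)) : bop1 K *o T = T.
Proof. exact: bopP. Qed.

Lemma op_comp1r (H K : hilbertType R) (T : 'B(H, K)) : T *o bop1 H = T.
Proof. exact: bopP. Qed.

End BoundedOp.

(** * Square-summable sequences *)

(** Completeness is demanded for Cauchy filters. Centres of balls of radius [1 / (n + 1)] that
    belong to [F] form a Cauchy sequence, and [F] converges to its limit. *)
Lemma complete_of_seq (R : realType) (V : normedModType R[i]) :
  (forall u : nat -> V,
    (forall e : R, 0 < e -> exists N, forall m n,
      (N <= m)%N -> (N <= n)%N -> nr (u m - u n) < e) ->
    exists l, forall e : R, 0 < e -> exists N, forall n,
      (N <= n)%N -> nr (u n - l) < e) ->
  forall F : set_system V, ProperFilter F -> cauchy F -> cvg F.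
Proof.
move=> seqc F FF /cauchyP cF.
have inv0 n : 0 < n.+1%:R^-1 :> R by rewrite invr_gt0.
have h n : exists x, F (ball x (n.+1%:R^-1 : R)%:C) by apply: cF; rewrite ltcR.
have [u hu] := choice h.
have [|l ul] := seqc u.
  move=> e e0; have e2 : 0 < e / 2 by rewrite divr_gt0.
  have [N hN] := ex_inv_lt e2; exists N => m n Nm Nn.
  have [y [ym yn]] := filter_ex (filterI (hu m) (hu n)).
  move: ym yn; rewrite -!ball_normE/= !nrE !ltcR => ym yn.
  apply: le_lt_trans (nr_triangle y _ _) _; rewrite [e]splitr ltrD//.
    exact: lt_trans ym (hN m Nm).
  by rewrite nrBC; exact: lt_trans yn (hN n Nn).
apply/cvg_ex; exists l; apply/cvgrPdist_lt => e e0.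
have re : (complex.Re e)%:C = e by rewrite RRe_real// gtr0_real.
have e0' : 0 < complex.Re e by rewrite -ltcR re.
have e2 : 0 < complex.Re e / 2 by rewrite divr_gt0.
have [N uN] := ul _ e2.
have [N' hN'] := ex_inv_lt e2; pose n := maxn N N'.
have := hu n; apply: filterS => y; rewrite -ball_normE/= !nrE -re !ltcR => yn.
apply: le_lt_trans (nr_triangle (u n) _ _) _; rewrite [complex.Re e]splitr ltrD//.
  by rewrite nrBC uN// leq_maxl.
exact: lt_trans yn (hN' n (leq_maxr _ _)).
Qed.

Section L2Def.
Context {R : realType}.
Variable H : hilbertType R.

Definition l2_pred : {pred nat -> H} :=
  [pred x : nat -> H | `[< exists C : R, forall n, \sum_(k < n) nr (x k) ^+ 2 <= C >]].

Record l2 := L2 { l2_fun :> nat -> H; l2_funP : l2_fun \in l2_pred }.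

HB.instance Definition _ := [isSub for l2_fun].
HB.instance Definition _ := [Choice of l2 by <:].

Lemma nrD2_le (V : normedModType R[i]) (x y : V) :
  nr (x + y) ^+ 2 <= 2 * nr x ^+ 2 + 2 * nr y ^+ 2.
Proof.
apply: (@le_trans _ _ ((nr x + nr y) ^+ 2)).
  by rewrite ler_pXn2r ?nnegrE ?nr_ge0 ?addr_ge0 ?nr_ge0// nrD.
by have := sqr_ge0 (nr x - nr y); nra.
Qed.

Lemma l2_submod_closed : submod_closed l2_pred.
Proof.
split=> [|c x y /asboolP[C hC] /asboolP[D hD]]; apply/asboolP.
  by exists 0 => n; rewrite big1// => i _; rewrite nr0 expr0n.
exists (2 * modc c ^+ 2 * C + 2 * D) => n.
apply: (@le_trans _ _ (2 * modc c ^+ 2 * (\sum_(k < n) nr (x k) ^+ 2)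
    + 2 * (\sum_(k < n) nr (y k) ^+ 2))).
  rewrite !mulr_sumr -big_split; apply: ler_sum => k _ /=.
  apply: le_trans (nrD2_le _ _) _.
  by rewrite nrZ exprMn mulrA.
by rewrite lerD// ler_wpM2l// mulr_ge0// sqr_ge0.
Qed.

HB.instance Definition _ :=
  GRing.isSubmodClosed.Build R[i] (nat -> H) l2_pred l2_submod_closed.
HB.instance Definition _ := [SubChoice_isSubLmodule of l2 by <:].

Implicit Types x y z : l2.

Lemma l2P x y : (forall k, x k = y k) -> x = y.
Proof. by move=> h; apply: val_inj; apply/funext. Qed.

Lemma l2DE x y k : (x + y) k = x k + y k. Proof. by []. Qed.
Lemma l2ZE c x k : (c *: x) k = c *: x k. Proof. by []. Qed.
Lemma l2BE x y k : (x - y) k = x k - y k. Proof. by []. Qed.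
Let psum x y n : R := \sum_(k < n) rdot (x k) (y k).
(** Only the real part of the inner product, so that convergence concerns real series; [l2hdot]
    supplies the imaginary part. *)
Definition l2dot x y : R := lim (psum x y n @[n --> \oo]).

Lemma psum_xx_cvg x : cvg (psum x x n @[n --> \oo]).
Proof.
apply: nondecreasing_is_cvgn.
  apply/nondecreasing_seqP => n; rewrite /psum big_ord_recr/= lerDl.
  exact: rdotxx_ge0.
have /asboolP[C hC] := l2_funP x; exists C => _ [n _ <-].
by apply: le_trans (hC n); apply: ler_sum => k _; rewrite nr2.
Qed.

(** Polarization writes the partial sums as a difference of two bounded monotone sequences. *)
Lemma psum_cvg x y : cvg (psum x y n @[n --> \oo]).
Proof.
have -> : psum x y = fun n => (psum (x + y) (x + y) n - psum (x - y) (x - y) n) * 4^-1.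
  apply/funext => n; rewrite /psum -sumrB mulr_suml; apply: eq_bigr => k _.
  by rewrite l2DE l2BE !rdotE (rdotC (y k) (x k)); field.
by apply: is_cvgM; [apply: is_cvgB; exact: psum_xx_cvg|exact: is_cvg_cst].
Qed.

Lemma l2dot_cvg x y : psum x y n @[n --> \oo] --> l2dot x y.
Proof. exact: psum_cvg. Qed.

Lemma l2dot_uniq x y l : psum x y n @[n --> \oo] --> l -> l2dot x y = l.
Proof. by move=> h; apply: cvg_lim. Qed.

Lemma l2dotC x y : l2dot x y = l2dot y x.
Proof.
apply: l2dot_uniq; rewrite (_ : psum x y = psum y x); first exact: l2dot_cvg.
by apply/funext => n; apply: eq_bigr => k _; rewrite rdotC.
Qed.

Lemma l2dotDl x y z : l2dot (x + y) z = l2dot x z + l2dot y z.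
Proof.
apply: l2dot_uniq.
rewrite (_ : psum (x + y) z = fun n => psum x z n + psum y z n).
  by apply: cvgD; exact: l2dot_cvg.
by apply/funext => n; rewrite /psum -big_split; apply: eq_bigr => k _; rewrite l2DE rdotDl.
Qed.

Lemma l2dotZl (r : R) x z : l2dot (r%:C *: x) z = r * l2dot x z.
Proof.
apply: l2dot_uniq.
rewrite (_ : psum _ z = fun n => r * psum x z n).
  by apply: cvgM; [exact: cvg_cst|exact: l2dot_cvg].
by apply/funext => n; rewrite /psum mulr_sumr; apply: eq_bigr => k _; rewrite l2ZE rdotZl.
Qed.

Lemma rdot_i (x y : H) : rdot ('i *: x) y = - rdot x ('i *: y).
Proof. by rewrite /rdot hdotZl hdotZr; case: (hdot H x y) => a b; simpc. Qed.

Lemma l2dot_i x y : l2dot ('i *: x) y = - l2dot x ('i *: y).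
Proof.
apply: l2dot_uniq.
rewrite (_ : psum _ y = fun n => - psum x ('i *: y) n).
  by apply: cvgN; exact: l2dot_cvg.
apply/funext => n; rewrite /psum -sumrN; apply: eq_bigr => k _.
by rewrite !l2ZE rdot_i.
Qed.

Lemma l2dot_psum x n : \sum_(k < n) nr (x k) ^+ 2 <= l2dot x x.
Proof.
have -> : \sum_(k < n) nr (x k) ^+ 2 = psum x x n.
  by apply: eq_bigr => k _; rewrite nr2.
apply: (nondecreasing_cvgn_le (u_ := psum x x)); last exact: psum_xx_cvg.
apply/nondecreasing_seqP => m; rewrite /psum big_ord_recr/= lerDl.
exact: rdotxx_ge0.
Qed.

Lemma l2dot_le x C : (forall n, \sum_(k < n) nr (x k) ^+ 2 <= C) -> l2dot x x <= C.
Proof.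
move=> h; apply: limr_le; first exact: psum_xx_cvg.
near=> n; apply: le_trans (h n).
by apply: ler_sum => k _; rewrite nr2.
Unshelve. all: by end_near. Qed.

Lemma l2dotxx_ge0 x : 0 <= l2dot x x.
Proof. by have := l2dot_psum x 0; rewrite big_ord0. Qed.

Lemma l2dot_eq0 x : l2dot x x = 0 -> x = 0.
Proof.
move=> h; apply: l2P => k; apply: nr0_eq0.
have := l2dot_psum x k.+1; rewrite h big_ord_recr/= => h'.
apply/eqP; rewrite -sqrf_eq0 eq_le sqr_ge0 andbT; apply: le_trans h'.
by rewrite lerDr sumr_ge0// => i _; exact: sqr_ge0.
Qed.

Definition l2norm x : R[i] := (Num.sqrt (l2dot x x))%:C.

Lemma l2dotDr x y z : l2dot z (x + y) = l2dot z x + l2dot z y.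
Proof. by rewrite l2dotC l2dotDl !(l2dotC z). Qed.

Lemma l2dotZr (r : R) x z : l2dot z (r%:C *: x) = r * l2dot z x.
Proof. by rewrite l2dotC l2dotZl l2dotC. Qed.

Lemma l2dot_cauchy x y : l2dot x y ^+ 2 <= l2dot x x * l2dot y y.
Proof.
apply: psd_cauchy => [|t]; first exact: l2dotxx_ge0.
have := l2dotxx_ge0 (x + t%:C *: y).
have -> : l2dot (x + t%:C *: y) (x + t%:C *: y) =
    l2dot x x + 2 * t * l2dot x y + t ^+ 2 * l2dot y y.
  by rewrite !(l2dotDl, l2dotDr, l2dotZl, l2dotZr) (l2dotC y x); ring.
by [].
Qed.

Lemma l2normD x y : l2norm (x + y) <= l2norm x + l2norm y.
Proof.
rewrite /l2norm -rmorphD lecR.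
rewrite -(@ler_pXn2r _ 2) ?nnegrE ?addr_ge0 ?sqrtr_ge0//.
rewrite sqrrD !sqr_sqrtr ?l2dotxx_ge0//.
rewrite !(l2dotDl, l2dotDr) (l2dotC y x) -mulr_natl.
have : l2dot x y <= Num.sqrt (l2dot x x) * Num.sqrt (l2dot y y).
  apply: le_trans (ler_norm _) _; rewrite -sqrtrM ?l2dotxx_ge0//.
  by rewrite -sqrtr_sqr ler_wsqrtr// l2dot_cauchy.
by lra.
Qed.

Lemma complexZ (c : R[i]) x : c *: x = (complex.Re c)%:C *: x + (complex.Im c)%:C *: ('i *: x).
Proof. by rewrite scalerA -scalerDl {1}[c]complexE [_%:C * _]mulrC. Qed.

Lemma l2dot_ii x : l2dot x ('i *: x) = 0.
Proof. by have := l2dot_i x x; rewrite (l2dotC _ x) => /eqP; rewrite -addr_eq0 -mulr2n mulrn_eq0/= => /eqP. Qed.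

Lemma l2normZ c x : l2norm (c *: x) = `|c| * l2norm x.
Proof.
rewrite /l2norm; have -> : l2dot (c *: x) (c *: x) = (complex.Re c ^+ 2 + complex.Im c ^+ 2) * l2dot x x.
  rewrite complexZ !(l2dotDl, l2dotDr, l2dotZl, l2dotZr) !l2dot_i l2dot_ii.
  rewrite scalerA -expr2 sqr_i.
  by have -> : l2dot x (-1 *: x) = - l2dot x x;
    [have := l2dotZr (-1) x x; rewrite rmorphN1 mulN1r|ring].
rewrite sqrtrM ?addr_ge0 ?sqr_ge0// normc_def rmorphM//.
Qed.

Lemma l2norm_eq0 x : l2norm x = 0 -> x = 0.
Proof.
move=> /complexI/eqP; rewrite sqrtr_eq0 => h; apply: l2dot_eq0.
by apply/eqP; rewrite eq_le h l2dotxx_ge0.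
Qed.

HB.instance Definition _ :=
  Lmodule_isNormed.Build R[i] l2 l2normD l2normZ l2norm_eq0.

Lemma l2_nrE x : nr x = Num.sqrt (l2dot x x). Proof. by []. Qed.

Lemma l2_nr2 x : nr x ^+ 2 = l2dot x x.
Proof. by rewrite l2_nrE sqr_sqrtr// l2dotxx_ge0. Qed.

Lemma l2_nr_le x C : 0 <= C -> (forall n, \sum_(k < n) nr (x k) ^+ 2 <= C ^+ 2) -> nr x <= C.
Proof.
move=> C0 h; rewrite -(@ler_pXn2r _ 2) ?nnegrE ?nr_ge0// l2_nr2.
exact: l2dot_le.
Qed.

Lemma l2_nr_coord x k : nr (x k) <= nr x.
Proof.
rewrite -(@ler_pXn2r _ 2) ?nnegrE ?nr_ge0// l2_nr2.
apply: le_trans (l2dot_psum x k.+1); rewrite big_ord_recr/= lerDr.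
by rewrite sumr_ge0// => i _; exact: sqr_ge0.
Qed.

Lemma trunc_subproof (w : nat -> H) K : (fun k => if (k < K)%N then w k else 0) \in l2_pred.
Proof.
apply/asboolP; exists (\sum_(k < K) nr (w k) ^+ 2) => n.
apply: (@le_trans _ _ (\sum_(k < n | (k < K)%N) nr (w k) ^+ 2)).
  rewrite [leRHS]big_mkcond/=; apply: ler_sum => k _.
  by case: ifP => // _; rewrite nr0 expr0n.
by apply: (@ler_sum_below _ (fun k => nr (w k) ^+ 2)) => k; exact: sqr_ge0.
Qed.

Definition trunc K (w : nat -> H) : l2 := L2 (trunc_subproof w K).

Lemma truncE K w k : trunc K w k = if (k < K)%N then w k else 0. Proof. by []. Qed.

Lemma trunc_sum (w : nat -> H) K n :
  \sum_(k < n) nr (trunc K w k) ^+ 2 = \sum_(k < n | (k < K)%N) nr (w k) ^+ 2.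
Proof.
rewrite [RHS]big_mkcond/=; apply: eq_bigr => k _.
by rewrite ?truncE; case: ifP => // _; rewrite nr0 expr0n.
Qed.

Lemma trunc_nr (w : nat -> H) K : \sum_(k < K) nr (w k) ^+ 2 <= nr (trunc K w) ^+ 2.
Proof.
rewrite l2_nr2; apply: le_trans (l2dot_psum _ K); rewrite trunc_sum.
by rewrite [leRHS](eq_bigl xpredT)// => k; rewrite ltn_ord.
Qed.

Lemma trunc_nr_le x K : nr (trunc K x) <= nr x.
Proof.
apply: l2_nr_le => [|n]; first exact: nr_ge0.
rewrite l2_nr2; apply: le_trans (l2dot_psum _ n); rewrite trunc_sum.
by rewrite [leLHS]big_mkcond/=; apply: ler_sum => k _; case: ifP => // _; exact: sqr_ge0.
Qed.

Lemma trunc_nr_sum (w : nat -> H) K : nr (trunc K w) <= \sum_(k < K) nr (w k).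
Proof.
elim: K => [|K IH].
  by rewrite big_ord0 (_ : trunc 0 w = 0) ?nr0//; apply: l2P => k; rewrite truncE.
rewrite big_ord_recr/=.
pose d := trunc K.+1 (fun k => if k == K then w k else 0).
have -> : trunc K.+1 w = trunc K w + d.
  apply: l2P => k; rewrite l2DE !truncE ltnS leq_eqVlt.
  by have [->|] := eqVneq k K; rewrite /= ?ltnn ?add0r//; case: ifP; rewrite addr0.
apply: le_trans (nrD _ _) _; rewrite lerD//.
apply: l2_nr_le => [|n]; first exact: nr_ge0.
rewrite /d; under eq_bigr do rewrite truncE.
have [Kn|nK] := ltnP K n.
  rewrite (bigD1 (Ordinal Kn))//= ltnSn eqxx big1 ?addr0// => i /eqP iK.
  have -> : (i == K :> nat) = false by apply/negbTE/eqP => h; apply: iK; apply: val_inj.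
  by rewrite if_same nr0 expr0n.
rewrite big1 ?sqr_ge0// => i _.
have -> : (i == K :> nat) = false by rewrite ltn_eqF// (leq_trans (ltn_ord i)).
by rewrite if_same nr0 expr0n.
Qed.

Lemma l2_complete (F : set_system l2) : ProperFilter F -> cauchy F -> cvg F.
Proof.
move: F; apply: complete_of_seq => u cu.
have h k : exists l, forall e : R, 0 < e -> exists N, forall n,
     (N <= n)%N -> nr (u n k - l) < e.
  apply: complete_seq => e e0; have [N hN] := cu _ e0.
  exists N => m n Nm Nn; rewrite -l2BE.
  by apply: le_lt_trans (l2_nr_coord _ _) _; apply: hN.
have [z hz] := choice h.
(* The Cauchy estimate passes to the coordinatewise limit on each block of [K] coordinates, where
   one [n] is good for all of them; the bound does not depend on [K]. *)
have key (e : R) N m : 0 < e -> (forall n, (N <= n)%N -> nr (u m - u n) < e) ->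
    forall K, \sum_(k < K) nr (u m k - z k) ^+ 2 <= e ^+ 2.
  move=> e0 hN K; apply: le_trans (trunc_nr (fun k => u m k - z k) K) _.
  rewrite ler_pXn2r ?nnegrE ?nr_ge0 ?(ltW e0)//; apply/ler_addgt0Pr => d d0.
  have d1 : 0 < d / K.+1%:R by rewrite divr_gt0.
  have [n Nn hn] : exists2 n, (N <= n)%N &
      forall k, (k < K)%N -> nr (u n k - z k) < d / K.+1%:R.
    have : exists M, forall n, (M <= n)%N -> forall k, (k < K)%N -> nr (u n k - z k) < d / K.+1%:R.
      move: d1; move: (d / K.+1%:R) => d1 d10; elim: (K) => [|L [M hM]]; first by exists 0%N.
      have [M' hM'] := hz L _ d10; exists (maxn M M') => n; rewrite geq_max => /andP[Mn M'n] k.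
      by rewrite ltnS leq_eqVlt => /orP[/eqP ->|]; [exact: hM'|exact: hM].
    by move=> [M hM]; exists (maxn N M); rewrite ?leq_maxl// => k; apply: hM; rewrite leq_maxr.
  have -> : trunc K (fun k => u m k - z k) =
      trunc K (u m - u n) + trunc K (fun k => u n k - z k).
    apply: l2P => k; rewrite l2DE !truncE; case: ifP; rewrite ?addr0// l2BE.
    by rewrite addrA subrK.
  apply: le_trans (nrD _ _) _; apply: lerD.
    by apply: le_trans (trunc_nr_le _ _) _; apply/ltW/hN.
  apply: le_trans (trunc_nr_sum _ _) _.
  apply: (@le_trans _ _ (\sum_(k < K) d / K.+1%:R)).
    by apply: ler_sum => k _; apply/ltW/hn.
  rewrite sumr_const card_ord -[leLHS]mulr_natl mulrCA ger_pMr// ler_pdivrMr// mul1r.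
  by rewrite ler_nat.
have [N0 hN0] := cu 1 ltr01.
have w0 : (fun k => u N0 k - z k) \in l2_pred.
  by apply/asboolP; exists (1 ^+ 2) => n; apply: (key 1 N0) => // m Nm; apply: hN0.
(* The coordinatewise limit is square-summable, being [u N0] minus the square-summable sequence
   [u N0 - z]. *)
pose zz : l2 := u N0 - L2 w0.
have zzE k : zz k = z k by rewrite l2BE /= opprB addrC subrK.
exists zz => e e0; have e2 : 0 < e / 2 by rewrite divr_gt0.
have [N hN] := cu _ e2; exists N => n Nn.
apply: (@le_lt_trans _ _ (e / 2)); last by rewrite ltr_pdivrMr// mulr_natr mulr2n ltrDl.
apply: l2_nr_le => [|m]; first exact: ltW.
under eq_bigr do rewrite l2BE zzE.
by apply: (key _ N) => // p Np; apply: hN.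
Qed.

HB.instance Definition _ := Uniform_isComplete.Build l2 l2_complete.

(** The second argument is conjugated, so the imaginary part of [<x, y>] is the real part of
    [<x, 'i y>]. *)
Definition l2hdot x y : R[i] := (l2dot x y) +i* (l2dot x ('i *: y)).

End L2Def.

Section L2Dot.
Context {R : realType}.
Variable H : hilbertType R.
Implicit Types x y z : l2 H.

Lemma l2dotNl x y : l2dot (- x) y = - l2dot x y.
Proof. by have := l2dotZl (-1) x y; rewrite rmorphN1 scaleN1r mulN1r. Qed.

Lemma l2dotNr x y : l2dot x (- y) = - l2dot x y.
Proof. by rewrite l2dotC l2dotNl l2dotC. Qed.

Lemma l2hdotC x y : l2hdot x y = conjc (l2hdot y x).
Proof.
rewrite /l2hdot /= l2dotC; congr (_ +i* _).
by rewrite [in RHS]l2dotC l2dot_i opprK.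
Qed.

Lemma l2hdotDl x y z : l2hdot (x + y) z = l2hdot x z + l2hdot y z.
Proof. by rewrite /l2hdot !l2dotDl; simpc. Qed.

Lemma l2hdotZl c x z : l2hdot (c *: x) z = c * l2hdot x z.
Proof.
have iiz : 'i *: ('i *: z) = - z by rewrite scalerA -expr2 sqr_i scaleN1r.
rewrite /l2hdot complexZ !(l2dotDl, l2dotZl) !l2dot_i iiz l2dotNr.
by case: c => a b; simpc; congr (_ +i* _); rewrite opprK.
Qed.

Lemma l2hdot_bilinear : bilinear_for *%R (@Num.conj R[i] \; *%R) (@l2hdot R H).
Proof.
split=> z c x y; first by rewrite l2hdotDl l2hdotZl.
by rewrite l2hdotC l2hdotDl l2hdotZl raddfD/= (l2hdotC z x) (l2hdotC z y) rmorphM.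
Qed.

HB.instance Definition _ := bilinear_isBilinear.Build R[i] (l2 H) (l2 H) R[i]
  _ _ (@l2hdot R H) l2hdot_bilinear.

Lemma l2hdot_herm x y : l2hdot x y = (-1) ^+ false * Num.conj (l2hdot y x).
Proof. by rewrite expr0 mul1r l2hdotC. Qed.

HB.instance Definition _ := isHermitianSesquilinear.Build R[i] (l2 H) false
  (@Num.conj R[i]) (@l2hdot R H) l2hdot_herm.

Lemma l2_hdotE x : `|x| ^+ 2 = l2hdot x x.
Proof. by rewrite /l2hdot l2dot_ii -l2_nr2 nrE -rmorphXn. Qed.

Lemma l2hdot_gt0 x : x != 0 -> 0 < l2hdot x x.
Proof. by move=> x0; rewrite -l2_hdotE exprn_gt0// normr_gt0. Qed.

HB.instance Definition _ := isDotProduct.Build R[i] (l2 H) (@l2hdot R H) l2hdot_gt0.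

Definition ell2 : hilbertType R :=
  @Hilbert R (l2 H) (@l2hdot R H) l2_hdotE.

Lemma ell2_rdot x y : rdot (x : ell2) y = l2dot x y. Proof. by []. Qed.

End L2Dot.

Section EllOps.
Context {R : realType}.
Variable H : hilbertType R.

Lemma l2_nr_psum (x : ell2 H) n : \sum_(k < n) nr (x k) ^+ 2 <= nr x ^+ 2.
Proof. by rewrite (l2_nr2 x) l2dot_psum. Qed.

Lemma eps_subproof k (h : H) :
  (fun j : nat => if j == k then h else 0) \in @l2_pred R H.
Proof.
apply/asboolP; exists (nr h ^+ 2) => n.
have [kn|nk] := ltnP k n.
  rewrite (bigD1 (Ordinal kn))//= eqxx big1 ?addr0// => i /eqP ik.
  have -> : (i == k :> nat) = false by apply/negbTE/eqP => e; apply: ik; apply: val_inj.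
  by rewrite nr0 expr0n.
rewrite big1 ?sqr_ge0// => i _.
by rewrite ltn_eqF ?nr0 ?expr0n// (leq_trans (ltn_ord i)).
Qed.

Definition eps_fun k (h : H) : ell2 H := L2 (eps_subproof k h).

Lemma eps_funE k h j : eps_fun k h j = if j == k then h else 0. Proof. by []. Qed.

Lemma eps_fun_linear k : linear (eps_fun k).
Proof.
move=> c x y; apply: l2P => j; rewrite l2DE l2ZE !eps_funE.
by case: ifP; rewrite // scaler0 addr0.
Qed.

Lemma eps_fun_bound k h : nr (eps_fun k h) <= 1 * nr h.
Proof.
rewrite mul1r; apply: (@l2_nr_le R H) => [|n]; first exact: nr_ge0.
have [kn|nk] := ltnP k n.
  rewrite (bigD1 (Ordinal kn))//= eqxx big1 ?addr0// => i /eqP ik.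
  have -> : (i == k :> nat) = false by apply/negbTE/eqP => e; apply: ik; apply: val_inj.
  by rewrite nr0 expr0n.
rewrite big1 ?sqr_ge0// => i _ /=.
by rewrite ltn_eqF ?nr0 ?expr0n// (leq_trans (ltn_ord i)).
Qed.

Definition eps k : 'B(H, ell2 H) := mkbop (eps_fun_linear k) (eps_fun_bound k).

Lemma epsE k h j : (eps k h : ell2 H) j = if j == k then h else 0. Proof. by []. Qed.

Lemma crd_linear k : linear (fun x : ell2 H => x k). Proof. by []. Qed.

Lemma crd_bound k (x : ell2 H) : nr (x k) <= 1 * nr x.
Proof. by rewrite mul1r; exact: l2_nr_coord. Qed.

Definition crd k : 'B(ell2 H, H) := mkbop (@crd_linear k) (@crd_bound k).

Lemma crdE k (x : ell2 H) : crd k x = x k. Proof. by []. Qed.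

Lemma eps_adj k : (eps k)^adj = crd k.
Proof.
apply: adj_uniq => h y; rewrite ell2_rdot; apply: l2dot_uniq.
apply: cvg_near_cst; exists k.+1 => // n /= kn.
rewrite (bigD1 (Ordinal kn))//= eqxx big1 ?addr0// => i /eqP ik.
have -> : (i == k :> nat) = false by apply/negbTE/eqP => e; apply: ik; apply: val_inj.
by rewrite rdot0l.
Qed.

Lemma crd_adj k : (crd k)^adj = eps k.
Proof. by rewrite -eps_adj adjK. Qed.

Lemma nr_eps k h : nr (eps k h) = nr h.
Proof.
apply/eqP; rewrite eq_le; apply/andP; split.
  by have := eps_fun_bound k h; rewrite mul1r.
by have := crd_bound k (eps k h); rewrite epsE eqxx mul1r.
Qed.

Lemma colop_exists (K : hilbertType R) (T : nat -> 'B(K, H)) (C : R) : 0 <= C ->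
  (forall n x, \sum_(k < n) nr (T k x) ^+ 2 <= C ^+ 2 * nr x ^+ 2) ->
  exists2 V : 'B(K, ell2 H), (forall x k, (V x : ell2 H) k = T k x) & nrm V <= C.
Proof.
move=> C0 hC.
have Vp x : (fun k => T k x) \in @l2_pred R H by apply/asboolP; exists (C ^+ 2 * nr x ^+ 2).
pose V x : ell2 H := L2 (Vp x).
have lV : linear V.
  by move=> c x y; apply: l2P => k; rewrite l2DE l2ZE /= bopD bopZ.
have bV x : nr (V x) <= C * nr x.
  by apply: (@l2_nr_le R H) => [|n]; [rewrite mulr_ge0 ?nr_ge0|rewrite exprMn; exact: hC].
by exists (mkbop lV bV) => //; apply/nrmP.
Qed.

Lemma sum_psum_le n (x : 'I_n -> ell2 H) (B : R) :
  \sum_(i < n) nr (x i) ^+ 2 <= B <->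
  forall m, \sum_(k < m) \sum_(i < n) nr (x i k) ^+ 2 <= B.
Proof.
split=> [h m|h].
  apply: le_trans h; rewrite exchange_big/=; apply: ler_sum => i _.
  exact: l2_nr_psum.
have L : (fun m => \sum_(i < n) \sum_(k < m) rdot (x i k) (x i k)) @ \oo -->
    \sum_(i < n) nr (x i) ^+ 2.
  elim: n x {h} => [|n IH] x.
    under eq_fun do rewrite big_ord0.
    by rewrite big_ord0; exact: cvg_cst.
  under eq_fun do rewrite big_ord_recr.
  rewrite big_ord_recr/=; apply: cvgD; first exact: IH.
  by rewrite (l2_nr2 (x ord_max)); exact: l2dot_cvg.
have <- := cvg_lim (@Rhausdorff R) L.
apply: limr_le; first by apply/cvg_ex; eexists; exact: L.
near=> m; rewrite exchange_big/=; apply: le_trans (h m).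
by apply: ler_sum => k _; apply: ler_sum => i _; rewrite nr2.
Unshelve. all: by end_near. Qed.

End EllOps.

(** * Columns as operators *)

Section Embedding.
Context {R : realType}.
Variables (X : operatorSpaceType R) (H K : hilbertType R).
Variable f : {linear X -> 'B(H, K)}.
Hypothesis hf : complete_isometry f.

Lemma mxnorm_ge0 n (x : 'M[X]_n) : 0 <= mxnorm x.
Proof. by rewrite -hf op_mxnorm_ge0. Qed.

Lemma rmxnorm_ge0 m n (x : 'M[X]_(m, n)) : 0 <= rmxnorm x.
Proof. exact: mxnorm_ge0. Qed.

(** The first [m] columns and the last [n] rows of the corner matrix vanish, so only the last [n]
    coordinates of a test vector and the first [m] of its image count. *)
Lemma rmxnormP m n (x : 'M[X]_(m, n)) r : 0 <= r -> rmxnorm x <= r <->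
  forall h : 'I_n -> H,
    \sum_(i < m) nr (\sum_j f (x i j) (h j)) ^+ 2 <= r ^+ 2 * \sum_j nr (h j) ^+ 2.
Proof.
move=> r0; rewrite /rmxnorm -hf; apply: iff_trans; first exact: op_mxnormP.
split=> hx h.
  pose h' (j : 'I_(m + n)) : H := if fintype.split j is inr k then h k else 0.
  have h'r k : h' (rshift m k) = h k by rewrite /h' (unsplitK (inr k)).
  have h'l k : h' (lshift n k) = 0 by rewrite /h' (unsplitK (inl k)).
  have := hx h'; rewrite [X in _ <= _ * X]big_split_ord/= [X in X + _]big1 ?add0r; last first.
    by move=> i _; rewrite h'l nr0 expr0n.
  under [X in _ <= _ * X]eq_bigr do rewrite h'r.
  apply: le_trans; rewrite [leRHS]big_split_ord/=.
  apply: ler_wpDr; first by apply: sumr_ge0 => i _; exact: sqr_ge0.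
  apply: ler_sum => i _; rewrite big_split_ord/= [X in nr (X + _)]big1 ?add0r; last first.
    by move=> j _; rewrite h'l bop0.
  by under [X in _ <= nr X ^+ 2]eq_bigr do rewrite mxE block_mxEur h'r.
pose h' k := h (rshift m k).
have := hx h' => hh'; rewrite [leLHS]big_split_ord/= [X in _ + X]big1 ?addr0; last first.
  move=> i _; rewrite big1 ?nr0 ?expr0n// => j _.
  rewrite mxE; have [[k ->]|[k ->]] : (exists k, j = lshift n k) \/ (exists k, j = rshift m k).
  - by have := splitK j; case: (fintype.split j) => k <-; [left|right]; exists k.
  - by rewrite block_mxEdl mxE linear0 bop0E.
  - by rewrite block_mxEdr mxE linear0 bop0E.
rewrite (_ : \sum_(i < m) _ = \sum_(i < m) nr (\sum_j f (x i j) (h' j)) ^+ 2); last first.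
  apply: eq_bigr => i _; rewrite big_split_ord/= [X in nr (X + _)]big1 ?add0r.
    by congr (nr _ ^+ 2); apply: eq_bigr => j _; rewrite mxE block_mxEur.
  by move=> j _; rewrite mxE block_mxEul mxE linear0 bop0E.
apply: le_trans hh' _; rewrite ler_wpM2l ?sqr_ge0//.
rewrite [leRHS]big_split_ord/= lerDr.
by apply: sumr_ge0 => i _; exact: sqr_ge0.
Qed.

Lemma nrm_rep x : nrm (f x) = nrm x.
Proof. by rewrite /nrm -hf; congr mxnorm; apply/matrixP => i j; rewrite !mxE. Qed.

Lemma nr_rep x : nr x = nrm (f x).
Proof. by apply: (@complexI R); rewrite -nrE mxnorm1 nrm_rep. Qed.

Lemma rep_inj : injective f.
Proof.
move=> x y h; apply/eqP; rewrite -subr_eq0; apply/eqP/nr0_eq0.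
by rewrite nr_rep linearB/= h subrr nrm0.
Qed.

(** [X] is complete and [f] isometric. This is how elements of an abstract space are obtained from
    operators that its image approximates. *)
Lemma rep_closed (T : 'B(H, K)) :
  (forall e : R, 0 < e -> exists x, nrm (T - f x) < e) -> exists x, f x = T.
Proof.
move=> h.
have inv0 n : 0 < n.+1%:R^-1 :> R by rewrite invr_gt0.
have hn n : exists x, nrm (T - f x) < n.+1%:R^-1 by apply: h.
have [u hu] := choice hn.
have [|l hl] := complete_seq (u := u).
  move=> e e0; have e2 : 0 < e / 2 by rewrite divr_gt0.
  have [N hN] := ex_inv_lt e2; exists N => m n Nm Nn; rewrite nr_rep linearB/=.
  apply: le_lt_trans (nrm_triangle _ T _) _; rewrite [e]splitr ltrD//.
    by rewrite nrmBC; exact: lt_trans (hu m) (hN m Nm).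
  exact: lt_trans (hu n) (hN n Nn).
exists l; apply/eqP; rewrite -subr_eq0; apply/eqP/nrm_small_eq0 => e e0.
have e2 : 0 < e / 2 by rewrite divr_gt0.
have [N hN] := hl _ e2; have [N' hN'] := ex_inv_lt e2; pose n := maxn N N'.
apply: le_lt_trans (nrm_triangle _ (f (u n)) _) _; rewrite [e]splitr ltrD//.
  by rewrite -linearB/= -nr_rep nrBC hN// leq_maxl.
by rewrite nrmBC; exact: lt_trans (hu n) (hN' n (leq_maxr _ _)).
Qed.

End Embedding.

Section ColumnRep.
Context {R : realType}.
Variables (X : operatorSpaceType R) (H : hilbertType R).
Variable f : {linear X -> 'B(H, H)}.
Hypothesis hf : complete_isometry f.

Lemma rmxnorm_colP m (x : nat -> X) r : 0 <= r -> rmxnorm (\col_(k < m) x k) <= r <->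
  forall h : H, \sum_(k < m) nr (f (x k) h) ^+ 2 <= r ^+ 2 * nr h ^+ 2.
Proof.
move=> r0; apply: iff_trans; first exact: (rmxnormP hf).
split=> hx h.
  have := hx (fun=> h); rewrite big_ord1; apply: le_trans.
  by apply: ler_sum => k _; rewrite big_ord1 mxE.
rewrite big_ord1; apply: le_trans (hx (h ord0)).
by apply: ler_sum => k _; rewrite big_ord1 mxE.
Qed.

(** Beyond the support of a finitely supported approximant the difference is [x] itself, so the
    approximant controls the tail of [x]; conversely, a small tail makes the truncation of [x] an
    approximant. *)
Lemma col_predP (x : nat -> X) : x \in @col_pred R X <->
  forall e : R, 0 < e -> exists N, forall m h,
    \sum_(k < m | (N <= k)%N) nr (f (x k) h) ^+ 2 <= e ^+ 2 * nr h ^+ 2.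
Proof.
split=> [/asboolP hx e e0|hx].
  have [y [N yN] xy] := hx e e0; exists N => m h.
  have /(rmxnorm_colP m (fun k => x k - y k) (ltW e0)) := xy m => /(_ h); apply: le_trans.
  rewrite [leLHS]big_mkcond/=; apply: ler_sum => k _.
  by case: ifP => [/yN ->|_]; rewrite ?subr0// sqr_ge0.
apply/asboolP => e e0; have [N hN] := hx e e0.
exists (fun k => if (N <= k)%N then 0 else x k); first by exists N => k ->.
move=> m; apply/(rmxnorm_colP m (fun k => x k - (if (N <= k)%N then 0 else x k)) (ltW e0)) => h; apply: le_trans (hN m h).
rewrite [leRHS]big_mkcond/=; apply: ler_sum => k _.
by case: ifP; rewrite ?subr0// subrr linear0 bop0E nr0 expr0n.
Qed.

Lemma colf_exists (x : Cinfty X) :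
  exists V : 'B(H, ell2 H), forall h k, (V h : ell2 H) k = f (x k) h.
Proof.
have [N hN] := (col_predP x).1 (Cinfty_funP x) 1 ltr01.
pose B := \sum_(k < N) nrm (f (x k)) ^+ 2.
have B0 : 0 <= B by apply: sumr_ge0 => k _; exact: sqr_ge0.
(* The entries from [N] on contribute at most [1] to the squared norm, the finitely many others at
   most [B]. *)
have [||V hV _] := @colop_exists R H H (fun k => f (x k)) (Num.sqrt (1 + B)); last by exists V.
  exact: sqrtr_ge0.
move=> n h; rewrite sqr_sqrtr ?addr_ge0// mulrDl.
rewrite (bigID (fun k : 'I_n => (N <= k)%N))/= lerD//.
  by have := hN n h; rewrite expr1n.
rewrite /B mulr_suml.
apply: (@le_trans _ _ (\sum_(k < n | (k < N)%N) nrm (f (x k)) ^+ 2 * nr h ^+ 2)).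
  under eq_bigl do rewrite -ltnNge.
  apply: ler_sum => k _; rewrite -exprMn ler_pXn2r ?nnegrE ?mulr_ge0 ?nr_ge0 ?nrm_ge0//.
  exact: nrm_bound.
apply: (@ler_sum_below _ (fun k => nrm (f (x k)) ^+ 2 * nr h ^+ 2)) => k.
by rewrite mulr_ge0 ?sqr_ge0.
Qed.

Definition colf_fun (x : Cinfty X) : 'B(H, ell2 H) := sval (cid (colf_exists x)).

Lemma colf_funE x h k : (colf_fun x h : ell2 H) k = f (x k) h.
Proof. by rewrite /colf_fun; case: cid => V /= hV; rewrite hV. Qed.

Lemma colf_linear : linear colf_fun.
Proof.
move=> c x y; apply: bopP => h; apply: l2P => k.
rewrite bopDE bopZE l2DE l2ZE !colf_funE.
have -> : (c *: x + y : Cinfty X) k = c *: x k + y k by [].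
by rewrite linearP.
Qed.

HB.instance Definition _ :=
  GRing.isLinear.Build R[i] (Cinfty X) 'B(H, ell2 H) _ colf_fun colf_linear.

Definition colf : {linear Cinfty X -> 'B(H, ell2 H)} := colf_fun.

Lemma colfE x h k : (colf x h : ell2 H) k = f (x k) h.
Proof. exact: colf_funE. Qed.

Lemma crd_colf k x : crd H k *o colf x = f (x k).
Proof. by apply: bopP => h; rewrite op_compE crdE colfE. Qed.

Lemma mxcol_sum m (p : 'I_m -> nat) (G : forall i, 'I_(p i) -> R) :
  \sum_(s < (\sum_i p i)%N) G (tagnat.sig1 s) (tagnat.sig2 s) = \sum_i \sum_j G i j.
Proof. by rewrite sig_big_dep/= (reindex _ tagnat.sig_bij_on). Qed.

Lemma rmxnorm_mxcolP m n (x : 'M[Cinfty X]_n) r : 0 <= r ->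
  rmxnorm (\mxcol_(k < m) (\matrix_(i < n, j < n) (x i j : nat -> X) k)) <= r <->
  forall h : 'I_n -> H,
    \sum_(k < m) \sum_(i < n) nr (\sum_j f (x i j k) (h j)) ^+ 2
      <= r ^+ 2 * \sum_j nr (h j) ^+ 2.
Proof.
move=> r0; apply: iff_trans; first exact: (rmxnormP hf).
have sE h : \sum_(i < (\sum_(k < m) n)%N) nr (\sum_j f ((\mxcol_(k < m)
      (\matrix_(i < n, j < n) (x i j : nat -> X) k)) i j) (h j)) ^+ 2 =
    \sum_(k < m) \sum_(i < n) nr (\sum_j f (x i j k) (h j)) ^+ 2.
  rewrite -[RHS](@mxcol_sum m (fun=> n) (fun k i => nr (\sum_j f (x i j k) (h j)) ^+ 2)).
  apply: eq_bigr => s _; congr (nr _ ^+ 2); apply: eq_bigr => j _.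
  by rewrite !mxE.
by split=> hx h; have := hx h; rewrite sE.
Qed.

Lemma colf_mxnormP n (x : 'M[Cinfty X]_n) r : 0 <= r ->
  mxnorm (map_mx colf x) <= r <-> forall m,
  rmxnorm (\mxcol_(k < m) (\matrix_(i < n, j < n) (x i j : nat -> X) k)) <= r.
Proof.
move=> r0; apply: iff_trans; first exact: op_mxnormP.
have colE h i k : ((\sum_j map_mx colf x i j (h j) : ell2 H) : nat -> H) k
    = \sum_j f (x i j k) (h j).
  have -> (F : 'I_n -> ell2 H) : (\sum_j F j : l2 H) k = \sum_j F j k.
    by elim/big_rec2: _ => // j a b _ <-.
  by apply: eq_bigr => j _; rewrite mxE colfE.
split=> hx.
  move=> m; apply/rmxnorm_mxcolP => // h.
  have /sum_psum_le/(_ m) := hx h; apply: le_trans; apply: ler_sum => k _.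
  by apply: ler_sum => i _; rewrite colE.
move=> h; apply/sum_psum_le => m.
have /rmxnorm_mxcolP := hx m => /(_ r0 h); apply: le_trans.
by apply: ler_sum => k _; apply: ler_sum => i _; rewrite colE.
Qed.

(** Truncating the image in [ell2 H] to [m] coordinates gives the norm of the column cut at [m], so
    the operator norm is the supremum that defines the norm of [Cinfty X]. Columns can thus be
    handled as operators [H -> ell2 H]. *)
Lemma colf_isometry : complete_isometry colf.
Proof.
move=> n x; rewrite [RHS]/(mxnorm _)/= /Cinfty_mxnorm.
set S := [set _ | _ in _].
have S0 : S !=set0 by exists (rmxnorm (\mxcol_(k < 0) (\matrix_(i < n, j < n) (x i j : nat -> X) k))), 0%N.
have ubS : ubound S (mxnorm (map_mx colf x)).
  by move=> _ [m _ <-]; have := (colf_mxnormP x (op_mxnorm_ge0 (map_mx colf x))).1 (lexx _); apply.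
have hS : has_sup S by split => //; exists (mxnorm (map_mx colf x)).
apply/eqP; rewrite eq_le; apply/andP; split; last exact: ge_sup.
apply/colf_mxnormP.
  have [s Ss] := S0; apply: (@le_trans _ _ s); last exact: sup_upper_bound hS _ Ss.
  by have [m _ <-] := Ss; exact: (rmxnorm_ge0 hf).
by move=> m; apply: sup_upper_bound => //; exists m.
Qed.

End ColumnRep.

Section ColumnElements.
Context {R : realType}.
Variables (X : operatorSpaceType R) (H : hilbertType R).
Variable f : {linear X -> 'B(H, H)}.
Hypothesis hf : complete_isometry f.

Local Notation col := (colf hf).

Lemma CinftyP (x y : Cinfty X) : (forall k, x k = y k) -> x = y.
Proof. by move=> h; apply: val_inj; apply/funext. Qed.

Lemma colf_nrm x : nrm (col x) = nrm x.
Proof. by rewrite /nrm -(colf_isometry hf); congr mxnorm; apply/matrixP => i j; rewrite !mxE. Qed.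

Lemma colf_inj : injective col.
Proof.
move=> x y h; apply: CinftyP => k; apply: (rep_inj hf).
by rewrite -!(crd_colf hf) h.
Qed.

Lemma ell2_opP (K : hilbertType R) (S T : 'B(K, ell2 H)) :
  (forall k, crd H k *o S = crd H k *o T) -> S = T.
Proof.
move=> h; apply: bopP => x; apply: l2P => k.
by have := congr1 (fun U : 'B(K, H) => U x) (h k); rewrite !op_compE !crdE.
Qed.

Lemma single_subproof k (a : X) : (fun j => if j == k then a else 0) \in @col_pred R X.
Proof.
apply/(col_predP hf) => e e0; exists k.+1 => m h.
rewrite big1 => [|i ki]; first by apply: mulr_ge0; exact: sqr_ge0.
by rewrite gtn_eqF ?linear0 ?bop0E ?nr0 ?expr0n.
Qed.

Definition single k (a : X) : Cinfty X := ColumnOf (single_subproof k a).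

Lemma singleE k a j : single k a j = if j == k then a else 0. Proof. by []. Qed.

Lemma colf_single k a : col (single k a) = eps H k *o f a.
Proof.
apply: bopP => h; apply: l2P => j; rewrite colfE op_compE epsE singleE.
by case: ifP; rewrite // linear0.
Qed.

Definition trunc_col n (x : Cinfty X) : Cinfty X := \sum_(k < n) single k (x k).

Lemma Cinfty_sumE I (r : seq I) (P : pred I) (F : I -> Cinfty X) j :
  (\sum_(i <- r | P i) F i) j = \sum_(i <- r | P i) F i j.
Proof. by elim/big_rec2: _ => [|i a b _ <-]. Qed.

Lemma trunc_colE n x j : trunc_col n x j = if (j < n)%N then x j else 0.
Proof.
rewrite /trunc_col Cinfty_sumE; under eq_bigr do rewrite singleE.
have [jn|nj] := ltnP j n.
  rewrite (bigD1 (Ordinal jn))//= eqxx big1 ?addr0// => i /eqP ij.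
  by case: eqP => // e; case: ij; apply: val_inj.
by rewrite big1// => i _; rewrite gtn_eqF// (leq_trans (ltn_ord i)).
Qed.

Lemma trunc_col_cvg (x : Cinfty X) (e : R) : 0 < e ->
  exists N, forall n, (N <= n)%N -> nrm (col (x - trunc_col n x)) <= e.
Proof.
move=> e0; have [N hN] := (col_predP hf x).1 (Cinfty_funP x) e e0.
exists N => n Nn; apply/nrmP => [|h]; first exact: ltW.
apply: (@l2_nr_le R H) => [|m]; first by rewrite mulr_ge0 ?nr_ge0 ?ltW.
rewrite exprMn; apply: le_trans (hN m h); rewrite [leRHS]big_mkcond/=.
apply: ler_sum => k _; rewrite colfE (_ : (x - trunc_col n x) k = x k - trunc_col n x k)//.
rewrite trunc_colE; case: (leqP N k) => Nk.
  by case: ifP; rewrite ?subr0// subrr linear0 bop0E nr0 expr0n sqr_ge0.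
by rewrite (leq_trans Nk Nn) subrr linear0 bop0E nr0 expr0n.
Qed.

End ColumnElements.

Section ColumnModule.
Context {R : realType}.
Variables (A : operatorAlgebraType R) (H : hilbertType R).
Variable f : {linear A -> 'B(H, H)}.
Hypothesis hf : complete_isometry f.
Hypothesis fM : forall a b, f (oamul a b) = f a *o f b.

Local Notation col := (colf hf).

Lemma rmulC_subproof (x : Cinfty A) a : (fun k => oamul (x k) a) \in @col_pred R A.
Proof.
apply/(col_predP hf) => e e0.
have n0 : 0 < nrm (f a) + 1 by rewrite ltr_wpDl ?nrm_ge0.
have [N hN] := (col_predP hf x).1 (Cinfty_funP x) (e / (nrm (f a) + 1)) ltac:(by rewrite divr_gt0).
exists N => m h.
under eq_bigr do rewrite fM op_compE.
apply: le_trans (hN m (f a h)) _.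
rewrite -!exprMn ler_pXn2r ?nnegrE ?mulr_ge0 ?nr_ge0 ?(ltW e0) ?invr_ge0 ?(ltW n0)//.
rewrite -mulrA ler_wpM2l ?(ltW e0)// ler_pdivrMl//.
apply: le_trans (nrm_bound _ _) _; rewrite ler_wpM2r ?nr_ge0//.
by rewrite lerDl.
Qed.

Definition rmulC (x : Cinfty A) a : Cinfty A := ColumnOf (rmulC_subproof x a).

Lemma rmulCE x a k : rmulC x a k = oamul (x k) a. Proof. by []. Qed.

Lemma colf_rmulC x a : col (rmulC x a) = col x *o f a.
Proof. by apply: bopP => h; apply: l2P => k; rewrite op_compE !colfE rmulCE fM. Qed.

End ColumnModule.

Definition mklinear (R : pzRingType) (U V : lmodType R) (g : U -> V) (lg : linear g) :
  {linear U -> V} := HB.pack g (GRing.isLinear.Build R U V _ g lg).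

Lemma mklinearE (R : pzRingType) (U V : lmodType R) (g : U -> V) (lg : linear g) x :
  mklinear lg x = g x.
Proof. by []. Qed.

(** * Separable TROs are sigma-TROs *)

Section Positive.
Context {R : realType} {K : hilbertType R}.

Definition selfadj (S : 'B(K, K)) := forall y z, rdot (S y) z = rdot y (S z).

(** Cauchy-Schwarz for the semidefinite form [rdot (S y) z] at [y] and [S y] gives
    [|S y|^4 <= <S y, y> <S (S y), S y>], and the last factor is at most [C |S y|^2]. This is
    [S^2 <= C S]. *)
Lemma pos_sq (S : 'B(K, K)) (C : R) : selfadj S -> 
  (forall y, 0 <= rdot (S y) y) -> (forall y, rdot (S y) y <= C * nr y ^+ 2) ->
  forall y, nr (S y) ^+ 2 <= C * rdot (S y) y.
Proof.
move=> Sa S0 SC y.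
have cs : rdot (S y) (S y) ^+ 2 <= rdot (S y) y * rdot (S (S y)) (S y).
  apply: psd_cauchy => // t; have := S0 (y + t%:C *: S y).
  rewrite bopD bopZ; set a := rdot _ _; set b := _ + _ + _.
  suff -> : a = b by [].
  by rewrite /a /b !rdotE (Sa (S y) y); ring.
have := le_trans cs (ler_wpM2l (S0 y) (SC (S y))); rewrite -nr2.
have [->|n0] := eqVneq (nr (S y) ^+ 2) 0.
  have [C0|C0] := leP 0 C; first by rewrite mulr_ge0.
  have := SC y; have := S0 y => h1 h2.
  have -> : rdot (S y) y = 0; last by rewrite mulr0.
  apply/eqP; rewrite eq_le h1 andbT; apply: le_trans h2 _.
  by rewrite nmulr_rle0// sqr_ge0.
have p : 0 < nr (S y) ^+ 2 by rewrite lt_def n0 sqr_ge0.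
move=> h; rewrite -(ler_pM2r p) -expr2; apply: le_trans h _.
by rewrite mulrA [rdot _ _ * C]mulrC.
Qed.

Lemma pos_nrm (S : 'B(K, K)) (C : R) : 0 <= C -> selfadj S -> 
  (forall y, 0 <= rdot (S y) y) -> (forall y, rdot (S y) y <= C * nr y ^+ 2) ->
  nrm S <= C.
Proof.
move=> C0 Sa S0 SC; apply/nrmP => // y.
rewrite -(@ler_pXn2r _ 2) ?nnegrE ?nr_ge0 ?mulr_ge0 ?nr_ge0//.
by apply: le_trans (pos_sq Sa S0 SC y) _; rewrite exprMn expr2 -mulrA ler_wpM2l.
Qed.

Variable T : 'B(K, K).
Hypothesis Ta : selfadj T.
Hypothesis T0 : forall y, 0 <= rdot (T y) y.
Hypothesis T1 : forall y, rdot (T y) y <= nr y ^+ 2.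

(* For commuting variables, [r (j+1) = r j (1 - T r j)] gives
   [r j <= 1 / (1 + j T)]; thus [1 - r j], a sum of the squares [r i T r i], is
   an approximate unit for [T] obtained without square roots or inverses. *)
Fixpoint resid (j : nat) : 'B(K, K) :=
  if j is j'.+1 then resid j' - resid j' *o T *o resid j' else bop1 K.

Lemma residS j y : resid j.+1 y = resid j y - resid j (T (resid j y)).
Proof. by []. Qed.

Lemma resid_selfadj j : selfadj (resid j).
Proof.
elim: j => [|j IH] y z; first by [].
by rewrite !residS rdotBl rdotBr !IH Ta IH.
Qed.

(** With [g = resid j y], the step subtracts [<T g, g>] from [<resid j y, y>]. This is at most
    [|g|^2], which [pos_sq] bounds by [<resid j y, y>], so positivity persists. *)
Lemma resid_bounds j :
  (forall y, 0 <= rdot (resid j y) y) /\ (forall y, rdot (resid j y) y <= nr y ^+ 2).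
Proof.
elim: j => [|j [r0 r1]].
  by split=> y; rewrite -nr2// sqr_ge0.
have sq y : nr (resid j y) ^+ 2 <= rdot (resid j y) y.
  rewrite -[leRHS]mul1r; apply: pos_sq => // [|z]; first exact: resid_selfadj.
  by rewrite mul1r.
have E y : rdot (resid j.+1 y) y = rdot (resid j y) y - rdot (T (resid j y)) (resid j y).
  by rewrite residS rdotBl; congr (_ - _); rewrite resid_selfadj.
split=> y; rewrite E.
  by rewrite subr_ge0; apply: le_trans (T1 _) (sq y).
by apply: le_trans (r1 y); rewrite gerBl.
Qed.

Lemma resid_sq j y : nr (resid j y) ^+ 2 <= rdot (resid j y) y.
Proof.
have [r0 r1] := resid_bounds j.
rewrite -[leRHS]mul1r; apply: pos_sq => // [|z]; first exact: resid_selfadj.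
by rewrite mul1r.
Qed.

Lemma resid_nr j y : nr (resid j y) <= nr y.
Proof.
rewrite -(@ler_pXn2r _ 2) ?nnegrE ?nr_ge0//.
by apply: le_trans (resid_sq j y) _; have [_] := resid_bounds j; apply.
Qed.

Definition resid_form j y := rdot (T (resid j y)) (resid j y).

(** Expanding the square gives the cross term [-2 <w, T g>] with [w = resid j (T g)]; it outweighs
    [<T w, w> <= |w|^2 <= <w, T g>], again by [pos_sq]. *)
Lemma resid_form_decr j y : resid_form j.+1 y <= resid_form j y.
Proof.
rewrite /resid_form residS; set g := resid j y; set w := resid j (T g).
have -> : rdot (T (g - w)) (g - w) = rdot (T g) g - 2 * rdot w (T g) + rdot (T w) w.
  by rewrite bopB !rdotE (Ta w g) (rdotC (T g) w); ring.
have h1 : rdot (T w) w <= rdot w (T g) by apply: le_trans (T1 _) (resid_sq _ _).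
have h2 : 0 <= rdot w (T g) by have [+ _] := resid_bounds j; apply.
by lra.
Qed.

Lemma resid_form_sum J y :
  \sum_(j < J) resid_form j y = nr y ^+ 2 - rdot (resid J y) y.
Proof.
elim: J => [|J IH]; first by rewrite big_ord0 -nr2 subrr.
by rewrite residS big_ord_recr/= IH rdotBl (@resid_selfadj J (T _) y) /resid_form; ring.
Qed.

(** The terms decrease and their telescoping sum is at most [|y|^2], so the last one is at most
    [|y|^2 / J]. This is the rate at which the iteration dies out. *)
Lemma resid_form_le J y : J%:R * resid_form J y <= nr y ^+ 2.
Proof.
apply: (@le_trans _ _ (\sum_(j < J) resid_form j y)); last first.
  by rewrite resid_form_sum gerBl; have [+ _] := resid_bounds J; apply.
rewrite mulr_natl -[X in _ *+ X]card_ord -sumr_const; apply: ler_sum => j _.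
elim: J j => [|J IH] [j //=]; rewrite ltnS leq_eqVlt => /orP[/eqP -> |jJ].
  exact: resid_form_decr.
by apply: le_trans (resid_form_decr _ _) (IH (Ordinal jJ)).
Qed.

End Positive.

Lemma ler_sum_uniq_sub (R : numDomainType) (I : eqType) (s s' : seq I) (F : I -> R) :
  (forall i, 0 <= F i) -> uniq s -> uniq s' -> {subset s <= s'} ->
  \sum_(i <- s) F i <= \sum_(i <- s') F i.
Proof.
move=> F0 us us' ss'.
rewrite (perm_big [seq i <- s' | i \in s])/=; last first.
  apply: uniq_perm => //; first exact: filter_uniq.
  by move=> i; rewrite mem_filter; case: (boolP (i \in s)) => //= /ss' ->.
rewrite big_filter [leLHS]big_mkcond/=; apply: ler_sum => i _.
by case: ifP.
Qed.

(** * Double series of nonnegative terms summed along an enumeration of pairs *)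

Section PairSums.
Context {R : realType}.
Variable F : nat * nat -> R.
Hypothesis F0 : forall p, 0 <= F p.

(** [pickle_inv] is partial: a number that encodes no pair contributes [0]. *)
Definition pair_term (i : nat) : R := if pickle_inv i is Some p then F p else 0.

Lemma pair_term_sum n :
  \sum_(i < n) pair_term i = \sum_(p <- pmap (@pickle_inv (nat * nat)%type) (iota 0 n)) F p.
Proof.
rewrite -(big_mkord xpredT pair_term) /index_iota subn0.
elim: (iota 0 n) => [|i s IH]; first by rewrite !big_nil.
rewrite big_cons /= IH /pair_term; case: pickle_inv => [p|] /=.
  by rewrite big_cons.
by rewrite add0r.
Qed.

Lemma pair_rect_sum J L :
  \sum_(p <- [seq (j, k) | j <- iota 0 J, k <- iota 0 L]) F p =
  \sum_(j < J) \sum_(k < L) F (j : nat, k : nat).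
Proof.
rewrite big_allpairs -(big_mkord xpredT (fun j => \sum_(k < L) F (j : nat, k : nat))).
rewrite /index_iota subn0; apply: eq_bigr => j _.
by rewrite -(big_mkord xpredT (fun k => F (j, k))) /index_iota subn0.
Qed.

Lemma uniq_pmap_pickle n : uniq (pmap (@pickle_inv (nat * nat)%type) (iota 0 n)).
Proof. by apply: (pmap_uniq (@pickle_invK _)); exact: iota_uniq. Qed.

Lemma uniq_rect J L : uniq [seq (j, k) | j <- iota 0 J, k <- iota 0 L].
Proof. by apply: allpairs_uniq; rewrite ?iota_uniq// => -[a b] [c d]. Qed.

Lemma mem_pmap_pickle n p :
  (p \in pmap (@pickle_inv (nat * nat)%type) (iota 0 n)) = (pickle p < n)%N.
Proof.
rewrite mem_pmap; apply/mapP/idP => [[l]|pn].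
  rewrite mem_iota add0n => /= l_n /esym h.
  by have := @pickle_invK (nat * nat)%type l; rewrite /oapp h => ->.
by exists (pickle p); rewrite ?mem_iota ?add0n// pickleK_inv.
Qed.

Lemma mem_rect J L j k :
  ((j, k) \in [seq (j, k) | j <- iota 0 J, k <- iota 0 L]) = (j < J)%N && (k < L)%N.
Proof.
apply/allpairsP/andP => [[[a b] /= [+ + [-> ->]]]|[jJ kL]].
  by rewrite !mem_iota !add0n.
by exists (j, k); rewrite !mem_iota !add0n.
Qed.

(** Finitely many pairs fit into a square, and the terms are nonnegative, so bounds on rectangles
    suffice whatever the enumeration. *)
Lemma pair_sum_le (B : R) n :
  (forall J L, \sum_(j < J) \sum_(k < L) F (j : nat, k : nat) <= B) -> \sum_(i < n) pair_term i <= B.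
Proof.
move=> hB; rewrite pair_term_sum.
set s := pmap _ _.
pose J := (\max_(p <- s) (maxn p.1 p.2)).+1.
apply: le_trans (hB J J); rewrite -pair_rect_sum.
apply: ler_sum_uniq_sub => //; rewrite ?uniq_pmap_pickle ?uniq_rect//.
move=> [j k] ps; rewrite mem_rect !ltnS.
have h : (maxn j k <= \max_(p <- s) (maxn p.1 p.2))%N.
  exact: (leq_bigmax_seq (j, k) (P := xpredT) (F := fun p : nat * nat => maxn p.1 p.2)).
by rewrite !(leq_trans _ h)// ?leq_maxl ?leq_maxr.
Qed.

End PairSums.

Section NullSequences.
Context {R : realType}.
Variables H K L : hilbertType R.

(** Uniform boundedness absorbs the approximation error, and a finite combination needs only
    finitely many thresholds. The summands [+ 1] in the denominators keep them nonzero. *)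
Lemma null_seq_closure (Q : nat -> 'B(K, L)) (C : R) (G : set 'B(H, K)) :
  (forall n, nrm (Q n) <= C) ->
  (forall y, G y -> forall e : R, 0 < e ->
     exists n0, forall n, (n0 <= n)%N -> nrm (Q n *o y) <= e) ->
  forall y, norm_closure (lin_span G) y -> forall e : R, 0 < e ->
     exists n0, forall n, (n0 <= n)%N -> nrm (Q n *o y) <= e.
Proof.
move=> QC QG y hy e e0.
have C0 : 0 <= C by apply: le_trans (QC 0%N); exact: nrm_ge0.
have C1 : 0 < 2 * (C + 1) by rewrite mulr_gt0// ltr_wpDl.
have [z [p [b [s [hs zE]]]] yz] := hy (e / (2 * (C + 1))) ltac:(by rewrite divr_gt0).
have M0 i : 0 < modc (b i) + 1 by rewrite ltr_wpDl ?modc_ge0.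
have P0 : 0 < p.+1%:R :> R by [].
have e2 : 0 < e / 2 by rewrite divr_gt0.
have h i : exists n0, forall n, (n0 <= n)%N ->
    nrm (Q n *o s i) <= e / 2 / p.+1%:R / (modc (b i) + 1).
  by apply: QG => //; rewrite !divr_gt0.
have [n0 hn0] := choice h.
exists (\max_(i < p) n0 i) => n hn.
have -> : y = (y - z) + z by rewrite subrK.
rewrite op_compDr; apply: le_trans (nrmD _ _) _; rewrite [e]splitr lerD//.
  apply: le_trans (nrm_comp _ _) _.
  apply: (@le_trans _ _ ((C + 1) * (e / (2 * (C + 1))))).
    apply: ler_pM; rewrite ?nrm_ge0 ?(ltW yz)//.
    by apply: le_trans (QC n) _; rewrite lerDl.
  by rewrite le_eqVlt; apply/orP; left; apply/eqP; field; rewrite gt_eqF// ltr_wpDl.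
rewrite zE op_comp_sumr; apply: le_trans (nrm_sum _ _ _) _.
apply: (@le_trans _ _ (\sum_(i < p) e / 2 / p.+1%:R)); last first.
  rewrite sumr_const card_ord -[leLHS]mulr_natl mulrCA ger_pMr// ler_pdivrMr// mul1r.
  by rewrite ler_nat.
apply: ler_sum => i _; rewrite op_compZr; apply: le_trans (nrmZ_le _ _) _.
have hi := hn0 i n (leq_trans (leq_bigmax i) hn).
apply: (@le_trans _ _ ((modc (b i) + 1) * (e / 2 / p.+1%:R / (modc (b i) + 1)))).
  by apply: ler_pM; rewrite ?modc_ge0 ?nrm_ge0// lerDl.
by rewrite mulrC divfK// gt_eqF.
Qed.

End NullSequences.

(** * A quasi-unit of squares in a separable TRO *)

Section SeparableTRO.
Context {R : realType}.
Variables H K : hilbertType R.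
Variable N : set 'B(H, K).
Hypothesis Nsub : linear_subspace N.
Hypothesis Ntri : forall x y z, N x -> N y -> N z -> N (x *o y^adj *o z).
Hypothesis Ncl : norm_closure N `<=` N.
Variable x : nat -> 'B(H, K).
Hypothesis Nx : forall k, N (x k).
Hypothesis Nd : N `<=` norm_closure (lin_span (range x)).

Let N0 : N 0. Proof. exact: Nsub.1. Qed.
Let ND y z : N y -> N z -> N (y + z).
Proof. by move=> Ny Nz; rewrite -[y]scale1r; exact: Nsub.2. Qed.
Let NZ c y : N y -> N (c *: y).
Proof. by move=> Ny; rewrite -[_ *: _]addr0; exact: Nsub.2. Qed.
Let NB y z : N y -> N z -> N (y - z).
Proof. by move=> Ny Nz; rewrite -scaleN1r; apply: ND => //; exact: NZ. Qed.
Let Nsum (n : nat) (F : nat -> 'B(H, K)) : (forall i, N (F i)) -> N (\sum_(i < n) F i).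
Proof. by move=> NF; elim/big_rec: _ => // i y _ Ny; exact: ND. Qed.

Let a k : R := 2^-1 ^+ k.
Let a0 k : 0 < a k. Proof. by rewrite exprn_gt0. Qed.
Let aS k : a k = a k.+1 + a k.+1. Proof. by rewrite /a exprS; set u := _ ^+ k; lra. Qed.
Let a1 k : a k <= 1. Proof. by rewrite exprn_ile1// ?invf_le1// ler1n. Qed.

Lemma geo_tail m n : \sum_(k < m | (n <= k)%N) a k.+1 <= a n.
Proof.
suff : \sum_(k < m | (n <= k)%N) a k.+1 = if (n <= m)%N then a n - a m else 0.
  by move=> ->; case: ifP => _; [rewrite gerBl ltW|rewrite ltW].
elim: m => [|m IH].
  by rewrite big_ord0; case: ifP => //; rewrite leqn0 => /eqP ->; rewrite subrr.
rewrite big_mkcond big_ord_recr/= -big_mkcond/= IH.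
have [nm|mn|->] := ltngtP n m.
- by rewrite leqW 1?ltnW// (aS m); ring.
- rewrite addr0; case: ifP => // nm1.
  by have -> : n = m.+1 by [apply/eqP; rewrite eqn_leq nm1 mn]; rewrite subrr.
- by rewrite leqnSn (aS m); ring.
Qed.

(** The rescaling gives [nrm (t k) <= 2^-(k+1)]: the sum of the [t_k t_k^adj] then converges in norm
    with explicit tails and lies between [0] and [1], while [x k] remains a multiple of [t k]. *)
Let c k : R := a k.+1 / (1 + nrm (x k)).
Let nx1 k : 0 < 1 + nrm (x k). Proof. by rewrite ltr_pwDl// nrm_ge0. Qed.
Let c0 k : 0 < c k. Proof. by rewrite divr_gt0. Qed.
Let t k : 'B(H, K) := (c k)%:C *: x k.

Let Nt k : N (t k). Proof. exact: NZ. Qed.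

Let t_nrm k : nrm (t k) <= a k.+1.
Proof.
apply: le_trans (nrmZ_le _ _) _; rewrite modcR ?(ltW (c0 k))//.
rewrite /c -mulrA ger_pMr// ler_pdivrMl// mulr1.
by rewrite lerDr.
Qed.

Let t_adj k y : nr ((t k)^adj y) ^+ 2 <= a k.+1 * nr y ^+ 2.
Proof.
apply: (@le_trans _ _ ((a k.+1 * nr y) ^+ 2)).
  rewrite ler_pXn2r ?nnegrE ?nr_ge0 ?mulr_ge0 ?nr_ge0 ?(ltW (a0 _))//.
  by apply: nrm_boundC; rewrite nrm_adj.
by rewrite exprMn ler_wpM2r ?sqr_ge0// expr2 ger_pMr.
Qed.

Let tail m n y :
  \sum_(k < m | (n <= k)%N) nr ((t k)^adj y) ^+ 2 <= a n * nr y ^+ 2.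
Proof.
apply: (@le_trans _ _ (\sum_(k < m | (n <= k)%N) a k.+1 * nr y ^+ 2)).
  by apply: ler_sum => k _; exact: t_adj.
by rewrite -mulr_suml ler_wpM2r ?sqr_ge0// geo_tail.
Qed.

(** The purpose is [T = V^adj *o V], the sum of all [t_k t_k^adj], whose form at [y] is the squared
    norm of a vector of [ell2 H]. *)
Lemma frame_exists : exists2 V : 'B(K, ell2 H),
  (forall y k, (V y : ell2 H) k = (t k)^adj y) & nrm V <= 1.
Proof.
apply: (@colop_exists R H K (fun k => (t k)^adj)) => // n y.
by have := tail n 0 y; rewrite /a expr0 expr1n.
Qed.

Let V := s2val (cid2 frame_exists).
Let VE y k : (V y : ell2 H) k = (t k)^adj y. Proof. by rewrite /V; case: cid2. Qed.
Let V1 : nrm V <= 1. Proof. by rewrite /V; case: cid2. Qed.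
Let T := V^adj *o V.

Let TE y z : rdot (T y) z = rdot (V y) (V z).
Proof. exact: radjP'. Qed.
Let Ta : selfadj T. Proof. by move=> y z; rewrite TE rdotC -TE rdotC. Qed.
Let T0 y : 0 <= rdot (T y) y. Proof. by rewrite TE -nr2 sqr_ge0. Qed.
Let T1 y : rdot (T y) y <= nr y ^+ 2.
Proof.
rewrite TE -nr2 ler_pXn2r ?nnegrE ?nr_ge0//.
by have := nrm_boundC y V1; rewrite mul1r.
Qed.

Local Notation r := (resid T).

Let Vbound y L : nr (V y) ^+ 2 <= \sum_(k < L) nr ((t k)^adj y) ^+ 2 + a L * nr y ^+ 2.
Proof.
rewrite (l2_nr2 (V y)); apply: l2dot_le => n.
under eq_bigr do rewrite VE.
apply: (@le_trans _ _ (\sum_(k < maxn n L) nr ((t k)^adj y) ^+ 2)).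
  rewrite -!(big_mkord xpredT (fun k => nr ((t k)^adj y) ^+ 2)).
  rewrite [leRHS](big_cat_nat (leq0n n))/= ?leq_maxl// lerDl.
  by apply: sumr_ge0 => k _; exact: sqr_ge0.
rewrite (bigID (fun k : 'I__ => (L <= k)%N))/= addrC lerD ?tail//.
under eq_bigl do rewrite -ltnNge.
by apply: (@ler_sum_below _ (fun k => nr ((t k)^adj y) ^+ 2)) => k; exact: sqr_ge0.
Qed.

(** The finite sums [Tn] map [N] into itself by the triple product. The difference [T - Tn] is
    positive with form at most [a n], so [pos_nrm] makes the convergence one in norm and [N] is
    closed. *)
Let T_N y : N y -> N (T *o y).
Proof.
move=> Ny; apply: Ncl => e e0.
have ny : 0 < nrm y + 1 by rewrite ltr_wpDl ?nrm_ge0.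
have [n hn] : exists n, a n < e / (nrm y + 1).
  have /ex_inv_lt[M hM] : 0 < e / (nrm y + 1) by rewrite divr_gt0.
  exists M; apply: le_lt_trans (hM M (leqnn _)).
  rewrite /a exprVn lef_pV2 ?posrE ?exprn_gt0// -natrX ler_nat.
  by rewrite ltn_expl.
pose Tn := \sum_(k < n) t k *o (t k)^adj.
exists (Tn *o y).
  rewrite op_comp_suml; apply: (@Nsum n (fun k => t k *o (t k)^adj *o y)) => k.
  exact: Ntri.
rewrite -op_compBl; apply: le_lt_trans (nrm_comp _ _) _.
have TnE z : rdot (Tn z) z = \sum_(k < n) nr ((t k)^adj z) ^+ 2.
  rewrite /Tn bop_sumE rdot_suml; apply: eq_bigr => k _.
  by rewrite op_compE radjP nr2.
have DE z : rdot ((T - Tn) z) z = nr (V z) ^+ 2 - \sum_(k < n) nr ((t k)^adj z) ^+ 2.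
  by rewrite bopBE rdotBl TnE TE nr2.
have : nrm (T - Tn) <= a n.
  apply: pos_nrm => [|u v|z|z]; first exact: ltW.
  - rewrite !bopBE rdotBl rdotBr Ta /Tn !bop_sumE rdot_suml rdot_sumr.
    by congr (_ - _); apply: eq_bigr => k _; rewrite !op_compE radjP radjP'.
  - rewrite DE subr_ge0; apply: le_trans (l2_nr_psum (V z) n).
    by apply: ler_sum => k _; rewrite VE.
  - by rewrite DE lerBlDl Vbound.
move=> h; apply: (@le_lt_trans _ _ (a n * (nrm y + 1))).
  by apply: ler_pM; rewrite ?nrm_ge0// lerDl.
by rewrite -ltr_pdivlMr.
Qed.

Let r_N j y : N y -> N (r j *o y).
Proof.
elim: j y => [|j IH] y Ny; first by rewrite op_comp1l.
rewrite /= op_compBl; apply: NB; first exact: IH.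
rewrite -[_ *o T *o _ *o y]op_compA -op_compA.
exact: (IH _ (T_N (IH _ Ny))).
Qed.

(** For fixed [j] the squares of the [r j *o t k] add up to [r j *o T *o r j], the amount by which
    [r] drops at step [j]. The double family is flattened since a sigma-TRO asks for a single
    sequence. *)
Definition tro_seq (i : nat) : 'B(H, K) :=
  if pickle_inv i is Some (j, k) then r j *o t k else 0.

Local Notation m := tro_seq.

Let m_N i : N (m i).
Proof. by rewrite /m; case: pickle_inv => // -[j k]; apply: r_N. Qed.

Let F y (p : nat * nat) : R := nr ((t p.2)^adj (r p.1 y)) ^+ 2.
Let F0 y p : 0 <= F y p. Proof. exact: sqr_ge0. Qed.

Let r_adj j : (r j)^adj = r j.
Proof. by apply: adj_uniq => u v; exact: resid_selfadj. Qed.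

Let m_adj i y : nr ((m i)^adj y) ^+ 2 = pair_term (F y) i.
Proof.
rewrite /m /pair_term; case: pickle_inv => [[j k]|]; last by rewrite adj0 bop0E nr0 expr0n.
by rewrite adj_comp op_compE r_adj.
Qed.

Let S n := \sum_(i < n) m i *o (m i)^adj.

Let SE n y : rdot (S n y) y = \sum_(i < n) nr ((m i)^adj y) ^+ 2.
Proof.
rewrite /S bop_sumE rdot_suml; apply: eq_bigr => k _.
by rewrite op_compE radjP nr2.
Qed.

Let Sa n : selfadj (S n).
Proof.
move=> u v; rewrite /S !bop_sumE rdot_suml rdot_sumr.
by apply: eq_bigr => k _; rewrite !op_compE radjP radjP'.
Qed.

Let S0 n y : 0 <= rdot (S n y) y.
Proof. by rewrite SE; apply: sumr_ge0 => i _; exact: sqr_ge0. Qed.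

Let row_le j L y : \sum_(k < L) F y (j : nat, k : nat) <= resid_form T j y.
Proof.
rewrite /resid_form TE -nr2; apply: le_trans (l2_nr_psum (V (r j y)) L).
by apply: ler_sum => k _; rewrite VE.
Qed.

Let S1 n y : rdot (S n y) y <= nr y ^+ 2.
Proof.
rewrite SE; under eq_bigr do rewrite m_adj.
apply: pair_sum_le => // J L.
apply: (@le_trans _ _ (\sum_(j < J) resid_form T j y)).
  by apply: ler_sum => j _; exact: row_le.
by rewrite (resid_form_sum Ta) gerBl; have [+ _] := resid_bounds Ta T0 T1 J; apply.
Qed.

Let Q n := bop1 K - S n.
Let QE n y : rdot (Q n y) y = nr y ^+ 2 - rdot (S n y) y.
Proof. by rewrite bopBE rdotBl nr2. Qed.
Let Qa n : selfadj (Q n).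
Proof. by move=> u v; rewrite !bopBE rdotBl rdotBr Sa. Qed.
Let Q_sq n y : nr (Q n y) ^+ 2 <= rdot (Q n y) y.
Proof.
rewrite -[leRHS]mul1r; apply: pos_sq => // z; rewrite QE.
  by rewrite subr_ge0.
by rewrite mul1r gerBl.
Qed.

Let pair_sum_ge_y J L : exists n0, forall n, (n0 <= n)%N -> forall y,
  \sum_(j < J) \sum_(k < L) F y (j : nat, k : nat) <= \sum_(i < n) pair_term (F y) i.
Proof.
pose s := [seq (j, k) | j <- iota 0 J, k <- iota 0 L].
exists (\max_(p <- s) pickle p).+1 => n hn y.
rewrite pair_term_sum -pair_rect_sum.
apply: ler_sum_uniq_sub => //; rewrite ?uniq_pmap_pickle ?uniq_rect//.
move=> p ps; rewrite mem_pmap_pickle; apply: leq_trans hn; rewrite ltnS.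
exact: (leq_bigmax_seq p (P := xpredT) (F := fun p : nat * nat => pickle p)).
Qed.

(** Once the partial sum contains the rectangle, [Q n] is below [1] minus the sum over the
    rectangle. Full rows would leave [r J]; cutting each of the [J] rows at [L] costs at most
    [a L]. *)
Let Q_form J L : exists n0, forall n, (n0 <= n)%N -> forall y,
  rdot (Q n y) y <= rdot (r J y) y + J%:R * a L * nr y ^+ 2.
Proof.
have [n0 h0] := pair_sum_ge_y J L; exists n0 => n hn y.
rewrite QE SE; under eq_bigr do rewrite m_adj.
have h1 := h0 n hn y.
have h2 : \sum_(j < J) resid_form T j y <=
    \sum_(j < J) \sum_(k < L) F y (j : nat, k : nat) + J%:R * a L * nr y ^+ 2.
  rewrite -mulrA -[X in X%:R]card_ord mulr_natl -sumr_const -big_split/=.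
  apply: ler_sum => j _; rewrite /resid_form TE -nr2.
  apply: le_trans (Vbound _ L) _; rewrite lerD2l ler_wpM2l ?(ltW (a0 _))//.
  by rewrite ler_pXn2r ?nnegrE ?nr_ge0// (resid_nr Ta T0 T1).
move: h1 h2; rewrite (resid_form_sum Ta); lra.
Qed.

(** Moving [x k] to the other side leaves the vector [(x k)^adj u], a multiple of [(t k)^adj u]. Its
    squared norm is one term of [<T u, u>], which [resid_form_le] makes small. *)
Let r_gen J k h : rdot (r J.+1 (x k h)) (x k h) <=
  (c k)^-1 * nrm (x k) * Num.sqrt J.+1%:R^-1 * nr h ^+ 2.
Proof.
set z := x k h; set u := r _ z.
have J0 : 0 <= J.+1%:R^-1 :> R by rewrite invr_ge0.
have h1 : nr ((t k)^adj u) <= Num.sqrt J.+1%:R^-1 * nr z.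
  rewrite -(@ler_pXn2r _ 2) ?nnegrE ?nr_ge0 ?mulr_ge0 ?nr_ge0 ?sqrtr_ge0//.
  rewrite exprMn sqr_sqrtr// ler_pdivlMl//.
  apply: le_trans (resid_form_le Ta T0 T1 J.+1 z); rewrite ler_pM2l//.
  apply: le_trans (row_le J.+1 k.+1 z); rewrite big_ord_recr/= lerDr.
  by apply: sumr_ge0 => i _; exact: F0.
have h2 : nr ((t k)^adj u) = c k * nr ((x k)^adj u).
  by rewrite /t adjZ conjc_real bopZE nrZR// ltW.
have h3 : nr z <= nrm (x k) * nr h by exact: nrm_bound.
have -> : rdot u z = rdot ((x k)^adj u) h by rewrite /z radjP'.
apply: le_trans (rdot_le _ _) _.
have -> : (c k)^-1 * nrm (x k) * Num.sqrt J.+1%:R^-1 * nr h ^+ 2 =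
  ((c k)^-1 * (Num.sqrt J.+1%:R^-1 * (nrm (x k) * nr h))) * nr h by ring.
rewrite ler_wpM2r ?nr_ge0// ler_pdivlMl// -h2; apply: le_trans h1 _.
by rewrite ler_wpM2l ?sqrtr_ge0.
Qed.

Let a_lt (e : R) : 0 < e -> exists L, a L < e.
Proof.
move=> /ex_inv_lt[M hM]; exists M; apply: le_lt_trans (hM M (leqnn _)).
rewrite /a exprVn lef_pV2 ?posrE ?exprn_gt0// -natrX ler_nat.
by rewrite ltn_expl.
Qed.

Let Q_gen k (e : R) : 0 < e -> exists n0, forall n, (n0 <= n)%N -> nrm (Q n *o x k) <= e.
Proof.
move=> e0; pose B := (c k)^-1 * nrm (x k).
have B0 : 0 <= B by rewrite mulr_ge0 ?nrm_ge0// invr_ge0 ltW.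
have e2 : 0 < e ^+ 2 / 2 by rewrite divr_gt0// exprn_gt0.
(* The index [J] is fixed first, making the residual term at most half of [e ^+ 2]; the cut [L] is
   then chosen for this [J], so that the factor [J.+1] is harmless. *)
have [J hJ] : exists J : nat, B * Num.sqrt J.+1%:R^-1 <= e ^+ 2 / 2.
  have d0 : 0 < (e ^+ 2 / 2 / (B + 1)) ^+ 2 by rewrite exprn_gt0// divr_gt0// ltr_wpDl.
  have [J hJ] := ex_inv_lt d0; exists J.
  have B1 : 0 < B + 1 by rewrite ltr_wpDl.
  apply: (@le_trans _ _ ((B + 1) * Num.sqrt J.+1%:R^-1)).
    by rewrite ler_wpM2r ?sqrtr_ge0// lerDl.
  rewrite mulrC -ler_pdivlMr//; apply: (@le_trans _ _ (Num.sqrt ((e ^+ 2 / 2 / (B + 1)) ^+ 2))).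
    by apply/ler_wsqrtr/ltW/hJ.
  by rewrite sqrtr_sqr ger0_norm// divr_ge0// ltW.
pose D := J.+1%:R * nrm (x k) ^+ 2.
have D0 : 0 <= D by rewrite mulr_ge0 ?sqr_ge0.
have D1 : 0 < D + 1 by rewrite ltr_wpDl.
have [L hL] : exists L, a L < e ^+ 2 / 2 / (D + 1) by apply: a_lt; rewrite divr_gt0.
have [n0 hn0] := Q_form J.+1 L; exists n0 => n hn.
apply/nrmP => [|h]; first exact: ltW.
rewrite -(@ler_pXn2r _ 2) ?nnegrE ?nr_ge0 ?mulr_ge0 ?nr_ge0 ?(ltW e0)//.
rewrite op_compE; apply: le_trans (Q_sq _ _) _; apply: le_trans (hn0 n hn _) _.
have h1 := r_gen J k h.
have h2 : J.+1%:R * a L * nr (x k h) ^+ 2 <= (e ^+ 2 / 2) * nr h ^+ 2.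
  have : nr (x k h) ^+ 2 <= nrm (x k) ^+ 2 * nr h ^+ 2.
    by rewrite -exprMn ler_pXn2r ?nnegrE ?nr_ge0 ?mulr_ge0 ?nr_ge0 ?nrm_ge0// nrm_bound.
  move=> /(ler_wpM2l (ltac:(by rewrite mulr_ge0// ltW) : 0 <= J.+1%:R * a L)) /le_trans; apply.
  rewrite mulrA ler_wpM2r ?sqr_ge0//.
  have -> : J.+1%:R * a L * nrm (x k) ^+ 2 = a L * D by rewrite /D; ring.
  apply: (@le_trans _ _ (a L * (D + 1))); first by rewrite ler_wpM2l ?lerDl// ltW.
  by rewrite -ler_pdivlMr// ltW.
have h3 : B * Num.sqrt J.+1%:R^-1 * nr h ^+ 2 <= e ^+ 2 / 2 * nr h ^+ 2.
  by rewrite ler_wpM2r ?sqr_ge0.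
rewrite exprMn; move: h1 h2 h3; rewrite -/B.
by set p := rdot _ _; set q := _ * a L * _; set w := B * _ * _; set v := nr h ^+ 2; lra.
Qed.

Let Q1 n : nrm (Q n) <= 1.
Proof.
apply: pos_nrm => // y; rewrite QE; first by rewrite subr_ge0.
by rewrite mul1r gerBl.
Qed.

Lemma separable_TRO_sequence : exists u : nat -> 'B(H, K), [/\ forall i, N (u i),
  forall y, N y -> forall e : R, 0 < e -> exists n0, forall n, (n0 <= n)%N ->
    nrm (\sum_(i < n) u i *o (u i)^adj *o y - y) < e &
  forall n, nrm (\sum_(i < n) u i *o (u i)^adj) <= 1].
Proof.
exists m; split => [//|y Ny e e0|n].
  have Qx z : range x z -> forall d : R, 0 < d ->
      exists n0, forall n, (n0 <= n)%N -> nrm (Q n *o z) <= d.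
    by move=> [k _ <-] d; exact: Q_gen.
  have [n0 hn0] := null_seq_closure Q1 Qx (Nd Ny) (ltac:(by rewrite divr_gt0) : 0 < e / 2).
  exists n0 => n hn; rewrite -op_comp_suml -/(S n) nrmBC.
  have -> : y - S n *o y = Q n *o y by rewrite op_compBl op_comp1l.
  by apply: le_lt_trans (hn0 n hn) _; rewrite ltr_pdivrMr// mulr_natr mulr2n ltrDl.
apply: pos_nrm => [||y|y]; first exact: ler01.
- exact: (@Sa n).
- exact: (S0 n y).
- by rewrite mul1r; exact: (S1 n y).
Qed.

End SeparableTRO.

Lemma cvg0P (R : realType) (u : nat -> R) : (u n @[n --> \oo] --> (0 : R)) <->
  forall e : R, 0 < e -> exists n0, forall n, (n0 <= n)%N -> `|u n| < e.
Proof.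
split=> [/cvgrPdist_lt h e e0|h].
  have [n0 _ hn0] := h e e0; exists n0 => n hn.
  by have := hn0 n hn; rewrite /= sub0r normrN.
apply/cvgrPdist_lt => e e0; have [n0 hn0] := h e e0.
by exists n0 => // n hn /=; rewrite sub0r normrN; apply: hn0.
Qed.

Lemma nrm_cvg0P (R : realType) (H K : hilbertType R) (u : nat -> 'B(H, K)) :
  (nrm (u n) @[n --> \oo] --> (0 : R)) <->
  forall e : R, 0 < e -> exists n0, forall n, (n0 <= n)%N -> nrm (u n) < e.
Proof.
apply: (iff_trans (cvg0P _)); split=> h e /h[n0 hn0]; exists n0 => n /hn0;
  by rewrite ger0_norm ?nrm_ge0.
Qed.

(** * Linear spans and their norm closures *)

Section Spans.
Context {R : realType}.
Implicit Types H K : hilbertType R.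

Lemma lin_span_ind (V : lmodType R[i]) (G P : set V) :
  P 0 -> (forall x y, P x -> P y -> P (x + y)) -> (forall c x, P x -> P (c *: x)) ->
  G `<=` P -> lin_span G `<=` P.
Proof.
move=> P0 PD PZ GP _ [n [c [s [hs ->]]]].
by elim/big_rec: _ => // i y _ Py; apply: PD => //; apply/PZ/GP.
Qed.

Lemma lin_span_gen (V : lmodType R[i]) (G : set V) x : G x -> lin_span G x.
Proof.
move=> Gx; exists 1%N, (fun=> 1), (fun=> x); split => //.
by rewrite big_ord1 scale1r.
Qed.

Lemma lin_spanZ (V : lmodType R[i]) (G : set V) c x : lin_span G x -> lin_span G (c *: x).
Proof.
move=> [n [b [s [hs ->]]]]; exists n, (fun i => c * b i), s; split=> //.
by rewrite scaler_sumr; apply: eq_bigr => i _; rewrite scalerA.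
Qed.

Lemma lin_span0 (V : lmodType R[i]) (G : set V) : lin_span G 0.
Proof. by exists 0%N, (fun=> 0), (fun=> 0); rewrite big_ord0; split=> // -[]. Qed.

Lemma lin_spanD (V : lmodType R[i]) (G : set V) x y :
  lin_span G x -> lin_span G y -> lin_span G (x + y).
Proof.
move=> [n [b [s [hs ->]]]] [m [c [t [ht ->]]]].
exists (n + m)%N,
  (fun i => match fintype.split i with inl j => b j | inr j => c j end),
  (fun i => match fintype.split i with inl j => s j | inr j => t j end).
split; first by move=> i; case: fintype.split.
rewrite big_split_ord/=; congr (_ + _); apply: eq_bigr => i _.
  by rewrite (unsplitK (inl i)).
by rewrite (unsplitK (inr i)).
Qed.

Lemma norm_closure_id H K (S : set 'B(H, K)) : S `<=` norm_closure S.
Proof. by move=> x Sx e e0; exists x => //; rewrite subrr nrm0. Qed.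

Lemma norm_closureK H K (S : set 'B(H, K)) :
  norm_closure (norm_closure S) `<=` norm_closure S.
Proof.
move=> x hx e e0; have e2 : 0 < e / 2 by rewrite divr_gt0.
have [y hy xy] := hx _ e2; have [z Sz yz] := hy _ e2; exists z => //.
by apply: le_lt_trans (nrm_triangle _ y _) _; rewrite [e]splitr ltrD.
Qed.

Lemma norm_closure_image H K H' K' (g : 'B(H, K) -> 'B(H', K')) (C : R)
    (S : set 'B(H, K)) (S' : set 'B(H', K')) :
  (forall x y, nrm (g x - g y) <= C * nrm (x - y)) ->
  (forall x, S x -> norm_closure S' (g x)) ->
  forall x, norm_closure S x -> norm_closure S' (g x).
Proof.
move=> gC gS x hx; apply: norm_closureK => e e0.
have C0 : 0 < Num.max C 0 + 1 by rewrite ltr_wpDl// le_max lexx orbT.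
have [y Sy xy] := hx (e / (Num.max C 0 + 1)) ltac:(by rewrite divr_gt0).
exists (g y); first exact: gS.
apply: le_lt_trans (gC x y) _; apply: (@le_lt_trans _ _ ((Num.max C 0 + 1) * nrm (x - y))).
  rewrite ler_wpM2r ?nrm_ge0//.
  by apply: (@le_trans _ _ (Num.max C 0)); rewrite ?le_max ?lexx// lerDl.
by rewrite mulrC -ltr_pdivlMr.
Qed.

Lemma norm_closure_span_subspace H K (G : set 'B(H, K)) :
  linear_subspace (norm_closure (lin_span G)).
Proof.
split; first exact/norm_closure_id/lin_span0.
move=> c x y hx hy e e0.
have m0 : 0 < modc c + 1 by rewrite ltr_wpDl ?modc_ge0.
have [s hs xs] := hx (e / 2 / (modc c + 1)) ltac:(by rewrite !divr_gt0).
have [t ht yt] := hy (e / 2) ltac:(by rewrite divr_gt0).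
exists (c *: s + t); first by apply: lin_spanD => //; exact: lin_spanZ.
have -> : c *: x + y - (c *: s + t) = c *: (x - s) + (y - t).
  by rewrite scalerBr opprD addrACA.
apply: le_lt_trans (nrmD _ _) _; rewrite [e]splitr ler_ltD//.
apply: le_trans (nrmZ_le _ _) _.
apply: (@le_trans _ _ ((modc c + 1) * (e / 2 / (modc c + 1)))).
  by apply: ler_pM; rewrite ?modc_ge0 ?nrm_ge0 ?lerDl// ltW.
by rewrite mulrC divfK// gt_eqF.
Qed.

End Spans.

(** The construction yields only the sequence acting on the left. The one acting on the right comes
    from the adjoint TRO [M'], which is closed and separable as well. *)
Lemma separable_sigma_TRO (R : realType) (H K : hilbertType R) (M : set 'B(H, K))
    (x : nat -> 'B(H, K)) :
  is_TRO M -> norm_closure M `<=` M -> (forall k, M (x k)) ->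
  M `<=` norm_closure (lin_span (range x)) -> is_sigma_TRO M.
Proof.
move=> [Ms Mt] Mcl Mx Md; split => //.
  have [u [Mu hu u1]] := separable_TRO_sequence Ms Mt Mcl Mx Md.
  by exists u; split => // y My; apply/nrm_cvg0P; exact: hu.
pose M' : set 'B(K, H) := [set T^adj | T in M].
have M'P T : M' T <-> M T^adj.
  by split=> [[S MS <-]|MT]; [rewrite adjK|exists T^adj => //; rewrite adjK].
have [|||||u [Mu hu u1]] := @separable_TRO_sequence R K H M' _ _ _ (fun k => (x k)^adj).
- split; first by apply/M'P; rewrite adj0; exact: Ms.1.
  by move=> c y z /M'P My /M'P Mz; apply/M'P; rewrite adjD adjZ; exact: Ms.2.
- move=> y z w /M'P My /M'P Mz /M'P Mw; apply/M'P.
  by rewrite !adj_comp op_compA; exact: Mt.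
- move=> y hy; apply/M'P/Mcl => e e0; have [s /M'P Ms' ys] := hy e e0.
  by exists s^adj => //; rewrite -adjB nrm_adj.
- by move=> k; apply/M'P; rewrite adjK.
- move=> y /M'P/Md hy e e0; have [s [n [c [v [hv sE]]]] ys] := hy e e0.
  exists s^adj; last by rewrite -nrm_adj adjB adjK.
  exists n, (fun i => conjc (c i)), (fun i => (v i)^adj); split.
    by move=> i; have [k _ <-] := hv i; exists k.
  by rewrite sE adj_sum; apply: eq_bigr => i _; rewrite adjZ.
exists (fun i => (u i)^adj); split=> [i|y My|n].
- exact/M'P.
- apply/nrm_cvg0P => e e0.
  have [|n0 hn0] := hu y^adj _ e e0; first by apply/M'P; rewrite adjK.
  exists n0 => n hn; rewrite -nrm_adj adjB adj_sum.
  under eq_bigr do rewrite !adj_comp !adjK op_compA.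
  exact: hn0.
- by under eq_bigr do rewrite adjK; exact: u1.
Qed.

(** * From rigged modules to column spaces *)

Section RiggedToColumns.
Context {R : realType}.
Variables (A : operatorAlgebraType R) (Y : operatorSpaceType R) (act : Y -> A -> Y).
Variables H K : hilbertType R.
Variable f : {linear A -> 'B(H, H)}.
Hypothesis hf : complete_isometry f.
Hypothesis fM : forall a b, f (oamul a b) = f a *o f b.
Variable M : set 'B(H, K).
Hypothesis MMA : forall x y a, M x -> M y -> range f (x^adj *o y *o f a).
Variable rho0 : {linear Y -> 'B(H, K)}.
Hypothesis rho0_iso : complete_isometry rho0.
Hypothesis rho0_range : range rho0 = closed_span_comp M (range f).
Hypothesis rho0_act : forall y a, rho0 (act y a) = rho0 y *o f a.
Variable m : nat -> 'B(H, K).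
Hypothesis Mm : forall i, M (m i).
Hypothesis m_cvg : forall x, M x -> forall e : R, 0 < e -> exists n0, forall n,
  (n0 <= n)%N -> nrm (\sum_(i < n) m i *o (m i)^adj *o x - x) < e.
Hypothesis m_le1 : forall n, nrm (\sum_(i < n) m i *o (m i)^adj) <= 1.

Local Notation col := (colf hf).
Local Notation Y0 := (closed_span_comp M (range f)).

Let S n := \sum_(i < n) m i *o (m i)^adj.

Let SE n y : rdot (S n y) y = \sum_(i < n) nr ((m i)^adj y) ^+ 2.
Proof.
rewrite /S bop_sumE rdot_suml; apply: eq_bigr => k _.
by rewrite op_compE radjP nr2.
Qed.

Let S1 n y : rdot (S n y) y <= nr y ^+ 2.
Proof.
apply: le_trans (rdot_le _ _) _; rewrite expr2 ler_wpM2r ?nr_ge0//.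
by have := nrm_boundC y (m_le1 n); rewrite mul1r.
Qed.

Lemma rigged_frame : exists2 V : 'B(K, ell2 H),
  (forall y k, (V y : ell2 H) k = (m k)^adj y) & nrm V <= 1.
Proof.
apply: (@colop_exists R H K (fun k => (m k)^adj)) => // n y.
by rewrite -SE expr1n mul1r.
Qed.

Let V := s2val (cid2 rigged_frame).
Let VE y k : (V y : ell2 H) k = (m k)^adj y. Proof. by rewrite /V; case: cid2. Qed.
Let V1 : nrm V <= 1. Proof. by rewrite /V; case: cid2. Qed.

Let crdV k : crd H k *o V = (m k)^adj.
Proof. by apply: bopP => y; rewrite op_compE crdE VE. Qed.

Let Veps k : V^adj *o eps H k = m k.
Proof. by rewrite -[LHS]adjK adj_comp eps_adj adjK crdV adjK. Qed.

Let Q n := bop1 K - S n.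

Let Q2 n : nrm (Q n) <= 2.
Proof.
apply: le_trans (nrmD _ _) _; rewrite nrmN (_ : 2 = 1 + 1)//; apply: lerD; last exact: m_le1.
by apply/nrmP => // y; rewrite mul1r.
Qed.

(** The hypothesis speaks of elements of [M]; right multiplication by [f a] and uniform boundedness
    carry it to the closed span of [M A]. *)
Let Q_Y0 y : Y0 y -> forall e : R, 0 < e ->
  exists n0, forall n, (n0 <= n)%N -> nrm (Q n *o y) <= e.
Proof.
apply: (null_seq_closure Q2) => _ [z Mz [b [a _ <-] <-]] e e0.
have n0 : 0 < nrm (f a) + 1 by rewrite ltr_wpDl ?nrm_ge0.
have [N hN] := m_cvg Mz (ltac:(by rewrite divr_gt0) : 0 < e / (nrm (f a) + 1)).
exists N => n /hN; rewrite -op_comp_suml -/(S n) nrmBC => h.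
have -> : Q n *o (z *o f a) = (z - S n *o z) *o f a.
  by rewrite op_compA; congr (_ *o _); rewrite /Q op_compBl op_comp1l.
apply: le_trans (nrm_comp _ _) _.
apply: (@le_trans _ _ (e / (nrm (f a) + 1) * (nrm (f a) + 1))).
  by apply: ler_pM; rewrite ?nrm_ge0 ?lerDl// ltW.
by rewrite divfK// gt_eqF.
Qed.

(** The generators of [Y0] are mapped into [f(A)] by [MMA], and [f(A)] is closed by [rep_closed]. *)
Let m_Y0 k y : Y0 y -> exists a, f a = (m k)^adj *o y.
Proof.
move=> hy; apply: (rep_closed hf) => e e0.
have : norm_closure (range f) ((m k)^adj *o y).
  move: y hy; apply: (norm_closure_image (C := nrm (m k)^adj)).
    by move=> x y; rewrite -op_compBr nrm_comp.
  move=> x hx; apply: norm_closure_id; move: x hx.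
  apply: lin_span_ind.
  - by rewrite op_comp0r; exists 0 => //; rewrite linear0.
  - move=> x y [a _ ha] [b _ hb]; exists (a + b) => //.
    by rewrite linearD/= ha hb op_compDr.
  - by move=> c x [a _ ha]; exists (c *: a) => //; rewrite linearZ/= ha op_compZr.
  - move=> _ [z Mz [_ [a _ <-] <-]]; rewrite op_compA.
    exact: MMA.
by move=> /(_ e e0)[_ [x _ <-]]; exists x.
Qed.

(** The issue is that [V y] has uniformly small tails, not merely bounded partial columns. The tail
    beyond [N] at [h] is at most [<Q N z, z>] with [z = y h], and [Q N *o y] tends to [0] in
    norm. *)
Let V_Y0 y : Y0 y -> exists x : Cinfty A, col x = V *o y.
Proof.
move=> hy; have [a ha] := choice (fun k => m_Y0 k hy).
have ap : (a : nat -> A) \in @col_pred R A.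
  apply/(col_predP hf) => e e0.
  have n0 : 0 < nrm y + 1 by rewrite ltr_wpDl ?nrm_ge0.
  (* Multiplied by [nr z <= (nrm y + 1) * nr h], this bound becomes exactly [e ^+ 2 * nr h ^+ 2]. *)
  have [N hN] := Q_Y0 hy (ltac:(by rewrite divr_gt0// exprn_gt0) : 0 < e ^+ 2 / (nrm y + 1)).
  exists N => n h.
  have B0 : 0 <= e ^+ 2 * nr h ^+ 2 by apply: mulr_ge0; exact: sqr_ge0.
  have [nN|Nn] := ltnP n N.
    by rewrite big_pred0// => k; apply/negbTE; rewrite -ltnNge (ltn_trans (ltn_ord k)).
  pose z := y h.
  apply: (@le_trans _ _ (rdot (Q N z) z)).
    rewrite bopBE rdotBl -nr2 SE lerBrDl.
    apply: le_trans (S1 n z); rewrite SE.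
    rewrite [leRHS](bigID (fun k : 'I_n => (N <= k)%N))/= [leRHS]addrC.
    rewrite lerD//; last first.
      by apply: ler_sum => k _; rewrite ha.
    under [X in _ <= X]eq_bigl do rewrite -ltnNge.
    rewrite -(big_mkord (fun k => (k < N)%N) (fun k => nr ((m k)^adj z) ^+ 2)).
    rewrite -(big_mkord xpredT (fun k => nr ((m k)^adj z) ^+ 2)).
    rewrite [leRHS](big_cat_nat (leq0n N) Nn)/= ler_wpDr//.
      by apply: sumr_ge0 => k _; exact: sqr_ge0.
    rewrite [leLHS]big_nat_cond [leRHS]big_nat_cond.
    by rewrite [leRHS](eq_bigl (fun i => (0 <= i < N)%N && true)) // => k; rewrite andbT andbb.
  apply: le_trans (rdot_le _ _) _.
  have h1 : nr (Q N z) <= e ^+ 2 / (nrm y + 1) * nr h by apply: nrm_boundC (hN N (leqnn _)).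
  have h2 : nr z <= (nrm y + 1) * nr h by apply: nrm_boundC; rewrite lerDl.
  apply: le_trans (ler_pM (nr_ge0 _) (nr_ge0 _) h1 h2) _.
  by rewrite le_eqVlt; apply/orP; left; apply/eqP; field; rewrite gt_eqF.
exists (ColumnOf ap); apply: ell2_opP => k.
by rewrite crd_colf /= ha op_compA crdV.
Qed.

(** The defect [D = 1 - V^adj V] satisfies [0 <= D <= Q N] for every [N], hence
    [|D z|^2 <= <D z, z> <= <Q N z, z>], which tends to [0]. *)
Let VVY0 y : Y0 y -> V^adj *o (V *o y) = y.
Proof.
move=> hy; apply: bopP => h; set z := y h.
pose D := bop1 K - V^adj *o V.
have DE w : rdot (D w) w = nr w ^+ 2 - nr (V w) ^+ 2.
  by rewrite bopBE rdotBl op_compE (radjP' V) !nr2.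
have D_sq : nr (D z) ^+ 2 <= 1 * rdot (D z) z.
  apply: pos_sq => [u v|w|w].
  - rewrite !bopBE rdotBl rdotBr !op_compE. rewrite (radjP' V).
    by rewrite [rdot u (V^adj _)]rdotC (radjP' V) [rdot (V v) _]rdotC.
  - rewrite DE subr_ge0 ler_pXn2r ?nnegrE ?nr_ge0//.
    by have := nrm_boundC w V1; rewrite mul1r.
  - by rewrite DE mul1r gerBl sqr_ge0.
suff : D z = 0 by rewrite bopBE => /eqP; rewrite subr_eq0 => /eqP DzE; exact: esym DzE.
apply: nr_small_eq0 => e e0; rewrite -(@ltr_pXn2r _ 2) ?nnegrE ?nr_ge0 ?(ltW e0)//.
apply: le_lt_trans D_sq _; rewrite mul1r.
have c0 : 0 < nr h * nr z + 1 by rewrite ltr_wpDl// mulr_ge0 ?nr_ge0.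
have e2 : 0 < e ^+ 2 / (nr h * nr z + 1) by rewrite divr_gt0// exprn_gt0.
have [N hN] := Q_Y0 hy e2.
apply: (@le_lt_trans _ _ (rdot (Q N z) z)).
  rewrite DE bopBE rdotBl -nr2 lerD2l lerN2 SE.
  apply: le_trans (l2_nr_psum (V z) N).
  by apply: ler_sum => k _; rewrite VE.
apply: le_lt_trans (rdot_le _ _) _.
have h1 : nr (Q N z) <= e ^+ 2 / (nr h * nr z + 1) * nr h.
  exact: nrm_boundC (hN N (leqnn _)).
apply: le_lt_trans (ler_wpM2r (nr_ge0 z) h1) _.
rewrite -[_ * nr h * nr z]mulrA [X in X < _]mulrAC ltr_pdivrMr// ltr_pM2l ?exprn_gt0//.
by rewrite ltrDl.
Qed.

(** [V^adj] sends a finitely supported column to the finite sum of the [m k *o f (x k)]; truncation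
    does the rest. *)
Let V_col (x : Cinfty A) : Y0 (V^adj *o col x).
Proof.
move=> e e0; have e2 : 0 < e / 2 by rewrite divr_gt0.
have [N hN] := trunc_col_cvg hf x e2.
exists (V^adj *o col (trunc_col hf N x)).
  rewrite linear_sum op_comp_sumr; elim/big_ind: _ => [||k _].
  - exact: lin_span0.
  - by move=> ? ? ? ?; exact: lin_spanD.
  apply: lin_span_gen; exists (m k) => //; exists (f (x k)); first by exists (x k).
  by rewrite colf_single op_compA Veps.
rewrite -op_compBr -linearB; apply: le_lt_trans (nrm_comp _ _) _.
apply: (@le_lt_trans _ _ (1 * (e / 2))); last first.
  by rewrite mul1r ltr_pdivrMr// mulr_natr mulr2n ltrDl.
by apply: ler_pM; rewrite ?nrm_ge0 ?nrm_adj// hN.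
Qed.

Let Y0_rho0 y : Y0 (rho0 y). Proof. by rewrite -rho0_range; exists y. Qed.

Lemma rigged_complemented : orthogonally_complemented_in_columns act.
Proof.
have [r hr] := choice (fun y => V_Y0 (Y0_rho0 y)).
have lr : linear r.
  move=> c x y; apply: (@colf_inj _ _ _ _ hf); rewrite linearP/= !hr linearP/=.
  by rewrite op_compDr op_compZr.
have hg (x : Cinfty A) : exists y, rho0 y = V^adj *o col x.
  by have := V_col x; rewrite -rho0_range => -[y _ <-]; exists y.
have [g gE] := choice hg.
have lg : linear g.
  move=> c x y; apply: (rep_inj rho0_iso); rewrite linearP/= !gE linearP/=.
  by rewrite op_compDr op_compZr.
have lP : linear (r \o g) by move=> c x y /=; rewrite lg lr.
pose P := mklinear lP.
have PE x : col (P x) = V *o V^adj *o col x.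
  by rewrite /P mklinearE /= hr gE op_compA.
have V2 : nrm (V *o V^adj) <= 1.
  apply: le_trans (nrm_comp _ _) _; rewrite nrm_adj.
  by rewrite -[leRHS]mul1r ler_pM ?nrm_ge0.
(* A multiplier needs a representation on a single Hilbert space, whereas [col] has values in
   operators [H -> ell2 H]. Composing with the coordinate map [crd H 0] on the right keeps matrix
   norms: it is a contraction with isometric right inverse [eps H 0]. *)
have mult : multiplied_by P (V *o V^adj).
  have ls : linear (fun x : Cinfty A => col x *o crd H 0).
    by move=> c x y; rewrite linearP/= op_compDl op_compZl.
  exists (mklinear ls); split; last first.
    by move=> x; rewrite !mklinearE PE op_compA.
  move=> n x; rewrite -(colf_isometry hf).
  apply/eqP; rewrite eq_le; apply/andP; split.
    apply/op_mxnormP => [|h]; first exact: op_mxnorm_ge0.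
    have := op_mxnorm_bound (map_mx col x) (fun j => crd H 0 (h j)) => hx.
    apply: (@le_trans _ _ (mxnorm (map_mx col x) ^+ 2 * \sum_j nr (crd H 0 (h j)) ^+ 2)).
      apply: le_trans hx; apply: ler_sum => i _.
      rewrite le_eqVlt; apply/orP; left; apply/eqP; congr (nr _ ^+ 2).
      by apply: eq_bigr => j _; rewrite !mxE.
    rewrite ler_wpM2l ?sqr_ge0//; apply: ler_sum => j _.
    rewrite ler_pXn2r ?nnegrE ?nr_ge0//.
    exact: l2_nr_coord.
  apply/op_mxnormP => [|h]; first exact: op_mxnorm_ge0.
  have := op_mxnorm_bound (map_mx (mklinear ls) x) (fun j => eps H 0 (h j)).
  under [X in _ <= _ * X]eq_bigr do rewrite nr_eps.
  apply: le_trans; apply: ler_sum => i _.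
  rewrite le_eqVlt; apply/orP; left; apply/eqP; congr (nr _ ^+ 2).
  by apply: eq_bigr => j _; rewrite !mxE.
exists P; split.
- by exists (ell2 H), (V *o V^adj).
- apply: le_trans V2; apply: ge_inf; last by exists (ell2 H), (V *o V^adj).
  by exists 0 => _ [H' [T [_ ->]]]; exact: nrm_ge0.
- move=> x; apply: (@colf_inj _ _ _ _ hf); rewrite !PE -!op_compA.
  by congr (_ *o _); apply: VVY0; exact: V_col.
- exists (mklinear lr); split.
  (* [V^adj V] fixes every vector in the images of [rho0], so [V] preserves the norms of their
     sums. *)
  + move=> n y; rewrite -(colf_isometry hf) -rho0_iso.
    have sE h i : nr (\sum_j map_mx col (map_mx (mklinear lr) y) i j (h j)) =
        nr (\sum_j map_mx rho0 y i j (h j)).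
      have -> : \sum_j map_mx col (map_mx (mklinear lr) y) i j (h j) =
          V (\sum_j map_mx rho0 y i j (h j)).
        by rewrite bop_sum; apply: eq_bigr => j _; rewrite !mxE mklinearE hr.
      have VV : V^adj (V (\sum_j map_mx rho0 y i j (h j))) = \sum_j map_mx rho0 y i j (h j).
        rewrite !bop_sum; apply: eq_bigr => j _; rewrite mxE.
        by have := congr1 (fun U : 'B(H, K) => U (h j)) (VVY0 (Y0_rho0 (y i j))).
      by apply/eqP; rewrite -(@eqrXn2 _ 2) ?nr_ge0// !nr2 -radjP' VV.
    apply/eqP; rewrite eq_le; apply/andP; split;
      apply/op_mxnormP => [|h]; try exact: op_mxnorm_ge0.
      have := op_mxnorm_bound (map_mx rho0 y) h.
      by under [X in X <= _]eq_bigr do rewrite -sE.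
    have := op_mxnorm_bound (map_mx col (map_mx (mklinear lr) y)) h.
    by under [X in X <= _]eq_bigr do rewrite sE.
  + apply/seteqP; split=> [_ [y _ <-]|_ [x _ <-]].
      exists (r y) => //; apply: (@colf_inj _ _ _ _ hf).
      rewrite PE mklinearE hr -op_compA; congr (_ *o _).
      exact: VVY0 (Y0_rho0 y).
    by exists (g x).
  + move=> y a k; apply: (rep_inj hf).
    by rewrite fM -!(crd_colf hf) !mklinearE !hr rho0_act !op_compA.
Qed.

End RiggedToColumns.

Lemma sigma_Delta_rigged_complemented (R : realType) (A : operatorAlgebraType R)
    (Y : operatorSpaceType R) (act : Y -> A -> Y) :
  sigma_Delta_rigged act -> orthogonally_complemented_in_columns act.
Proof.
move=> [H [K [f [M [rho [[hf fM] [sM MMA] rho_iso rho_range rho_act]]]]]].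
have [_ _ [m [Mm mcvg m1]] _] := sM.
apply: (@rigged_complemented R A Y act H K f hf fM M MMA rho rho_iso rho_range
  rho_act m Mm _ m1) => x Mx.
by apply/nrm_cvg0P; exact: mcvg.
Qed.

(** * Contractive idempotent multipliers of the column space *)

Section ApproximateIdentity.
Context {R : realType}.
Variable A : operatorAlgebraType R.
Hypothesis hA : approximately_unital A.

Lemma approx_unit_seq (s : seq A) (d : R) : 0 < d -> exists e : A,
  nr e <= 1 /\ forall a, a \in s -> nr (oamul e a - a) < d /\ nr (oamul a e - a) < d.
Proof.
move=> d0; have [I [F [e [FF e1 el er]]]] := hA.
have dC : 0 < d%:C by rewrite ltcR.
have : \forall i \near F, forall a, a \in s ->
    nr (oamul (e i) a - a) < d /\ nr (oamul a (e i) - a) < d.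
  elim: s => [|b s IH]; first by apply: nearW.
  have /cvgrPdist_lt/(_ d%:C dC) h1 := el b.
  have /cvgrPdist_lt/(_ d%:C dC) h2 := er b.
  move: IH; apply: filterS2 (filterI h1 h2) => i [+ +] IH.
  rewrite !nrE !ltcR => p1 p2 a; rewrite inE => /orP[/eqP ->|]; last exact: IH.
  by split; rewrite nrBC.
move=> /filter_ex[i hi]; exists (e i); split=> //.
by rewrite -lecR -nrE.
Qed.

End ApproximateIdentity.

(** [(1 + d)^2 - 1 = 2 d + d^2 <= 3 d], which explains the divisor [3]. *)
Lemma sqr_near1 (R : realType) (d q : R) : 0 < d -> d <= 1 -> d <= q / 3 ->
  (1 + d) ^+ 2 - 1 <= q.
Proof.
move=> d0 d1 d2; have dd : d * d <= d by rewrite ger_pMr.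
by rewrite expr2; lra.
Qed.

Lemma sqr_sum_almost (R : realType) (a b r e : R) : 0 <= e -> r <= e * b * a ->
  a ^+ 2 + 2 * r + b ^+ 2 <= (1 + e) * (a ^+ 2 + b ^+ 2).
Proof.
move=> e0 h.
have : e * ((a - b) ^+ 2) >= 0 by rewrite mulr_ge0// sqr_ge0.
by rewrite !expr2 in h *; nra.
Qed.

(** The terms in [t^2] cancel, and the linear term [2 t U^2] beats [C^2] once [t U^2 = C^2 + 1]. *)
Lemma large_contra (R : realType) (U C : R) : 0 < U ->
  (forall t : R, 0 < t -> ((1 + t) * U) ^+ 2 <= t ^+ 2 * U ^+ 2 + C ^+ 2) -> False.
Proof.
move=> Up key.
have t0 : 0 < (C ^+ 2 + 1) / U ^+ 2 by rewrite divr_gt0 ?exprn_gt0// ltr_wpDl ?sqr_ge0.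
have := key _ t0; set t := _ / _ in t0 *.
have tU : t * U ^+ 2 = C ^+ 2 + 1 by rewrite /t divfK// gt_eqF ?exprn_gt0.
have -> : ((1 + t) * U) ^+ 2 = U ^+ 2 + 2 * (t * U ^+ 2) + t ^+ 2 * U ^+ 2 by ring.
rewrite tU => h; move: h; apply/negP; rewrite -ltNge.
by have := sqr_ge0 U; have := sqr_ge0 C; lra.
Qed.

Section Multiplier.
Context {R : realType}.
Variable A : operatorAlgebraType R.
Hypothesis hA : approximately_unital A.
Variable H : hilbertType R.
Variable f : {linear A -> 'B(H, H)}.
Hypothesis hf : complete_isometry f.
Hypothesis fM : forall a b, f (oamul a b) = f a *o f b.
Variable P : {linear Cinfty A -> Cinfty A}.
Hypothesis Pmult : left_multiplier P.
Hypothesis P1 : multiplier_norm P <= 1.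
Hypothesis PP : forall x, P (P x) = P x.
Hypothesis Pmod : forall x a, P (rmulC hf fM (P x) a) = rmulC hf fM (P x) a.

Local Notation col := (colf hf).
Local Notation "x ** a" := (rmulC hf fM x a) (at level 40).

Let colD x y : col (x + y) = col x + col y. Proof. exact: linearD. Qed.
Let colB x y : col (x - y) = col x - col y. Proof. exact: linearB. Qed.
Let colZ c x : col (c *: x) = c *: col x. Proof. exact: linearZ. Qed.

(** The norm of a multiplier is an infimum over representations, so a slack [d] remains and has to
    be removed in each consequence separately. *)
Lemma multiplier_near (d : R) : 0 < d ->
  exists (H0 : hilbertType R) (S : 'B(H0, H0)), multiplied_by P S /\ nrm S < 1 + d.
Proof.
move=> d0.
set D := [set r | exists (H : hilbertType R) (S : 'B(H, H)), multiplied_by P S /\ r = nrm S].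
have hD : has_inf D.
  split; last by exists 0 => _ [H' [T [_ ->]]]; exact: nrm_ge0.
  by have [H0 [S hS]] := Pmult; exists (nrm S), H0, S.
have [_ [H0 [S [hS ->]]] hlt] := inf_adherent d0 hD.
by exists H0, S; split=> //; apply: lt_le_trans hlt _; rewrite lerD2r.
Qed.

(** In a representation where [P] is multiplication by [S], every matrix amplification has norm at
    most [nrm S]. The inequality involves matrix norms only, so the slack can go to [0] although the
    representation changes with it. *)
Lemma multiplier_contractive n (x : 'M[Cinfty A]_n) :
  mxnorm (map_mx P x) <= mxnorm x.
Proof.
have x0 : 0 <= mxnorm x by rewrite -(colf_isometry hf) op_mxnorm_ge0.
apply/ler_addgt0Pr => e e0.
have d0 : 0 < e / (mxnorm x + 1) by rewrite divr_gt0// ltr_wpDl.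
have [H0 [S [[s [s_iso sP]] S1]]] := multiplier_near d0.
rewrite -s_iso; apply: (@le_trans _ _ ((1 + e / (mxnorm x + 1)) * mxnorm x)).
  apply/op_mxnormP => [|h]; first by rewrite mulr_ge0// addr_ge0// ltW.
  have := op_mxnorm_bound (map_mx s x) h; rewrite s_iso => hx.
  rewrite exprMn -mulrA.
  apply: le_trans (ler_wpM2l (sqr_ge0 _) hx); rewrite mulr_sumr.
  apply: ler_sum => i _; rewrite -exprMn.
  rewrite ler_pXn2r ?nnegrE ?nr_ge0 ?mulr_ge0 ?nr_ge0 ?addr_ge0 ?(ltW d0)//.
  have -> : \sum_j map_mx s (map_mx P x) i j (h j) = S (\sum_j map_mx s x i j (h j)).
    by rewrite bop_sum; apply: eq_bigr => j _; rewrite !mxE sP.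
  by apply: nrm_boundC; exact: ltW.
rewrite mulrDl mul1r lerD2l -mulrA ger_pMr// ler_pdivrMl ?mulr1 ?lerDl// ltr_wpDl//.
Qed.

Lemma multiplier_nrm x : nrm (col (P x)) <= nrm (col x).
Proof.
rewrite !colf_nrm /nrm; apply: le_trans (multiplier_contractive _).
by rewrite le_eqVlt; apply/orP; left; apply/eqP; congr mxnorm; apply/matrixP => i j; rewrite !mxE.
Qed.

(* If [S v = v], [S z = 0] and [S] is almost contractive, then [S^* v] is close
   to [v], whence [<v, z> = <v - S^* v, z>] is small. *)
Lemma almost_orthogonal (H0 : hilbertType R) (S : 'B(H0, H0)) (d e : R) v z :
  0 <= d -> 0 <= e -> (1 + d) ^+ 2 - 1 <= e ^+ 2 -> nrm S <= 1 + d ->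
  S v = v -> S z = 0 -> `|rdot v z| <= e * nr v * nr z.
Proof.
move=> d0 e0 de S1 Sv Sz.
have -> : rdot v z = rdot (v - S^adj v) z by rewrite rdotBl radjP' Sz rdot0r subr0.
apply: le_trans (cauchy_schwarz _ _) _; rewrite ler_wpM2r ?nr_ge0//.
rewrite -(@ler_pXn2r _ 2) ?nnegrE ?nr_ge0 ?mulr_ge0 ?nr_ge0//.
rewrite nrB2 -radjP Sv -nr2 exprMn.
have h : nr (S^adj v) ^+ 2 <= (1 + d) ^+ 2 * nr v ^+ 2.
  rewrite -exprMn ler_pXn2r ?nnegrE ?nr_ge0 ?mulr_ge0 ?nr_ge0 ?addr_ge0//.
  by apply: nrm_boundC; rewrite nrm_adj.
have := ler_wpM2r (sqr_ge0 (nr v)) de; move: h.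
by set a := nr v ^+ 2; set b := nr _ ^+ 2; set c := _ ^+ 2; lra.
Qed.

(** In a representation where [P] is multiplication by an almost contractive [S], the images of [x],
    killed by [S], and of [w], fixed by [S], are almost orthogonal, so Pythagoras holds up to a
    factor. Stated as a bound on the norm of the row [(x, w)], this transfers to [col], where the
    loss disappears. *)
Lemma multiplier_row x w (mu : R) h k : P x = 0 -> P w = w ->
  nrm (col x) <= mu -> nrm (col w) <= mu ->
  nr (col x h + col w k) ^+ 2 <= mu ^+ 2 * (nr h ^+ 2 + nr k ^+ 2).
Proof.
move=> Px Pw xmu wmu; have mu0 : 0 <= mu := le_trans (nrm_ge0 _) xmu.
(* The row is padded by a zero row, as [mxnorm] applies to square matrices. *)
pose B : 'M[Cinfty A]_2 := \matrix_(i, j) if i == 0 then (if j == 0 then x else w) else 0.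
have sumE (H1 K1 : hilbertType R) (s : {linear Cinfty A -> 'B(H1, K1)}) (g : 'I_2 -> H1) :
    \sum_(i < 2) nr (\sum_(j < 2) map_mx s B i j (g j)) ^+ 2 =
    nr (s x (g 0) + s w (g 1)) ^+ 2.
  rewrite !(big_ord_recl, big_ord0) !mxE /= !linear0 !bop0E !addr0 nr0 expr0n/= addr0.
  by congr (nr (_ + s w (g _)) ^+ 2); apply: val_inj.
suff : mxnorm B <= mu.
  rewrite -(colf_isometry hf) => /(op_mxnormP _ mu0).1/(_ (fun j => if j == 0 then h else k)).
  by rewrite sumE !(big_ord_recl, big_ord0) /= addr0.
apply/ler_addgt0Pr => e' e0'.
have [e e0 emu] : exists2 e : R, 0 < e & (1 + e) * mu <= mu + e'.
  exists (e' / (mu + 1)); first by rewrite divr_gt0// ltr_wpDl.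
  rewrite mulrDl mul1r lerD2l mulrAC ler_pdivrMr ?ltr_wpDl//.
  by rewrite ler_wpM2l ?(ltW e0')// lerDl.
have [d [d0 d1 d2]] : exists d : R, [/\ 0 < d, d <= 1 & d <= e ^+ 2 / 3].
  exists (Num.min 1 (e ^+ 2 / 3)); rewrite lt_min ltr01 divr_gt0 ?exprn_gt0//.
  by rewrite !ge_min !lexx orbT.
have [H0 [S [[s [s_iso sP]] S1]]] := multiplier_near d0.
have nrs y : nrm (s y) = nrm (col y).
  by rewrite colf_nrm /nrm -s_iso; congr mxnorm; apply/matrixP => i j; rewrite !mxE.
rewrite -s_iso; apply: (@le_trans _ _ ((1 + e) * mu)); last exact: emu.
apply/op_mxnormP => [|g]; first by rewrite mulr_ge0// addr_ge0// ltW.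
rewrite sumE !(big_ord_recl, big_ord0) addr0.
have -> : lift ord0 (ord0 : 'I_1) = 1 :> 'I_2 by apply: val_inj.
set z := s x _; set v := s w _.
have Sv : S v = v by rewrite /v -[S (s w _)]/((S *o s w) _) -sP Pw.
have Sz : S z = 0 by rewrite /z -[S (s x _)]/((S *o s x) _) -sP Px linear0.
have hz : nr z ^+ 2 <= mu ^+ 2 * nr (g 0) ^+ 2.
  rewrite -exprMn ler_pXn2r ?nnegrE ?nr_ge0 ?mulr_ge0 ?nr_ge0//.
  by apply: nrm_boundC; rewrite nrs.
have hv : nr v ^+ 2 <= mu ^+ 2 * nr (g 1) ^+ 2.
  rewrite -exprMn ler_pXn2r ?nnegrE ?nr_ge0 ?mulr_ge0 ?nr_ge0//.
  by apply: nrm_boundC; rewrite nrs.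
have orth : `|rdot v z| <= e * nr v * nr z.
  apply: (almost_orthogonal (ltW d0) (ltW e0) _ (ltW S1) Sv Sz).
  exact: sqr_near1.
have orth' : rdot z v <= e * nr v * nr z by rewrite rdotC; exact: le_trans (ler_norm _) orth.
rewrite nrD2 exprMn.
apply: (le_trans (sqr_sum_almost (ltW e0) orth')).
apply: (@le_trans _ _ ((1 + e) ^+ 2 * (nr z ^+ 2 + nr v ^+ 2))).
  rewrite ler_wpM2r ?addr_ge0 ?sqr_ge0// expr2 ler_peMl// ?addr_ge0 ?(ltW e0)//.
  by rewrite lerDl ltW.
rewrite -[leRHS]mulrA ler_wpM2l ?sqr_ge0// mulrDr.
exact: lerD.
Qed.

Lemma col_approx_right u (d : R) : 0 < d -> exists e : A,
  nr e <= 1 /\ nrm (col (u ** e) - col u) <= d.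
Proof.
move=> d0; have d3 : 0 < d / 3 by rewrite divr_gt0.
have [N /(_ N (leqnn _)) hN] := trunc_col_cvg hf u d3.
have dN : 0 < d / 3 / N.+1%:R by rewrite divr_gt0.
have [e [e1 he]] := approx_unit_seq hA [seq (u k) | k <- iota 0 N] dN.
exists e; split=> //.
have fe : nrm (f e) <= 1 by rewrite -(nr_rep hf).
pose u' := trunc_col hf N u.
have -> : col (u ** e) - col u = col (u - u') *o f e + (col u' *o f e - col u') + (col u' - col u).
  rewrite colf_rmulC linearB/= op_compBl.
  by rewrite !addrA !subrK.
apply: le_trans (nrmD _ _) _; rewrite [d](_ : _ = d / 3 + d / 3 + d / 3); last by field.
apply: lerD; last by rewrite -linearB/= -opprB linearN/= nrmN.
apply: le_trans (nrmD _ _) _; apply: lerD.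
  apply: le_trans (nrm_comp _ _) _; rewrite -[leRHS]mulr1.
  by apply: ler_pM; rewrite ?nrm_ge0.
rewrite /u' /trunc_col linear_sum op_comp_suml -sumrB.
apply: le_trans (nrm_sum _ _ _) _.
apply: (@le_trans _ _ (\sum_(k < N) d / 3 / N.+1%:R)).
  apply: ler_sum => k _; rewrite colf_single -op_compA -fM -op_compBr -linearB/=.
  apply: le_trans (nrm_comp _ _) _.
  have [|_ hk] := he (u k); first by apply/mapP; exists (k : nat) => //; rewrite mem_iota add0n /=.
  rewrite -[leRHS]mul1r; apply: ler_pM; rewrite ?nrm_ge0//; last by rewrite -(nr_rep hf) ltW.
  by apply/nrmP => // h; rewrite nr_eps mul1r.
rewrite sumr_const card_ord -[leLHS]mulr_natl mulrCA ger_pMr// ler_pdivrMr// mul1r.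
by rewrite ler_nat.
Qed.

(* Writing [u = P (x a)], compare the norms of [x a + t u e] and of its image
   [u + t u e] for large [t]. *)
Lemma multiplier_ker_module x a : P x = 0 -> P (x ** a) = 0.
Proof.
move=> Px.
have [u uE] : {u | u = P (x ** a)} by eexists.
have [U UE] : {U | nrm (col u) = U} by eexists.
have U_ge0 : 0 <= U by rewrite -UE nrm_ge0.
rewrite -uE; have [U0|U0] := eqVneq U 0.
  apply: (@colf_inj _ _ _ _ hf); rewrite linear0; apply: nrm0_eq0.
  by rewrite UE U0.
have Up : 0 < U by rewrite lt_def U0 U_ge0.
have [X XE] : {X | nrm (col x) = X} by eexists.
have X0 : 0 <= X by rewrite -XE nrm_ge0.
have X1 : 0 < X + 1 by rewrite ltr_wpDl.
have [C CE] : {C | nrm (f a) * (X + 1) = C} by eexists.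
have C0 : 0 <= C by rewrite -CE mulr_ge0 ?nrm_ge0// ltW.
have Pu : P u = u by rewrite uE PP.
have key (t : R) : 0 < t -> ((1 + t) * U) ^+ 2 <= t ^+ 2 * U ^+ 2 + C ^+ 2.
  move=> t0.
  have D0 : 0 <= t ^+ 2 * U ^+ 2 + C ^+ 2 by apply: addr_ge0; [apply: mulr_ge0|]; exact: sqr_ge0.
  rewrite -[leRHS]sqr_sqrtr//.
  rewrite ler_pXn2r ?nnegrE ?sqrtr_ge0 ?mulr_ge0 ?addr_ge0 ?(ltW t0) ?(ltW Up)//.
  apply/ler_addgt0Pr => e e0.
  have et : 0 < e / t by rewrite divr_gt0.
  have [b [b1 hb]] := col_approx_right u et.
  have fb : nrm (f b) <= 1 by rewrite -(nr_rep hf).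
  have h1 : nrm (col (P (x ** a + t%:C *: (u ** b)))) <= Num.sqrt (t ^+ 2 * U ^+ 2 + C ^+ 2).
    apply: le_trans (multiplier_nrm _) _.
    have tU0 : 0 < t * U by rewrite mulr_gt0.
    (* [multiplier_row] wants one bound for both entries. Moving the factor [l] from [f a h] to [x]
       brings both below [t * U]; the first summand then contributes at most [C ^+ 2], independently
       of [t]. *)
    have [l lE] : {l | t * U / (X + 1) = l} by eexists.
    have l0 : 0 < l by rewrite -lE divr_gt0.
    apply/nrmP => [|h]; first exact: sqrtr_ge0.
    have -> : col (x ** a + t%:C *: (u ** b)) h =
        col (l%:C *: x) (l^-1%:C *: f a h) + col (t%:C *: u) (f b h).
      rewrite colD bopDE !colZ !colf_rmulC !bopZE bopZ scalerA -rmorphM/=.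
      by rewrite mulfV ?gt_eqF// scale1r.
    rewrite -(@ler_pXn2r _ 2) ?nnegrE ?nr_ge0 ?mulr_ge0 ?nr_ge0 ?sqrtr_ge0//.
    have := @multiplier_row (l%:C *: x) (t%:C *: u) (t * U) (l^-1%:C *: f a h) (f b h).
    move=> /(_ _ _ _ _)/le_trans; apply.
    - by rewrite linearZ/= Px scaler0.
    - by rewrite linearZ/= Pu.
    - rewrite colZ; apply: le_trans (nrmZ_le _ _) _; rewrite modcR ?(ltW l0)//.
      rewrite XE -lE mulrAC ler_pdivrMr// ler_wpM2l ?(ltW tU0)//.
      by rewrite lerDl.
    - by rewrite colZ; apply: le_trans (nrmZ_le _ _) _; rewrite modcR ?(ltW t0)// UE.
    rewrite [leRHS]exprMn sqr_sqrtr// nrZR ?invr_ge0 ?(ltW l0)//.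
    have ha : (nr (f a h)) ^+ 2 <= nrm (f a) ^+ 2 * nr h ^+ 2.
      by rewrite -exprMn ler_pXn2r ?nnegrE ?nr_ge0 ?mulr_ge0 ?nr_ge0 ?nrm_ge0// nrm_bound.
    have hb' : (nr (f b h)) ^+ 2 <= nr h ^+ 2.
      rewrite ler_pXn2r ?nnegrE ?nr_ge0//.
      by have := nrm_boundC h fb; rewrite mul1r.
    have tU : (t * U) * l^-1 = X + 1.
      by rewrite -lE invf_div mulrC divfK// gt_eqF.
    have -> : (t * U) ^+ 2 * ((l^-1 * nr (f a h)) ^+ 2 + nr (f b h) ^+ 2) =
        (X + 1) ^+ 2 * nr (f a h) ^+ 2 + (t * U) ^+ 2 * nr (f b h) ^+ 2.
      by rewrite -tU mulrDr; ring.
    have p1 := ler_wpM2l (sqr_ge0 (X + 1)) ha.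
    have p2 := ler_wpM2l (sqr_ge0 (t * U)) hb'.
    apply: le_trans (lerD p1 p2) _.
    by rewrite le_eqVlt; apply/orP; left; apply/eqP; rewrite -CE; ring.
  have Pe : P (x ** a + t%:C *: (u ** b)) = u + t%:C *: (u ** b).
    have Pub : P (u ** b) = u ** b by rewrite -{1}Pu Pmod Pu.
    by rewrite linearD linearZ/= -uE Pub.
  rewrite Pe in h1.
  have -> : (1 + t) * U = nrm ((1 + t)%:C *: col u).
    rewrite -UE.
    have t1 : 0 < 1 + t by rewrite addr_gt0.
    apply/eqP; rewrite eq_le; apply/andP; split; last first.
      by apply: le_trans (nrmZ_le _ _) _; rewrite modcR ?(ltW t1).
    have := nrmZ_le ((1 + t)^-1)%:C ((1 + t)%:C *: col u).
    rewrite scalerA -rmorphM/= mulVf ?gt_eqF// scale1r modcR ?invr_ge0 ?(ltW t1)//.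
    by rewrite ler_pdivlMl.
  have -> : (1 + t)%:C *: col u =
      col (u + t%:C *: (u ** b)) - t%:C *: (col (u ** b) - col u).
    rewrite colD colZ rmorphD/= scalerDl scale1r scalerBr opprB.
    by rewrite [t%:C *: col u - _]addrC addrA addrK.
  apply: le_trans (nrmD _ _) _; rewrite nrmN addrC [leRHS]addrC; apply: lerD => //.
  apply: le_trans (nrmZ_le _ _) _; rewrite modcR ?(ltW t0)//.
  by rewrite mulrC -ler_pdivlMr.
by have := large_contra Up key.
Qed.
Lemma rmulCDl x y a : (x + y) ** a = x ** a + y ** a.
Proof. by apply: (@colf_inj _ _ _ _ hf); rewrite colD !colf_rmulC colD op_compDl. Qed.

Lemma multiplier_module x a : P (x ** a) = P x ** a.
Proof.
have {1}-> : x = (x - P x) + P x by rewrite subrK.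
rewrite rmulCDl linearD Pmod multiplier_ker_module ?add0r//.
by rewrite linearB/= PP subrr.
Qed.

Lemma nr_eps_sum N (w : 'I_N -> H) :
  nr (\sum_(j < N) eps H j (w j)) ^+ 2 = \sum_(j < N) nr (w j) ^+ 2.
Proof.
rewrite nr2 rdot_suml; apply: eq_bigr => i _.
rewrite -[eps H i]adjK eps_adj radjP' bop_sum (bigD1 i)//= big1 ?addr0.
  by rewrite eqxx nr2.
by move=> j /eqP ji; case: eqP => // e; case: ji; exact/esym/val_inj.
Qed.

(** The row of the columns [single hf j e] is a contraction because their ranges are orthogonal;
    complete contractivity of [P] passes this to the row of images, for every length [N]. *)
Lemma multiplier_eps N (e : A) (g : 'I_N -> H) : nr e <= 1 ->
  nr (\sum_(j < N) col (P (single hf j e)) (g j)) ^+ 2 <= \sum_(j < N) nr (g j) ^+ 2.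
Proof.
case: N g => [|N] g e1; first by rewrite !big_ord0 nr0 expr0n.
have fe : nrm (f e) <= 1 by rewrite -(nr_rep hf).
pose B : 'M[Cinfty A]_N.+1 := \matrix_(i, j) if i == 0 then single hf j e else 0.
have hB : mxnorm (map_mx col B) <= 1.
  apply/op_mxnormP => // h; rewrite (bigD1 0)//= [X in _ + X]big1 ?addr0; last first.
    move=> i i0; rewrite big1 ?nr0 ?expr0n// => j _.
    by rewrite !mxE (negbTE i0) linear0.
  rewrite expr1n mul1r.
  have -> : \sum_j map_mx col B 0 j (h j) = \sum_(j < N.+1) eps H j (f e (h j)).
    by apply: eq_bigr => j _; rewrite !mxE eqxx colf_single.
  rewrite nr_eps_sum; apply: ler_sum => j _; rewrite ler_pXn2r ?nnegrE ?nr_ge0//.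
  by have := nrm_boundC (h j) fe; rewrite mul1r.
have := multiplier_contractive B; rewrite -!(colf_isometry hf) => /le_trans/(_ hB).
move=> /(op_mxnormP _ ler01).1/(_ g); rewrite expr1n mul1r; apply: le_trans.
apply: le_trans (ler_sum_term 0 (fun i => sqr_ge0 _)).
rewrite le_eqVlt; apply/orP; left; apply/eqP; congr (nr _ ^+ 2).
by apply: eq_bigr => j _; rewrite !mxE eqxx.
Qed.

(** Multiplying by [e] on the left exposes [x j] as a right factor: the summands are
    [rmulC hf fM (single hf j e) (x j)], on which the module property determines [P]. *)
Definition left_approx (N : nat) (e : A) (x : Cinfty A) : Cinfty A := \sum_(j < N) single hf j (oamul e (x j)).

Lemma left_approx_exists x y (d : R) : 0 < d -> exists N e, [/\ nr e <= 1,
  nrm (col (left_approx N e x - x)) <= d & nrm (col (left_approx N e y - y)) <= d].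
Proof.
move=> d0; have d2 : 0 < d / 2 by rewrite divr_gt0.
have [N1 hN1] := trunc_col_cvg hf x d2.
have [N2 hN2] := trunc_col_cvg hf y d2.
pose N := maxn N1 N2.
have dN : 0 < d / 2 / N.+1%:R by rewrite divr_gt0.
have [e [e1 he]] := approx_unit_seq hA
  ([seq (x k) | k <- iota 0 N] ++ [seq (y k) | k <- iota 0 N]) dN.
exists N, e.
have gen (z : Cinfty A) : (forall k, (k < N)%N -> nr (oamul e (z k) - z k) < d / 2 / N.+1%:R) ->
    nrm (col (z - trunc_col hf N z)) <= d / 2 ->
    nrm (col (left_approx N e z - z)) <= d.
  move=> h1 h2.
  have -> : left_approx N e z - z =
      (left_approx N e z - trunc_col hf N z) - (z - trunc_col hf N z).
    by rewrite opprB addrA subrK.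
  rewrite colB; apply: le_trans (nrmD _ _) _; rewrite nrmN [leRHS]splitr.
  apply: lerD; last exact: h2.
  rewrite /left_approx /trunc_col -sumrB linear_sum.
  apply: le_trans (nrm_sum _ _ _) _.
  apply: (@le_trans _ _ (\sum_(k < N) d / 2 / N.+1%:R)).
    apply: ler_sum => k _; rewrite colB !colf_single -op_compBr -linearB/=.
    apply: le_trans (nrm_comp _ _) _.
    rewrite -[leRHS]mul1r; apply: ler_pM; rewrite ?nrm_ge0//.
      by apply/nrmP => // h; rewrite nr_eps mul1r.
    by rewrite -(nr_rep hf) ltW// h1.
  rewrite sumr_const card_ord -[leLHS]mulr_natl mulrCA ger_pMr// ler_pdivrMr// mul1r.
  by rewrite ler_nat.
split=> //; apply: gen => //.
- move=> k kN; have [|] := he (x k); last by [].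
  by rewrite mem_cat; apply/orP; left; apply/mapP; exists k => //; rewrite mem_iota add0n.
- by apply: hN1; rewrite leq_maxl.
- move=> k kN; have [|] := he (y k); last by [].
  by rewrite mem_cat; apply/orP; right; apply/mapP; exists k => //; rewrite mem_iota add0n.
- by apply: hN2; rewrite leq_maxr.
Qed.

Lemma multiplier_left_approx N e x h :
  col (P (left_approx N e x)) h = \sum_(j < N) col (P (single hf j e)) (f (x j) h).
Proof.
rewrite /left_approx !linear_sum bop_sumE; apply: eq_bigr => j _.
have -> : single hf j (oamul e (x j)) = single hf j e ** x j.
  apply: (@colf_inj _ _ _ _ hf).
  by rewrite colf_rmulC !colf_single fM op_compA.
by rewrite multiplier_module colf_rmulC op_compE.
Qed.

(** Up to a small error, the left side is the contractive row of the [P (single hf j e)] applied to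
    the vector with entries [f (x j) h + f (y j) k], that is, to the first coordinates of the vector
    on the right. *)
Lemma multiplier_vector_contractive x y h k :
  nr (col (P x) h + col (P y) k) <= nr (col x h + col y k).
Proof.
apply/ler_addgt0Pr => e' e0'.
have c0 : 0 < nr h + nr k + 1 by rewrite ltr_wpDl// addr_ge0 ?nr_ge0.
have d0 : 0 < e' / (nr h + nr k + 1) by rewrite divr_gt0.
have [N [e [e1 hx hy]]] := left_approx_exists x y d0.
set d := e' / _ in d0 hx hy.
have hP z (l : H) : nrm (col (left_approx N e z - z)) <= d ->
    nr (col (P z) l - col (P (left_approx N e z)) l) <= d * nr l.
  move=> hz; rewrite -bopBE -colB -linearB; apply: nrm_boundC.
  by apply: le_trans (multiplier_nrm _) _; rewrite -opprB linearN nrmN.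
have -> : col (P x) h + col (P y) k =
    (col (P (left_approx N e x)) h + col (P (left_approx N e y)) k) +
    ((col (P x) h - col (P (left_approx N e x)) h) +
     (col (P y) k - col (P (left_approx N e y)) k)).
  by rewrite [RHS]addrACA; congr (_ + _); rewrite addrC subrK.
apply: le_trans (nrD _ _) _; apply: lerD; last first.
  apply: le_trans (nrD _ _) _; apply: (@le_trans _ _ (d * nr h + d * nr k)).
    by apply: lerD; apply: hP.
  rewrite -mulrDr; apply: (@le_trans _ _ (d * (nr h + nr k + 1))).
    by rewrite ler_wpM2l ?(ltW d0)// lerDl.
  by rewrite /d divfK// gt_eqF.
rewrite -(@ler_pXn2r _ 2) ?nnegrE ?nr_ge0//.
rewrite !multiplier_left_approx.
have -> : \sum_(j < N) col (P (single hf j e)) (f (x j) h) +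
    \sum_(j < N) col (P (single hf j e)) (f (y j) k) =
    \sum_(j < N) col (P (single hf j e)) (f (x j) h + f (y j) k).
  by rewrite -big_split; apply: eq_bigr => j _; rewrite bopD.
apply: le_trans (multiplier_eps _ e1) _.
apply: le_trans (l2_nr_psum (col x h + col y k : ell2 H) N).
apply: ler_sum => j _; rewrite le_eqVlt; apply/orP; left; apply/eqP.
by congr (nr _ ^+ 2); rewrite (l2DE (col x h)) !colfE.
Qed.

(** Contractivity applied to [u + t v] gives [|u| <= |u + t v|] for all real [t], since [v] is
    killed; the term linear in [t] must vanish. *)
Lemma multiplier_orth x y h k : rdot (col (P x) h) (col (y - P y) k) = 0.
Proof.
set u := col (P x) h; set v := col _ k.
have : rdot u v ^+ 2 <= 0 * rdot v v.
  apply: psd_cauchy => [|t]; first exact: rdotxx_ge0.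
  have := multiplier_vector_contractive (P x) (y - P y) h (t%:C *: k).
  rewrite PP linearB/= PP subrr linear0 bop0E addr0 -/u bopZ -/v => h1.
  have h2 : nr u ^+ 2 <= nr (u + t%:C *: v) ^+ 2 by rewrite ler_pXn2r ?nnegrE ?nr_ge0.
  rewrite nrD2 [nr (t%:C *: v) ^+ 2]nr2 !(rdotZl, rdotZr) in h2.
  rewrite -addrA -subr_ge0 in h2.
  have -> : 0 + 2 * t * rdot u v + t ^+ 2 * rdot v v =
    nr u ^+ 2 + (2 * (t * rdot u v) + t * (t * rdot v v)) - nr u ^+ 2 by ring.
  exact: h2.
rewrite mul0r => h0; apply/eqP; rewrite -(@sqrf_eq0 R) eq_le h0.
exact: sqr_ge0.
Qed.

End Multiplier.

(** * From column spaces to rigged modules *)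

Lemma projection_exists (R : realType) (H : hilbertType R) (C : set H) :
  C 0 -> (forall (c : R[i]) x y, C x -> C y -> C (c *: x + y)) -> approx_closed C ->
  exists p : 'B(H, H), [/\ selfadj p, p *o p = p &
    forall x y, C y -> (forall c, C c -> rdot (x - y) c = 0) -> p x = y].
Proof.
move=> C0 CD Ccl.
have h x : exists y, C y /\ forall c, C c -> hdot H (x - y) c = 0.
  by have [y Cy hy] := proj_exists C0 CD Ccl x; exists y.
have [p hp] := choice h.
have pC x : C (p x) by case: (hp x).
have port x c : C c -> rdot (x - p x) c = 0.
  by move=> Cc; case: (hp x) => _ hx; apply: hdot0_rdot; exact: hx.
have uniq x y : C y -> (forall c, C c -> rdot (x - y) c = 0) -> p x = y.
  move=> Cy hy; apply/eqP; rewrite -subr_eq0; apply/eqP.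
  have Cd : C (p x - y).
    by rewrite addrC -scaleN1r; exact: CD.
  apply: nr0_eq0; apply/eqP; rewrite -(@sqrf_eq0 R) nr2; apply/eqP.
  have E : p x - y = (x - y) - (x - p x) by rewrite opprB [RHS]addrC addrA subrK.
  by rewrite {1}E rdotBl hy// port// subrr.
have lp : linear p.
  move=> c x y; apply: uniq => [|d Cd]; first exact: CD.
  have -> : c *: x + y - (c *: p x + p y) = c *: (x - p x) + (y - p y).
    by rewrite scalerBr opprD addrACA.
  rewrite rdotDl port// addr0; apply: hdot0_rdot; rewrite hdotZl.
  by case: (hp x) => _ ->; rewrite ?mulr0.
have bp x : nr (p x) <= 1 * nr x.
  rewrite mul1r -(@ler_pXn2r _ 2) ?nnegrE ?nr_ge0//.
  have {2}-> : x = p x + (x - p x) by rewrite addrC subrK.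
  by rewrite nrD2 rdotC port// mulr0 addr0 lerDl sqr_ge0.
exists (mkbop lp bp); split.
- move=> x y /=.
  have h1 : rdot (p x) (y - p y) = 0 by rewrite rdotC port.
  have h2 : rdot (x - p x) (p y) = 0 by rewrite port.
  by move: h1 h2; rewrite rdotBl rdotBr => /eqP; rewrite subr_eq0 => /eqP -> /eqP; rewrite subr_eq0 => /eqP ->.
- apply: bopP => x; rewrite op_compE; apply: uniq => [|c Cc]; first exact: pC.
  by rewrite subrr rdot0l.
- exact: uniq.
Qed.

Section ColumnsToRigged.
Context {R : realType}.
Variable A : operatorAlgebraType R.
Hypothesis hA : approximately_unital A.
Variable H : hilbertType R.
Variable f : {linear A -> 'B(H, H)}.
Hypothesis hf : complete_isometry f.
Hypothesis fM : forall a b, f (oamul a b) = f a *o f b.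
Variable P : {linear Cinfty A -> Cinfty A}.
Hypothesis Pmult : left_multiplier P.
Hypothesis P1 : multiplier_norm P <= 1.
Hypothesis PP : forall x, P (P x) = P x.
Hypothesis Pmod : forall x a, P (rmulC hf fM (P x) a) = rmulC hf fM (P x) a.

Local Notation col := (colf hf).

(** By [multiplier_orth], [col (P x) h] lies in [C], while [col x h - col (P x) h] is orthogonal to
    [C] by definition. Taking a complement rather than the span of the images of [P] makes
    closedness a matter of continuity; off the span of all columns [p] is the identity. *)
Lemma multiplier_projection : exists p : 'B(ell2 H, ell2 H),
  [/\ selfadj p, p *o p = p & forall x, p *o col x = col (P x)].
Proof.
(* [C] is the orthogonal complement of the columns killed by [P]. *)
pose C : set (ell2 H) := [set z | forall x h, hdot (ell2 H) z (col (x - P x) h) = 0].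
have C0 : C 0 by move=> x h; rewrite -[0](scale0r (0 : ell2 H)) hdotZl mul0r.
have CD (c : R[i]) x y : C x -> C y -> C (c *: x + y).
  by move=> Cx Cy z h; rewrite hdotDl hdotZl Cx Cy mulr0 addr0.
have Ccl : approx_closed C.
  move=> z hz x h; set v := col _ h.
  apply/eqP; rewrite -normr_eq0 modcE; apply/eqP; congr (_%:C).
  apply/eqP; rewrite eq_le modc_ge0 andbT; apply/ler_addgt0Pl => e e0; rewrite addr0.
  have v0 : 0 < nr v + 1 by rewrite ltr_wpDl ?nr_ge0.
  have [c Cc zc] := hz (e / (nr v + 1)) ltac:(by rewrite divr_gt0).
  have -> : hdot (ell2 H) z v = hdot (ell2 H) (z - c) v.
    by rewrite hdotDl -[- c]scaleN1r hdotZl Cc mulr0 addr0.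
  apply: le_trans (modc_hdot _ _) _.
  apply: (@le_trans _ _ (e / (nr v + 1) * (nr v + 1))).
    by apply: ler_pM; rewrite ?nr_ge0 ?lerDl// ltW.
  by rewrite divfK// gt_eqF.
have [p [pa pp pE]] := projection_exists C0 CD Ccl.
exists p; split=> // x; apply: bopP => h; rewrite op_compE; apply: pE.
  move=> y k; apply: hdot0P => c; rewrite -bopZ.
  exact: (multiplier_orth hA Pmult P1 PP Pmod).
by move=> c Cc; rewrite -bopBE -linearB rdotC; apply: hdot0_rdot; exact: Cc.
Qed.

(** * The TRO generated by the columns of the projection *)

Variable p : 'B(ell2 H, ell2 H).
Hypothesis pa : selfadj p.
Hypothesis pp : p *o p = p.
Hypothesis pcol : forall x, p *o col x = col (P x).

Let padj : p^adj = p.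
Proof. by apply: adj_uniq => x y; exact: pa. Qed.

Definition coef k l : 'B(H, H) := crd H k *o p *o eps H l.

Lemma coef_adj k l : (coef k l)^adj = coef l k.
Proof. by rewrite /coef !adj_comp padj crd_adj eps_adj op_compA. Qed.

(** [p *o eps H l *o f a] is the image under [P] of a column over [A], so its entries stay in
    [A]. *)
Lemma coef_range k l a : range f (coef k l *o f a).
Proof.
exists (P (single hf l a) k) => //.
by rewrite /coef -op_compA -colf_single -op_compA pcol crd_colf.
Qed.

Fixpoint word (w : seq (nat * nat)) : 'B(H, H) :=
  if w is (k, l) :: w' then coef k l *o word w' else bop1 H.

Lemma word_cat v w : word (v ++ w) = word v *o word w.
Proof.
elim: v => [|[k l] v IH] /=; first by rewrite op_comp1l.
by rewrite IH op_compA.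
Qed.

Definition word_adj (w : seq (nat * nat)) := rev [seq (kl.2, kl.1) | kl <- w].

Lemma adj_word w : (word w)^adj = word (word_adj w).
Proof.
rewrite /word_adj; elim: w => [|[k l] w IH]; first exact: adj1.
rewrite /= adj_comp IH coef_adj rev_cons -cats1 word_cat /=.
by rewrite op_comp1r.
Qed.

Lemma word_range w a : range f (word w *o f a).
Proof.
elim: w => [|[k l] w [b _ hb]] /=; first by rewrite op_comp1l; exists a.
by rewrite -op_compA -hb; exact: coef_range.
Qed.

Definition tro_gen (jw : nat * seq (nat * nat)) : 'B(H, ell2 H) :=
  p *o eps H jw.1 *o word jw.2.

(** Numbers that encode nothing get the pair [(0, [::])], so the range still consists of generators
    only. *)
Definition tro_gens (i : nat) : 'B(H, ell2 H) :=
  tro_gen (odflt (0%N, [::]) (pickle_inv i)).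

Lemma tro_gensP jw : range tro_gens (tro_gen jw).
Proof. by exists (pickle jw) => //; rewrite /tro_gens pickleK_inv. Qed.

(* [p *o eps H k] need not be approximable by finitely supported columns, so
   the span of all [p *o eps H k] over a large algebra of coefficients need not
   be a sigma-TRO; only the countably many words are used, which makes the TRO
   separable. *)
Definition column_TRO : set 'B(H, ell2 H) := norm_closure (lin_span (range tro_gens)).

Local Notation M := column_TRO.

Let M_gen x : range tro_gens x -> M x.
Proof. by move=> hx; apply/norm_closure_id/lin_span_gen. Qed.

Let Msub : linear_subspace M. Proof. exact: norm_closure_span_subspace. Qed.
Let Mcl : norm_closure M `<=` M. Proof. exact: norm_closureK. Qed.
Let M0 : M 0. Proof. exact: Msub.1. Qed.
Let MD x y : M x -> M y -> M (x + y).
Proof. by move=> Mx My; rewrite -[x]scale1r; exact: Msub.2. Qed.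
Let MZ c x : M x -> M (c *: x).
Proof. by move=> Mx; have := Msub.2 c x 0 Mx M0; rewrite addr0. Qed.

(** The two copies of [p] merge, and [crd H k *o p *o eps H l] is the single letter [coef k l]. This
    is why words are closed under the triple product. *)
Lemma tro_gen_adj_mul k v l u :
  (tro_gen (k, v))^adj *o tro_gen (l, u) = word (word_adj v ++ (k, l) :: u).
Proof.
rewrite /tro_gen word_cat /= -adj_word !adj_comp padj eps_adj /coef.
by rewrite !op_compA -[_ *o p *o p]op_compA pp.
Qed.

Lemma tro_gen_triple x y z : range tro_gens x -> range tro_gens y -> range tro_gens z ->
  range tro_gens (x *o y^adj *o z).
Proof.
move=> [i _ <-] [j _ <-] [k _ <-]; rewrite /tro_gens.
case: (odflt _ _) => j1 w1; case: (odflt _ _) => j2 w2; case: (odflt _ _) => j3 w3.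
rewrite -op_compA tro_gen_adj_mul.
have -> : tro_gen (j1, w1) *o word (word_adj w2 ++ (j2, j3) :: w3) =
    tro_gen (j1, w1 ++ word_adj w2 ++ (j2, j3) :: w3).
  by rewrite /tro_gen /= [in RHS]word_cat op_compA.
exact: tro_gensP.
Qed.

(** The existential scalar [d] admits conjugate linear [g], needed when the variable occurs under an
    adjoint. *)
Lemma column_TRO_ind (H1 K1 : hilbertType R) (g : 'B(H, ell2 H) -> 'B(H1, K1)) (C : R)
    (N : set 'B(H1, K1)) :
  norm_closure N `<=` N -> N 0 -> (forall x y, N x -> N y -> N (x + y)) ->
  (forall c x, N x -> N (c *: x)) ->
  (forall x y, nrm (g x - g y) <= C * nrm (x - y)) -> g 0 = 0 ->
  (forall x y, g (x + y) = g x + g y) ->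
  (forall c x, exists d, g (c *: x) = d *: g x) ->
  (forall jw, N (g (tro_gen jw))) -> forall x, M x -> N (g x).
Proof.
move=> Ncl N0 ND NZ gC g0 gD gZ Ng x Mx; apply: Ncl; move: x Mx.
apply: (norm_closure_image gC) => x hx; apply: norm_closure_id; move: x hx.
apply: lin_span_ind => [|x y Nx Ny|c x Nx|_ [i _ <-]].
- by rewrite g0.
- by rewrite gD; exact: ND.
- by have [d ->] := gZ c x; exact: NZ.
- exact: Ng.
Qed.

(** The three factors are extended from generators to [M] one at a time, each time with the other
    two fixed. *)
Lemma column_TRO_is_TRO : is_TRO M.
Proof.
split; first exact: Msub.
have h1 x y z : range tro_gens y -> range tro_gens z -> M x -> M (x *o y^adj *o z).
  move=> hy hz; move: x.
  apply: (@column_TRO_ind _ _ (fun x => x *o y^adj *o z) (nrm y^adj * nrm z) M Mcl M0 MD MZ).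
  - move=> x x'; rewrite -!op_compBl mulrC mulrA.
    apply: le_trans (nrm_comp _ _) _; rewrite ler_wpM2r ?nrm_ge0//.
    exact: nrm_comp.
  - by rewrite !op_comp0l.
  - by move=> x x'; rewrite !op_compDl.
  - by move=> c x; exists c; rewrite !op_compZl.
  - by move=> jw; exact: M_gen (tro_gen_triple (tro_gensP jw) hy hz).
have h2 x y z : M x -> range tro_gens z -> M y -> M (x *o y^adj *o z).
  move=> hx hz; move: y.
  apply: (@column_TRO_ind _ _ (fun y => x *o y^adj *o z) (nrm x * nrm z) M Mcl M0 MD MZ).
  - move=> y y'; rewrite -op_compBl -op_compBr -adjB mulrAC.
    apply: le_trans (nrm_comp _ _) _; rewrite ler_wpM2r ?nrm_ge0//.
    by apply: le_trans (nrm_comp _ _) _; rewrite nrm_adj.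
  - by rewrite adj0 op_comp0r op_comp0l.
  - by move=> y y'; rewrite adjD op_compDr op_compDl.
  - by move=> c y; exists (conjc c); rewrite adjZ op_compZr op_compZl.
  - by move=> jw; exact: h1 (tro_gensP jw) hz hx.
move=> x y z hx hy; move: z.
apply: (@column_TRO_ind _ _ (fun z => x *o y^adj *o z) (nrm (x *o y^adj)) M Mcl M0 MD MZ).
- by move=> z z'; rewrite -op_compBr; exact: nrm_comp.
- by rewrite op_comp0r.
- by move=> z z'; rewrite op_compDr.
- by move=> c z; exists c; rewrite op_compZr.
- by move=> jw; exact: h2 hx (tro_gensP jw) hy.
Qed.

Lemma column_TRO_sigma : is_sigma_TRO M.
Proof.
have Mx k : M (tro_gens k) by apply: M_gen; exists k.
exact: (separable_sigma_TRO column_TRO_is_TRO Mcl Mx (fun _ => id)).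
Qed.

Let range_cl : norm_closure (range f) `<=` range f.
Proof.
move=> T hT; have [e e0|x <-] := rep_closed hf (T := T); last by exists x.
by have [_ [x _ <-] hx] := hT e e0; exists x.
Qed.

Let range0 : range f 0. Proof. by exists 0; rewrite ?linear0. Qed.
Let rangeD S T : range f S -> range f T -> range f (S + T).
Proof. by move=> [a _ <-] [b _ <-]; exists (a + b); rewrite ?linearD. Qed.
Let rangeZ c S : range f S -> range f (c *: S).
Proof. by move=> [a _ <-]; exists (c *: a); rewrite ?linearZ. Qed.

Lemma column_TRO_acts x y a : M x -> M y -> range f (x^adj *o y *o f a).
Proof.
have h1 y' jw : M y' -> range f ((tro_gen jw)^adj *o y' *o f a).
  move: y'; apply: (@column_TRO_ind _ _ (fun y' => (tro_gen jw)^adj *o y' *o f a)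
    (nrm (tro_gen jw)^adj * nrm (f a)) (range f) range_cl range0 rangeD rangeZ).
  - move=> z z'; rewrite -op_compBl -op_compBr mulrAC.
    apply: le_trans (nrm_comp _ _) _; rewrite ler_wpM2r ?nrm_ge0//.
    exact: nrm_comp.
  - by rewrite op_comp0r op_comp0l.
  - by move=> z z'; rewrite op_compDr op_compDl.
  - by move=> c z; exists c; rewrite op_compZr op_compZl.
  - by case: jw => k v [l u]; rewrite tro_gen_adj_mul; exact: word_range.
move=> Mx My; move: x Mx.
apply: (@column_TRO_ind _ _ (fun x => x^adj *o y *o f a) (nrm y * nrm (f a)) (range f) range_cl range0 rangeD rangeZ).
- move=> z z'; rewrite -!op_compBl -adjB mulrC mulrA.
  apply: le_trans (nrm_comp _ _) _; rewrite ler_wpM2r ?nrm_ge0//.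
  by apply: le_trans (nrm_comp _ _) _; rewrite nrm_adj.
- by rewrite adj0 !op_comp0l.
- by move=> z z'; rewrite adjD !op_compDl.
- by move=> c z; exists (conjc c); rewrite adjZ !op_compZl.
- by move=> jw; exact: h1.
Qed.

Lemma tro_gen_col jw a : exists x, tro_gen jw *o f a = col (P x).
Proof.
have [b _ hb] := word_range jw.2 a.
exists (single hf jw.1 b).
by rewrite -pcol colf_single hb /tro_gen !op_compA.
Qed.

(** [x = P x] is approximated by [P] of a truncation, a sum of [p *o eps H k *o f (x k)]; here the
    empty word suffices. *)
Lemma col_closed_span x : P x = x -> closed_span_comp M (range f) (col x).
Proof.
move=> Px e e0; have e2 : 0 < e / 2 by rewrite divr_gt0.
have [N hN] := trunc_col_cvg hf x e2.
exists (col (P (trunc_col hf N x))).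
  rewrite !linear_sum; elim/big_ind: _ => [||k _].
  - exact: lin_span0.
  - by move=> ? ? ? ?; exact: lin_spanD.
  apply: lin_span_gen; exists (tro_gen (k : nat, [::])); first exact/M_gen/tro_gensP.
  exists (f (x k)); first by exists (x k).
  by rewrite /tro_gen /= op_comp1r -op_compA -colf_single pcol.
rewrite -[in X in X - _]Px -linearB -linearB.
apply: le_lt_trans (multiplier_nrm hf Pmult P1 _) _.
by apply: le_lt_trans (hN N (leqnn _)) _; rewrite ltr_pdivrMr// mulr_natr mulr2n ltrDl.
Qed.

End ColumnsToRigged.

Lemma complemented_sigma_Delta_rigged (R : realType) (A : operatorAlgebraType R)
    (Y : operatorSpaceType R) (act : Y -> A -> Y) : approximately_unital A ->
  orthogonally_complemented_in_columns act -> sigma_Delta_rigged act.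
Proof.
move=> hA [P [Pmult P1 PP [rho [rho_iso rho_range rho_act]]]].
have [H [f [hf fM]]] := @operator_algebra_rep R A.
have rho_mod y a : rho (act y a) = rmulC hf fM (rho y) a.
  by apply: CinftyP => k; rewrite rho_act rmulCE.
have Prho y : P (rho y) = rho y.
  have : range P (rho y) by rewrite -rho_range; exists y.
  by move=> [x _ <-]; rewrite PP.
have rhoP x : exists y, rho y = P x.
  have : range rho (P x) by rewrite rho_range; exists x.
  by move=> [y _ <-]; exists y.
(* The range of [P] is a submodule because it is the range of the module map [rho]. This half of the
   module property comes from [Y]; the other half concerns the kernel of [P]. *)
have Pmod x a : P (rmulC hf fM (P x) a) = rmulC hf fM (P x) a.
  by have [y <-] := rhoP x; rewrite -rho_mod Prho.
have [p [pa pp pcol]] := multiplier_projection hA Pmult P1 PP Pmod.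
have lr : linear (fun y => colf hf (rho y)) by move=> c x y; rewrite !linearP.
pose rho1 := mklinear lr.
have rho1_iso : complete_isometry rho1.
  move=> n y; rewrite -rho_iso -(colf_isometry hf).
  by congr mxnorm; apply/matrixP => i j; rewrite !mxE.
exists H, (ell2 H), f, (column_TRO p), rho1; split.
- by split; [exact: hf|exact: fM].
- split; first exact: (column_TRO_sigma pa pp).
  by move=> x y a; exact: (column_TRO_acts pa pp pcol).
- exact: rho1_iso.
- apply/seteqP; split=> [_ [y _ <-]|T hT].
    by apply: (col_closed_span Pmult P1 pcol); exact: Prho.
  (* The range of [rho1] is closed, so it is enough to treat products [z *o f a], and by continuity
     in [z] only generators, where [tro_gen_col] applies. *)
  have [e e0|y <-] := rep_closed rho1_iso (T := T); last by exists y.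
  suff [_ [y _ <-] hy] : exists2 S, range rho1 S & nrm (T - S) < e by exists y.
  have cl : norm_closure (range rho1) `<=` range rho1.
    move=> S hS; have [d d0|x <-] := rep_closed rho1_iso (T := S); last by exists x.
    by have [_ [x _ <-] hx] := hS d d0; exists x.
  have rD S S' : range rho1 S -> range rho1 S' -> range rho1 (S + S').
    by move=> [a _ <-] [b _ <-]; exists (a + b); rewrite ?linearD.
  have rZ c S : range rho1 S -> range rho1 (c *: S).
    by move=> [a _ <-]; exists (c *: a); rewrite ?linearZ.
  have r0 : range rho1 0 by exists 0; rewrite ?linear0.
  have [S hS TS] := hT e e0; exists S => //; move: S hS {TS}.
  apply: lin_span_ind => // _ [z Mz [_ [a _ <-] <-]]; move: z Mz.
  apply: (@column_TRO_ind _ _ _ _ _ (fun z => z *o f a) (nrm (f a)) (range rho1) cl r0 rD rZ).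
  + by move=> z z'; rewrite -op_compBl mulrC nrm_comp.
  + by rewrite op_comp0l.
  + by move=> z z'; rewrite op_compDl.
  + by move=> c z; exists c; rewrite op_compZl.
  + move=> jw; have [x ->] := tro_gen_col pcol jw a.
    by have [y <-] := rhoP x; exists y.
- by move=> y a; rewrite !mklinearE rho_mod colf_rmulC.
Qed.

Theorem theorem2p2 (R : realType) (A : operatorAlgebraType R)
    (hA : approximately_unital A)
    (Y : operatorSpaceType R) (act : Y -> A -> Y)
    (hact : operator_module act) :
  sigma_Delta_rigged act <-> orthogonally_complemented_in_columns act.
Proof.
split; first exact: sigma_Delta_rigged_complemented.
exact: complemented_sigma_Delta_rigged.
Qed.
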